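(* Let $m,n_1,n_2\in\mathbb{N}$ and let $\psi_1:\mathcal{M}_{n_1}\to\mathcal{M}_m$ and $\psi_2:\mathcal{M}_{n_2}\to\mathcal{M}_m$ be unital completely positive maps with $\psi_1$ faithful. Let $k\in\mathbb{N}$ and let $a=(a_1,\dots,a_k)\in\mathcal{M}_{n_1}^k$ and $b=(b_1,\dots,b_k)\in\mathcal{M}_{n_2}^k$ be $k$-tuples of self-adjoint matrices. The following are equivalent: (1) $a\prec_{\psi_1,\psi_2}b$; (2) for every $p\in\mathbb{N}$ with $p\le 2n_2^2+2$, every $q,r_1,\dots,r_q\in\mathbb{N}$ and all $h_i\in\mathcal{M}_{r_i}(\mathcal{M}_p(\mathrm{A}(K)))$, $1\le i\le q$, if $G:K\to\mathcal{M}_p(\mathcal{M})_{\mathrm{sa}}$ is the multivalued nc function defined by $$G(x)=\bigcap_{i=1}^q\{\alpha\in\mathcal{M}_p(\mathcal{M}_n)_{\mathrm{sa}}:1_{r_i}\otimes\alpha\ge h_i(x)\}\qquad(n\le\infty,\ x\in K_n),$$ then $$(\mathrm{id}_{\mathcal{M}_p}\otimes\psi_1)(G(a))\le(\mathrm{id}_{\mathcal{M}_p}\otimes\psi_2)(G(b)).$$ Here $K$ is any closed nc $k$-ball containing $a$ and $b$.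
   Context: Conventions. Indices $m,n,p\le\infty$ range over $\{1,2,\dots\}\cup\{\infty\}$. For each $n\le\infty$ fix a complex Hilbert space $H_n$ of dimension $n$ ($H_\infty$ of countably infinite dimension). $\mathcal{M}_{m,n}$ is the space of bounded operators $H_n\to H_m$ with the weak* topology (the norm topology if $m,n<\infty$); $\mathcal{M}_n=\mathcal{M}_{n,n}$ with identity $1_n$; $\mathcal{M}=\sqcup_{n\le\infty}\mathcal{M}_n$. $\mathcal{M}_p(\mathcal{M}_n)$ is identified with the bounded operators on $H_p\otimes H_n$, and $\mathcal{M}_p(\mathcal{M})=\sqcup_n\mathcal{M}_p(\mathcal{M}_n)$. The subscript sa denotes self-adjoint elements, the superscript $+$ positive elements, and $\alpha\ge\beta$ means $\alpha-\beta$ is positive. $\mathcal{M}_n^k$ has the product topology, and for $x=(x_1,\dots,x_k)\in\mathcal{M}_n^k$, $\alpha x\beta=(\alpha x_1\beta,\dots,\alpha x_k\beta)$. A positive linear map $\psi:\mathcal{M}_n\to\mathcal{M}_m$ is faithful if $\ker\psi\cap\mathcal{M}_n^+=\{0\}$. Closed nc $k$-ball. For $r>0$, the closed nc $k$-ball of radius $r$ is the graded set $K=\sqcup_{n\le\infty}K_n$ with $K_n=\{x=(x_1,\dots,x_k)\in\mathcal{M}_n^k:\sum_{i=1}^k x_ix_i^*\le r^2 1_n\}$. Continuous affine nc functions. An affine nc function on $K$ is a function $f:K\to\mathcal{M}$ such that $f(K_n)\subseteq\mathcal{M}_n$ for all $n\le\infty$; $f(\sum_i\alpha_ix_i\alpha_i^*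 )=\sum_i\alpha_if(x_i)\alpha_i^*$ for every bounded sequence $x_i\in K_{n_i}$ and isometries $\alpha_i\in\mathcal{M}_{n,n_i}$ with $\sum_i\alpha_i\alpha_i^*=1_n$; and $f(\gamma^*x\gamma)=\gamma^*f(x)\gamma$ for all $x\in K_n$ and all isometries $\gamma\in\mathcal{M}_{n,m}$ (in particular all unitaries). It is continuous if $f|_{K_n}:K_n\to\mathcal{M}_n$ is continuous for every $n\le\infty$. $\mathrm{A}(K)$ is the space of continuous affine nc functions on $K$. An element $h\in\mathcal{M}_r(\mathcal{M}_p(\mathrm{A}(K)))$ (a matrix of elements of $\mathrm{A}(K)$) is evaluated entrywise, so $h(x)\in\mathcal{M}_r(\mathcal{M}_p(\mathcal{M}_n))$ for $x\in K_n$. Multivalued nc functions. Let $K$ be a closed nc $k$-ball and $p\le\infty$. A multivalued nc function $F:K\to\mathcal{M}_p(\mathcal{M})$ assigns to every $n\le\infty$ and $x\in K_n$ a nonempty set $F(x)\subseteq\mathcal{M}_p(\mathcal{M}_n)_{\mathrm{sa}}$ such that $F(\alpha^*x\alpha)=(1_p\otimes\alpha^* )F(x)(1_p\otimes\alpha)$ for every unitary $\alpha\in\mathcal{M}_n$, and $F(x)=F(x)+\mathcal{M}_p(\mathcal{M}_n)^+$. It is bounded if there is $\lambda>0$ such that for every $x\in K$ and $\beta\in F(x)$ there is $\alpha\in F(x)$ with $\alpha\le\beta$ and $\|\alpha\|\le\lambda$. Its graph is $\mathrm{Graph}(F)=\sqcup_n\mathrm{Graph}_n(F)$ with $\mathrm{Graph}_n(F)=\{(x,T):x\in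 K_n,\ T\in F(x)\}\subseteq K_n\times\mathcal{M}_p(\mathcal{M}_n)$. $F$ is convex if $\mathrm{Graph}(F)$ is an nc convex set, i.e. for every $n\le\infty$, every bounded sequence $(x_i,T_i)\in\mathrm{Graph}_{n_i}(F)$ and every sequence $\alpha_i\in\mathcal{M}_{n_i,n}$ with $\sum_i\alpha_i^*\alpha_i=1_n$, one has $\big(\sum_i\alpha_i^*x_i\alpha_i,\ \sum_i(1_p\otimes\alpha_i^* )T_i(1_p\otimes\alpha_i)\big)\in\mathrm{Graph}_n(F)$. $F$ is lower semicontinuous if each $\mathrm{Graph}_n(F)$ is closed in $\mathcal{M}_n^k\times\mathcal{M}_p(\mathcal{M}_n)$ (weak* topologies). An nc majorization function is a bounded lower semicontinuous convex multivalued nc function $F:K\to\mathcal{M}_p(\mathcal{M})$, for some $p\le\infty$. Majorization. For a unital completely positive map $\psi:\mathcal{M}_n\to\mathcal{M}_m$ and $x\in K_n$, $(\mathrm{id}_{\mathcal{M}_p}\otimes\psi)(F(x))=\{(\mathrm{id}_{\mathcal{M}_p}\otimes\psi)(\alpha):\alpha\in F(x)\}$. For two sets $S,T$ of self-adjoint elements, $S\le T$ means that for every $\beta\in T$ there is $\alpha\in S$ with $\alpha\le\beta$. With $\psi_1,\psi_2,a,b$ as in the claim, $a\prec_{\psi_1,\psi_2}b$ means $$(\mathrm{id}_{\mathcal{M}_p}\otimes\psi_1)(F(a))\le(\mathrm{id}_{\mathcal{M}_p}\otimes\psi_2)(F(b))$$ for every $p\le\infty$ and every nc majorization function $F:K\to\mathcal{M}_p(\mathcal{M})$,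 where $K$ is any closed nc $k$-ball containing $a$ and $b$. *)

(* Defs.v *)
From HB Require Import structures.
From mathcomp Require Import all_boot all_order all_algebra.
From mathcomp Require Import complex.
From mathcomp Require Import all_classical all_reals all_analysis.
From mathcomp.analysis Require showcase.summability.
From mathcomp Require Import ring lra.
Set Implicit Arguments.
Unset Strict Implicit.
Unset Printing Implicit Defensive.
Import Order.TTheory GRing.Theory Num.Theory.
Import numFieldNormedType.Exports.
Local Open Scope classical_set_scope.
Local Open Scope ring_scope.

Section Ell2.
Variable R : realType.

Definition normsq (z : R[i]) : R := complex.Re z ^+ 2 + complex.Im z ^+ 2.

Lemma normsq_ge0 z : 0 <= normsq z.
Proof. by rewrite addr_ge0 ?sqr_ge0. Qed.

Lemma normsq0 : normsq 0 = 0.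
Proof. by rewrite /normsq /= expr0n/= addr0. Qed.

Lemma normsqM z w : normsq (z * w) = normsq z * normsq w.
Proof. case: z w => [a b] [c d]; rewrite /normsq /=; ring. Qed.

Lemma normsqD z w : normsq (z + w) <= 2 * normsq z + 2 * normsq w.
Proof.
case: z w => [a b] [c d]; rewrite /normsq /= -subr_ge0.
suff -> : 2 * (a ^+ 2 + b ^+ 2) + 2 * (c ^+ 2 + d ^+ 2) -
    ((a + c) ^+ 2 + (b + d) ^+ 2) = (a - c) ^+ 2 + (b - d) ^+ 2.
  by rewrite addr_ge0 ?sqr_ge0.
by ring.
Qed.

Lemma esumZ_le (I : choiceType) (c : R) (a : I -> \bar R) : 0 <= c ->
  (forall i, 0 <= a i)%E ->
  (\esum_(i in [set: I]) (c%:E * a i) <= c%:E * \esum_(i in [set: I]) a i)%E.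
Proof.
move=> c0 a0; rewrite ge_ereal_sup// => _ [X XI <-].
rewrite -ge0_mule_fsumr//; apply: lee_wpmul2l; first by rewrite lee_fin.
by apply: esum_ge; exists X.
Qed.

Definition sqsum (I : choiceType) (f : I -> R[i]^o) : \bar R :=
  \esum_(i in [set: I]) (normsq (f i))%:E.

Lemma sqsum_ge0 (I : choiceType) (f : I -> R[i]^o) : (0 <= sqsum f)%E.
Proof. by apply: esum_ge0 => i _; rewrite lee_fin normsq_ge0. Qed.

Lemma sqsum0 (I : choiceType) : sqsum (0 : I -> R[i]^o) = 0%E.
Proof. by apply: esum1 => i _; rewrite normsq0. Qed.

Lemma sqsum_lin (I : choiceType) (c : R[i]) (f g : I -> R[i]^o) :
  (sqsum (c *: f + g)%R <=
   (2 * normsq c)%:E * sqsum f + 2%:E * sqsum g)%E.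
Proof.
have n0 (h : I -> R[i]^o) i : (0 <= (normsq (h i))%:E)%E.
  by rewrite lee_fin normsq_ge0.
have c0 : 0 <= 2 * normsq c by rewrite mulr_ge0 ?normsq_ge0.
apply: (@le_trans _ _ (\esum_(i in [set: I])
  ((2 * normsq c)%:E * (normsq (f i))%:E + 2%:E * (normsq (g i))%:E))%E).
  apply: le_esum => i _; rewrite -!EFinM -EFinD lee_fin.
  apply: le_trans (normsqD (c * f i) (g i)) _.
  by rewrite normsqM mulrA.
rewrite esumD; last 2 first.
- by move=> i _; rewrite mule_ge0.
- by move=> i _; rewrite mule_ge0// lee_fin.
by apply: leeD; apply: esumZ_le.
Qed.

Definition ell2_pred (I : choiceType) : {pred (I -> R[i]^o)} :=
  fun f => (sqsum f < +oo)%E.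

Record ell2 (I : choiceType) :=
  Ell2 { ell2_fun :> I -> R[i]^o; _ : ell2_pred ell2_fun }.

HB.instance Definition _ (I : choiceType) := [isSub for @ell2_fun I].
HB.instance Definition _ (I : choiceType) := [Choice of ell2 I by <:].

Lemma ell2_submod (I : choiceType) : submod_closed (@ell2_pred I).
Proof.
split=> [|c f g]; rewrite !unfold_in /ell2_pred; first by rewrite sqsum0 ltry.
move=> ff gf; apply: le_lt_trans (sqsum_lin _ _ _) _.
by rewrite lte_add_pinfty// lte_mul_pinfty// lee_fin mulr_ge0 ?normsq_ge0.
Qed.

HB.instance Definition _ (I : choiceType) := GRing.SubChoice_isSubLmodule.Build R[i]
  (I -> R[i]^o) (@ell2_pred I) (ell2 I) (@ell2_submod I).

Definition norm2 (I : choiceType) (u : ell2 I) : R := Num.sqrt (fine (sqsum u)).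

Definition inner (I : choiceType) (u v : ell2 I) : R[i]^o :=
  lim (summability.partial_sum (fun i => u i * (v i)^*%C : R[i]^o) @
       summability.totally).

Definition bounded_map (I J : choiceType) (f : ell2 I -> ell2 J) : Prop :=
  exists M : R, forall u, norm2 (f u) <= M * norm2 u.

Lemma bounded_mapP (I J : choiceType) (f : ell2 I -> ell2 J) :
  bounded_map f <->
  exists2 N : R, 0 <= N & forall u, (sqsum (f u) <= N%:E * sqsum u)%E.
Proof.
have fin (K : choiceType) (u : ell2 K) : (fine (sqsum u))%:E = sqsum u.
  by rewrite fineK// ge0_fin_numE ?sqsum_ge0//; case: u.
have fge0 (K : choiceType) (u : ell2 K) : 0 <= fine (sqsum u).
  by rewrite fine_ge0 ?sqsum_ge0.
split=> [[M fM]|[N N0 fN]].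
  exists (M ^+ 2) => [|u]; first exact: sqr_ge0.
  rewrite -(fin _ (f u)) -(fin _ u) -EFinM lee_fin.
  rewrite -(sqr_sqrtr (fge0 _ (f u))) -(sqr_sqrtr (fge0 _ u)) -exprMn.
  by apply: lerXn2r; rewrite ?nnegrE ?(le_trans (sqrtr_ge0 _) (fM u))
    ?sqrtr_ge0//; exact: fM.
exists (Num.sqrt N) => u; rewrite /norm2 -sqrtrM//.
by rewrite ler_sqrt ?mulr_ge0// -lee_fin EFinM !fin.
Qed.

Definition bop_pred (I J : choiceType) : {pred (ell2 I -> ell2 J)} :=
  fun f => `[< linear f /\ bounded_map f >].

Record bop (I J : choiceType) :=
  Bop { bop_fun :> ell2 I -> ell2 J; _ : bop_pred bop_fun }.

HB.instance Definition _ (I J : choiceType) := [isSub for @bop_fun I J].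
HB.instance Definition _ (I J : choiceType) := [Choice of bop I J by <:].

Lemma bop_submod (I J : choiceType) : submod_closed (@bop_pred I J).
Proof.
split=> [|c f g]; rewrite !unfold_in /bop_pred.
  apply/asboolP; split=> [a u v|]; first by rewrite scaler0 addr0.
  by apply/bounded_mapP; exists 0 => // u; rewrite sqsum0 mul0e.
move=> /asboolP[lf /bounded_mapP[M M0 fM]] /asboolP[lg /bounded_mapP[N N0 gN]].
apply/asboolP; split=> [a u v|].
  rewrite -[LHS]/(c *: f (a *: u + v) + g (a *: u + v)) lf lg.
  rewrite -[(c *: f + g) u]/(c *: f u + g u) -[(c *: f + g) v]/(c *: f v + g v).
  by rewrite !scalerDr !scalerA (mulrC c) addrACA.
apply/bounded_mapP; exists (2 * normsq c * M + 2 * N) => [|u].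
  by rewrite addr_ge0 ?mulr_ge0 ?normsq_ge0.
apply: (le_trans (sqsum_lin c (f u) (g u))).
rewrite (EFinD (_ * M)) ge0_muleDl ?lee_fin ?mulr_ge0 ?normsq_ge0//.
rewrite (EFinM _ M) (EFinM _ N) -!muleA; apply: leeD; apply: lee_wpmul2l.
- by rewrite lee_fin mulr_ge0 ?normsq_ge0.
- exact: fM.
- by rewrite lee_fin.
- exact: gN.
Qed.

HB.instance Definition _ (I J : choiceType) :=
  GRing.SubChoice_isSubLmodule.Build R[i]
    (ell2 I -> ell2 J) (@bop_pred I J) (bop I J) (@bop_submod I J).

Lemma bop_linear (I J : choiceType) (T : bop I J) : linear T.
Proof. by case: T => f /= /asboolP[]. Qed.

Lemma bop_bounded (I J : choiceType) (T : bop I J) : bounded_map T.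
Proof. by case: T => f /= /asboolP[]. Qed.

HB.instance Definition _ (I J : choiceType) (T : bop I J) :=
  GRing.isLinear.Build R[i] (ell2 I) (ell2 J) *:%R T (@bop_linear I J T).

Lemma idop_proof (I : choiceType) : bop_pred (@id (ell2 I)).
Proof. by apply/asboolP; split=> //; exists 1 => u; rewrite mul1r. Qed.
Definition idop (I : choiceType) : bop I I := Bop (idop_proof I).

Lemma compop_proof (I J K : choiceType) (S : bop J K) (T : bop I J) :
  bop_pred (S \o T).
Proof.
apply/asboolP; split=> [a u v|]; first by rewrite /= !linearP.
have /bounded_mapP[M M0 SM] := bop_bounded S.
have /bounded_mapP[N N0 TN] := bop_bounded T.
apply/bounded_mapP; exists (M * N) => [|u]; first exact: mulr_ge0.
by rewrite EFinM -muleA (le_trans (SM _))// lee_wpmul2l.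
Qed.
Definition compop (I J K : choiceType) (S : bop J K) (T : bop I J) : bop I K :=
  Bop (compop_proof S T).

(* By the Riesz representation theorem there is exactly one such [S]. *)
Definition adj (I J : choiceType) (T : bop I J) : bop J I :=
  xget 0 [set S : bop J I | forall u v, inner (T u) v = inner u (S v)].

Definition opnorm (I J : choiceType) (T : bop I J) : R :=
  inf [set M : R | 0 <= M /\ forall u, norm2 (T u) <= M * norm2 u].

Definition selfadj (I : choiceType) (T : bop I I) : Prop := adj T = T.

(* [0 <= z] in R[i] forces [z] to be real. *)
Definition oppos (I : choiceType) (T : bop I I) : Prop :=
  forall u, 0 <= inner (T u) u.

Definition ople (I : choiceType) (S T : bop I I) : Prop := oppos (T - S).

Definition isometry_op (I J : choiceType) (T : bop I J) : Prop :=
  compop (adj T) T = idop I.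

Definition unitary_op (I : choiceType) (T : bop I I) : Prop :=
  compop (adj T) T = idop I /\ compop T (adj T) = idop I.

(* ell2 (I * J) = ell2 I (x) ell2 J, with e_(i, j) = e_i (x) e_j *)

Lemma sqsum_prod (I J : choiceType) (f : I * J -> R[i]^o) :
  sqsum f = (\esum_(i in [set: I]) sqsum (fun j => f (i, j)))%E.
Proof.
rewrite /sqsum esum_esum; last by move=> *; rewrite lee_fin normsq_ge0.
by congr esum; [apply/seteqP; split | apply/funext => -[]].
Qed.

Lemma sqsum_row (I J : choiceType) (f : I * J -> R[i]^o) (i : I) :
  (sqsum (fun j => f (i, j)) <= sqsum f)%E.
Proof.
rewrite sqsum_prod; apply: esum_ge; exists [set i].
  by split; [exact: finite_set1 | exact: subsetT].
by rewrite fsbig_set1.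
Qed.

Definition inj_fun (I J : choiceType) (i : I) (u : J -> R[i]^o) :
    I * J -> R[i]^o :=
  fun x => if x.1 == i then u x.2 else 0.

Lemma sqsum_inj (I J : choiceType) (i : I) (u : J -> R[i]^o) :
  sqsum (inj_fun i u) = sqsum u.
Proof.
rewrite sqsum_prod -(@esum_set1 _ _ i (fun=> sqsum u)) ?sqsum_ge0//.
rewrite [RHS]esum_mkcond; apply: eq_esum => i' _; rewrite /inj_fun /=.
rewrite in_set1; case: (i' == i) => //.
exact: sqsum0.
Qed.

Lemma inj_proof (I J : choiceType) (i : I) (u : ell2 J) :
  (sqsum (inj_fun i u) < +oo)%E.
Proof. by rewrite sqsum_inj; case: u. Qed.

Lemma injop_proof (I J : choiceType) (i : I) :
  bop_pred (fun u : ell2 J => Ell2 (inj_proof i u)).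
Proof.
apply/asboolP; split=> [a u v|].
  apply/val_inj/funext => -[i' j] /=.
  rewrite -[RHS]/(a *: inj_fun i u (i', j) + inj_fun i v (i', j)).
  by rewrite /inj_fun /=; case: ifP => // _; rewrite scaler0 addr0.
by apply/bounded_mapP; exists 1 => // u; rewrite mul1e sqsum_inj.
Qed.

(* u |-> e_i (x) u *)
Definition injop (I J : choiceType) (i : I) : bop J (I * J)%type :=
  Bop (injop_proof J i).

Lemma row_proof (I J : choiceType) (i : I) (u : ell2 (I * J)%type) :
  (sqsum (fun j => u (i, j)) < +oo)%E.
Proof. by apply: le_lt_trans (sqsum_row _ _) _; case: u. Qed.

Lemma rowop_proof (I J : choiceType) (i : I) :
  bop_pred (fun u : ell2 (I * J)%type => Ell2 (row_proof i u)).
Proof.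
apply/asboolP; split=> [a u v|]; first exact/val_inj.
by apply/bounded_mapP; exists 1 => // u; rewrite mul1e sqsum_row.
Qed.

(* sum_i e_i (x) u_i |-> u_i *)
Definition rowop (I J : choiceType) (i : I) : bop (I * J)%type J :=
  Bop (rowop_proof J i).

Definition block (I I' J J' : choiceType) (T : bop (I * J)%type (I' * J')%type)
    (i' : I') (i : I) : bop J J' :=
  compop (rowop J' i') (compop T (injop J i)).

Definition ampl_fun (I J J' : choiceType) (T : bop J J') (u : ell2 (I * J)%type)
    : I * J' -> R[i]^o :=
  fun x => T (rowop J x.1 u) x.2.

Lemma sqsum_ampl (I J J' : choiceType) (T : bop J J') : exists2 N : R,
  0 <= N & forall u : ell2 (I * J)%type, (sqsum (ampl_fun T u) <= N%:E * sqsum u)%E.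
Proof.
have /bounded_mapP[N N0 TN] := bop_bounded T.
exists N => // u; rewrite !sqsum_prod.
apply: le_trans (esumZ_le N0 _); last by move=> i; exact: sqsum_ge0.
by apply: le_esum => i _; exact: (TN (rowop J i u)).
Qed.

Lemma ampl_proof (I J J' : choiceType) (T : bop J J') (u : ell2 (I * J)%type) :
  (sqsum (ampl_fun T u) < +oo)%E.
Proof.
have [N N0 /(_ u) /le_lt_trans] := sqsum_ampl I T; apply.
by rewrite lte_mul_pinfty// ?lee_fin// ?fin_numE//; case: u.
Qed.

Lemma amplop_proof (I J J' : choiceType) (T : bop J J') :
  bop_pred (fun u : ell2 (I * J)%type => Ell2 (ampl_proof T u)).
Proof.
apply/asboolP; split=> [a u v|].
  apply/val_inj/funext => -[i j].
  transitivity ((a *: T (rowop J i u) + T (rowop J i v)) j); last by [].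
  by rewrite -!linearP.
by apply/bounded_mapP; have [N N0 TN] := sqsum_ampl I T; exists N.
Qed.

(* 1 (x) T *)
Definition ampl (I J J' : choiceType) (T : bop J J') :
    bop (I * J)%type (I * J')%type :=
  Bop (amplop_proof I T).

(* the operator with blocks A i' i *)
Definition blockop (I I' : finType) (J J' : choiceType)
    (A : I' -> I -> bop J J') : bop (I * J)%type (I' * J')%type :=
  \sum_(i' : I') \sum_(i : I)
    compop (injop J' i') (compop (A i' i) (rowop J i)).

(* id (x) psi acts blockwise; the operator [S] exists and is unique when [J] and
   [J'] are finite and [psi] is linear, which is the only case used. *)
Definition idtens (I J J' : choiceType) (psi : bop J J -> bop J' J')
    (T : bop (I * J)%type (I * J)%type) : bop (I * J')%type (I * J')%type :=
  xget 0 [set S | forall i i' : I, block S i i' = psi (block T i i')].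

(* With u = (u_k)_k and v = (v_k)_k square-summable sequences of vectors,
   [ultraweak T (u, v)] is sum_k <T u_k, v_k>; these are the weak*-continuous
   functionals on the bounded operators. *)
Definition ultraweak (I J : choiceType) (T : bop I J) :
    {ptws (ell2 (nat * I)%type * ell2 (nat * J)%type) -> R[i]^o} :=
  fun w => inner (ampl nat T w.1) w.2.

HB.instance Definition _ (I J : choiceType) :=
  Topological.copy (bop I J) (initial_topology (@ultraweak I J)).

Definition opsum (N I J : choiceType) (T : N -> bop I J) (S : bop I J) : Prop :=
  summability.partial_sum T @ summability.totally --> S.

End Ell2.

Notation "S *o T" := (compop S T) (at level 40, left associativity).

(* The dimensions 1, 2, ..., infinity; they also index (finite or infinite)
   sequences below. H_n is [ell2 (idx n)]. *)
Inductive ncdim := Fin (n : nat) of (0 < n)%N | Infty.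

Definition idx (d : ncdim) : choiceType := if d is Fin n _ then 'I_n else nat.

(* opM R m n is M_{m,n}, the operators H_n -> H_m; opMp R p n is M_p(M_n). *)
Notation opM R m n := (bop R (idx n) (idx m)).
Notation opMp R p n :=
  (bop R (idx p * idx n)%type (idx p * idx n)%type).

Section NcBall.
Variables (R : realType) (k : nat).

Definition tuples (n : ncdim) : Type := {ptws 'I_k -> opM R n n}.
HB.instance Definition _ n := Topological.on (tuples n).

Definition conjt (n m : ncdim) (alpha : opM R m n) (x : tuples m) : tuples n :=
  fun j => adj alpha *o x j *o alpha.

Definition ncball (r : R) (n : ncdim) : set (tuples n) :=
  [set x : tuples n |
    ople (\sum_(j < k) x j *o adj (x j)) ((r ^+ 2)%:C%C *: idop R (idx n))].

Definition ncfun := forall n : ncdim, tuples n -> opM R n n.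

(* The sums converge in the weak* topology; [opsum _ (f n y)] includes the
   convergence of its left-hand side. *)
Definition affine_nc (r : R) (f : ncfun) : Prop :=
  (forall (N n : ncdim) (d : idx N -> ncdim) (x : forall i, tuples (d i))
      (alpha : forall i, opM R n (d i)) (y : tuples n),
    (forall i, ncball r (x i)) ->
    (exists c, forall i j, opnorm (x i j) <= c) ->
    (forall i, isometry_op (alpha i)) ->
    opsum (fun i => alpha i *o adj (alpha i)) (idop R (idx n)) ->
    (forall j, opsum (fun i => alpha i *o x i j *o adj (alpha i)) (y j)) ->
    opsum (fun i => alpha i *o f (d i) (x i) *o adj (alpha i)) (f n y)) /\
  (forall (n m : ncdim) (x : tuples n) (gamma : opM R n m),
    ncball r x -> isometry_op gamma ->
    f m (conjt gamma x) = adj gamma *o f n x *o gamma).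

(* A(K); only the values of [f] on K matter *)
Definition cont_affine (r : R) (f : ncfun) : Prop :=
  affine_nc r f /\ forall n, {within @ncball r n, continuous (f n)}.

Definition evalmx (s : nat) (p : nat) (h : 'I_s -> 'I_s -> 'I_p -> 'I_p -> ncfun)
    (n : ncdim) (x : tuples n) :=
  blockop (fun s1 s2 : 'I_s => blockop (fun p1 p2 : 'I_p => h s1 s2 p1 p2 n x)).

Section Multivalued.
Variable p : ncdim.

Definition mvfun := forall n : ncdim, tuples n -> set (opMp R p n).

Definition mv_nc (r : R) (F : mvfun) : Prop :=
  forall (n : ncdim) (x : tuples n), ncball r x ->
    [/\ F n x !=set0,
        F n x `<=` @selfadj R _,
        forall alpha : opM R n n, unitary_op alpha ->
          F n (conjt alpha x) =
          [set ampl (idx p) (adj alpha) *o T *o ampl (idx p) alpha | T in F n x]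
      & F n x = [set T + P | T in F n x & P in @oppos R _]].

Definition mv_bounded (r : R) (F : mvfun) : Prop :=
  exists2 lambda : R, 0 < lambda &
    forall (n : ncdim) (x : tuples n), ncball r x -> forall beta, F n x beta ->
      exists alpha, [/\ F n x alpha, ople alpha beta & opnorm alpha <= lambda].

Definition graph (r : R) (F : mvfun) (n : ncdim) : set (tuples n * opMp R p n) :=
  [set z | ncball r z.1 /\ F n z.1 z.2].

Definition mv_convex (r : R) (F : mvfun) : Prop :=
  forall (N n : ncdim) (d : idx N -> ncdim) (x : forall i, tuples (d i))
      (T : forall i, opMp R p (d i)) (alpha : forall i, opM R (d i) n)
      (y : tuples n) (S : opMp R p n),
    (forall i, graph r F (x i, T i)) ->
    (exists c, forall i, (forall j, opnorm (x i j) <= c) /\ opnorm (T i) <= c) ->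
    opsum (fun i => adj (alpha i) *o alpha i) (idop R (idx n)) ->
    (forall j, opsum (fun i => adj (alpha i) *o x i j *o alpha i) (y j)) ->
    opsum (fun i => ampl (idx p) (adj (alpha i)) *o T i *o ampl (idx p) (alpha i))
      S ->
    graph r F (y, S).

Definition mv_lsc (r : R) (F : mvfun) : Prop :=
  forall n : ncdim, closed (graph r F (n:=n)).

Definition nc_majorization (r : R) (F : mvfun) : Prop :=
  [/\ mv_nc r F, mv_bounded r F, mv_lsc r F & mv_convex r F].

End Multivalued.

Definition setle (I : choiceType) (S T : set (bop R I I)) : Prop :=
  forall beta, T beta -> exists2 alpha, S alpha & ople alpha beta.

Definition ucp (n m : ncdim) (psi : opM R n n -> opM R m m) : Prop :=
  psi (idop R (idx n)) = idop R (idx m) /\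
  forall (l : nat) (hl : (0 < l)%N) (T : opMp R (Fin hl) n),
    oppos T -> oppos (idtens psi T).

Definition faithful (n m : ncdim) (psi : opM R n n -> opM R m m) : Prop :=
  forall T, oppos T -> psi T = 0 -> T = 0.

Definition nc_maj (m n1 n2 : ncdim) (psi1 : opM R n1 n1 -> opM R m m)
    (psi2 : opM R n2 n2 -> opM R m m) (a : tuples n1) (b : tuples n2) : Prop :=
  forall r : R, 0 < r -> ncball r a -> ncball r b ->
  forall (p : ncdim) (F : mvfun p), nc_majorization r F ->
    setle (idtens psi1 @` F n1 a) (idtens psi2 @` F n2 b).

Definition cutmap (p : nat) (hp : (0 < p)%N) (q : nat) (s : 'I_q -> nat)
    (h : forall i, 'I_(s i) -> 'I_(s i) -> 'I_p -> 'I_p -> ncfun) :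
    mvfun (Fin hp) :=
  fun n x => \bigcap_(i in [set: 'I_q])
    [set alpha | selfadj alpha /\ ople (evalmx (h i) x) (ampl 'I_(s i) alpha)].

End NcBall.

Arguments cutmap {R k p} hp {q s} h n x.

(* Main.v *)
Require Import Defs.
From mathcomp Require Import all_boot all_order all_algebra.
From mathcomp Require Import complex finmap.
From mathcomp Require Import all_classical all_reals all_analysis.
From mathcomp.analysis Require showcase.summability.
From mathcomp Require Import ring lra.
Set Implicit Arguments.
Unset Strict Implicit.
Unset Printing Implicit Defensive.
Import Order.TTheory GRing.Theory Num.Theory.
Import numFieldNormedType.Exports.
Local Open Scope classical_set_scope.
Local Open Scope ring_scope.
Import summability.
#[local] Existing Instance totally_filter.

(** Both conditions are equivalent to the existence of a unital completely positive
    map [Phi : M_n2 -> M_n1] with [Phi b = a] and [psi1 o Phi = psi2].  Given Kraus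
    operators [al_i] of [Phi], the element [sum_i al_i^* T al_i] lies in [F a] when
    [T] lies in [F b], and its image under [id (x) psi1] equals that of [T] under
    [id (x) psi2].

    Conversely take [p = n2] and [T = sum_uv E_uv (x) E_uv], so that an element of
    [M_p(M_n1)] is the Choi matrix of a map [Phi], and [Phi] is completely positive
    iff the element is positive.  For a real [t <> 0] let [W = 1 + t b_j]; then
    [W^* W - (1 + 2 t b_j - t^2)] is bounded below by [t^2], which leaves enough room
    to dominate by [1 (x) T] a matrix of affine functions whose compression to [W] is
    [1 + 2 t x_j - t^2].  The corresponding cut at [a] gives
    [Phi (W^* W) >= 1 + 2 t a_j - t^2].  By compactness one [S] satisfies all these
    cuts together with [(id (x) psi1) S <= (id (x) psi2) T].  Letting [t -> 0] yields
    [Phi 1 >= 1], hence [Phi 1 = 1] since [psi1] is faithful and [psi1 (Phi 1) <= 1];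
    then [Phi b_j = a_j] from both signs of [t].  Finally [psi2 - psi1 o Phi] is
    completely positive and kills [1], so it vanishes.

    A cut map need not be bounded: for [{al >= X, al >= - X}] with [X] the flip on
    [C^2], the elements [diag (e, 1/e)] have no uniformly bounded minorant.  For the
    first condition it is therefore replaced by its truncation, the set of all elements
    above an element of the cut map of norm at most [lam]. *)

(** * Convergence of complex-valued nets *)

(** An affine function contains no [x_j^2], so a cut sees [W^* W] only to first order in [t]; the
    loss is [O(t^2)] and vanishes in the limit even after division by [t]. A cut constrains
    [1 (x) T] on all families of vectors, not only on the families [W (x) eta] that produce
    [Phi (W^* W)]: elsewhere a penalty is subtracted, and the slack [t^2] makes the finite weight
    [n2 / t^2] sufficient.

    Condition (2) takes finitely many cuts at a time, so each initial part of the countable list of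
    cuts has its own solution [S_N], without an a priori common bound; faithfulness supplies the
    compactness. Weak limits are taken along ultrafilters and represented by the Riesz theorem, at
    infinite levels too, since truncated cut maps must be convex and closed there.

    In the other direction, affine nc functions respect by definition only sums and compressions
    along isometries. A Kraus sum [sum_i al_i^* x al_i] is therefore rewritten as the compression of
    a direct sum of copies of [x] by the isometric column of the [al_i]. *)

Section Scalars.
Variable R : realType.
Notation C := R[i].
Local Notation Re := complex.Re.
Local Notation Im := complex.Im.

Lemma cvgC (T : Type) (F : set_system T) {FF : Filter F} (f : T -> C^o) (l : C^o) :
  (fun x => complex.Re (f x)) @ F --> complex.Re l ->
  (fun x => complex.Im (f x)) @ F --> complex.Im l -> f @ F --> l.
Proof.
move=> /cvgrPdist_lt fr /cvgrPdist_lt fi; apply/cvgrPdist_lt => -[e e'].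
rewrite ltcE /= => /andP[/eqP e'0 e0]; subst e'.
have e2 : 0 < e / 2 by rewrite divr_gt0.
near=> x.
have hr : `|complex.Re l - complex.Re (f x)| < e / 2 by near: x; exact: fr.
have hi : `|complex.Im l - complex.Im (f x)| < e / 2 by near: x; exact: fi.
set z := l - f x.
have -> : z = (complex.Re z)%:C%C + 'i%C * (complex.Im z)%:C%C by rewrite -complexE.
apply: le_lt_trans (ler_normD _ _) _.
rewrite normrM !normc_def /= !expr0n /= !addr0 add0r expr1n sqrtr1 !sqrtr_sqr mul1r.
rewrite -rmorphD /= -[X in _ < X]/(e%:C)%C ltcR (splitr e).
by apply: ltrD; [move: hr|move: hi]; rewrite /z; case: (l) (f x) => [? ?] [? ?].
Unshelve. all: by end_near.
Qed.

Lemma cvg_Re (T : Type) (F : set_system T) {FF : Filter F} (f : T -> C^o) (l : C^o) :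
  f @ F --> l -> (fun x => complex.Re (f x)) @ F --> complex.Re l.
Proof.
move=> /cvgrPdist_lt fl; apply/cvgrPdist_lt => e e0.
have e0' : 0 < e%:C%C :> C by rewrite ltcR.
near=> x; have : `|l - f x| < e%:C%C by near: x; exact: fl.
move=> h; rewrite -ltcR; apply: le_lt_trans h.
by apply: le_trans (normc_ge_Re _); case: (l) (f x) => [? ?] [? ?] /=.
Unshelve. all: by end_near.
Qed.

(** The topology lives on [R[i]^o], the ring operations and conjugation on [R[i]]. The constructor
    hides the change of type, so that statements and rewriting stay in [R[i]]. *)
Variant tendsto (T : Type) (F : set_system T) (f : T -> C) (l : C) : Prop :=
  Tendsto of (f : T -> C^o) @ F --> (l : C^o).

Lemma tendstoP (T : Type) (F : set_system T) {FF : Filter F} (f : T -> C) (l : C) :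
  (fun x => Re (f x)) @ F --> Re l -> (fun x => Im (f x)) @ F --> Im l ->
  tendsto F f l.
Proof. by move=> ? ?; constructor; exact: cvgC. Qed.

Lemma tendsto_Re (T : Type) (F : set_system T) {FF : Filter F} (f : T -> C) (l : C) :
  tendsto F f l -> (fun x => Re (f x)) @ F --> Re l.
Proof. by move=> [?]; exact: cvg_Re. Qed.

Lemma tendsto_cst (T : Type) (F : set_system T) {FF : Filter F} (l : C) :
  tendsto F (fun=> l) l.
Proof. by constructor; exact: cvg_cst. Qed.

Lemma tendstoD (T : Type) (F : set_system T) {FF : Filter F} (f g : T -> C) (l m : C) :
  tendsto F f l -> tendsto F g m -> tendsto F (fun x => f x + g x) (l + m).
Proof. by move=> [?] [?]; constructor; exact: cvgD. Qed.

Lemma tendstoZ (T : Type) (F : set_system T) {FF : Filter F} (c : C) (f : T -> C) (l : C) :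
  tendsto F f l -> tendsto F (fun x => c * f x) (c * l).
Proof. by move=> [?]; constructor; exact: cvgMl_tmp. Qed.

Lemma tendsto_Im (T : Type) (F : set_system T) {FF : Filter F} (f : T -> C) (l : C) :
  tendsto F f l -> (fun x => Im (f x)) @ F --> Im l.
Proof.
move=> fl; have E (z : C) : Re (- 'i%C * z) = Im z.
  by rewrite mulNr mulrC -[LHS]/(Re (- (z * 'i%C))) raddfN /= ReiNIm opprK.
have -> : (fun x => Im (f x)) = (fun x => Re (- 'i%C * f x)).
  by apply/funext => x; rewrite E.
by rewrite -E; exact: (tendsto_Re (tendstoZ _ fl)).
Qed.

Lemma complexRe_conj (z : C) : Re (z^*)%C = Re z. Proof. by case: z. Qed.
Lemma complexIm_conj (z : C) : Im (z^*)%C = - Im z. Proof. by case: z. Qed.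

Lemma tendsto_conj (T : Type) (F : set_system T) {FF : Filter F} (f : T -> C) (l : C) :
  tendsto F f l -> tendsto F (fun x => (f x)^*%C) (l^*%C).
Proof.
move=> fl; apply: tendstoP.
  have -> : (fun x => Re (f x)^*%C) = (fun x => Re (f x)).
    by apply/funext => x; rewrite complexRe_conj.
  by rewrite complexRe_conj; exact: tendsto_Re.
have -> : (fun x => Im (f x)^*%C) = - (fun x => Im (f x)).
  by apply/funext => x; rewrite complexIm_conj.
by rewrite complexIm_conj; apply: cvgN; exact: tendsto_Im.
Qed.

Lemma tendsto_sum (T : Type) (F : set_system T) {FF : Filter F} (J : Type) (s : seq J)
    (P : pred J) (f : J -> T -> C) (l : J -> C) :
  (forall j, tendsto F (f j) (l j)) ->
  tendsto F (fun x => \sum_(j <- s | P j) f j x) (\sum_(j <- s | P j) l j).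
Proof.
move=> fl; elim: s => [|j s IH].
  rewrite big_nil (_ : (fun x => _) = fun=> 0); first exact: tendsto_cst.
  by apply/funext => x; rewrite big_nil.
rewrite big_cons (_ : (fun x => _) = fun x =>
  if P j then f j x + \sum_(j <- s | P j) f j x else \sum_(j <- s | P j) f j x).
  by case: (P j) => //; exact: tendstoD.
by apply/funext => x; rewrite big_cons.
Qed.

Lemma tendsto_unique (T : Type) (F : set_system T) {FF : ProperFilter F} (f : T -> C)
    (l m : C) : tendsto F f l -> tendsto F f m -> l = m.
Proof. by move=> [fl] [fm]; exact: (@norm_cvg_unique _ C^o _ _ l m fl fm). Qed.

Lemma tendsto_lim (T : Type) (F : set_system T) {FF : ProperFilter F} (f : T -> C)
    (l : C) : tendsto F f l -> lim ((f : T -> C^o) @ F) = l.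
Proof. by move=> [fl]; apply: (@cvg_lim C^o) => //; exact: norm_hausdorff. Qed.

Lemma tendsto_ge0 (T : Type) (F : set_system T) {FF : ProperFilter F} (f : T -> C)
    (l : C) : tendsto F f l -> (\forall x \near F, 0 <= Re (f x)) -> 0 <= Re l.
Proof. by move=> /tendsto_Re fl f0; exact: (cvgr_to_ge fl). Qed.

Lemma psumE (I : choiceType) (V : zmodType) (a : I -> V) (A : {fset I}) :
  partial_sum a A = \sum_(i <- A) a i.
Proof. by rewrite /partial_sum (big_seq_fsetE _ A xpredT a). Qed.

Lemma psum_le_esum (I : choiceType) (a : I -> R) (A : {fset I}) :
  (forall i, 0 <= a i) ->
  ((\sum_(i <- A) a i)%:E <= \esum_(i in [set: I]) (a i)%:E)%E.
Proof.
move=> a0; apply: esum_ge; exists [set` A] => //.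
by rewrite -fsbig_seq ?fset_uniq// sumEFin.
Qed.

(** Some finite [X] comes within [e] of the supremum, and by nonnegativity every finite set
    containing [X] has its sum between that of [X] and the supremum. *)
Lemma psum_cvg (I : choiceType) (a : I -> R) : (forall i, 0 <= a i) ->
  (\esum_(i in [set: I]) (a i)%:E < +oo)%E ->
  (fun A : {fset I} => \sum_(i <- A) a i) @ totally -->
  fine (\esum_(i in [set: I]) (a i)%:E).
Proof.
move=> a0 afin; set s := esum _ _ in afin *.
have s0 : (0 <= s)%E by apply: esum_ge0 => i _; rewrite lee_fin.
have sE : s = (fine s)%:E by rewrite fineK// ge0_fin_numE.
apply/cvgrPdist_lt => e e0.
have : ((fine s - e)%:E < s)%E by rewrite sE lte_fin /= ltrBlDr ltrDl.
move=> /ereal_sup_gt[_ [X [finX _] <-]].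
rewrite fsbig_finite// sumEFin lte_fin => hX.
exists (fset_set X) => // B /= XB.
have h1 : \sum_(i <- B) a i <= fine s.
  by rewrite -lee_fin -sE; exact: psum_le_esum.
have h2 : \sum_(i <- fset_set X) a i <= \sum_(i <- B) a i.
  rewrite [leRHS](big_fsetID _ (mem (fset_set X))) /=.
  rewrite (_ : [fset x in B | x \in fset_set X]%fset = fset_set X).
    by rewrite lerDl sumr_ge0.
  apply/fsetP => x; rewrite !inE /= andbC; case: (boolP (x \in fset_set X)) => //=.
  exact: (fsubsetP XB).
rewrite ger0_norm ?subr_ge0// ltrBlDr -ltrBlDl.
by apply: lt_le_trans h2.
Qed.

End Scalars.

(** * The Hilbert space of square-summable families *)

Section Inner.
Variable R : realType.
Notation C := R[i].
Local Notation Re := complex.Re.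
Implicit Types I J : choiceType.

Definition sq I (u : ell2 R I) : R := fine (sqsum u).

Lemma sqE I (u : ell2 R I) : (sq u)%:E = sqsum u.
Proof. by rewrite fineK// ge0_fin_numE ?sqsum_ge0//; case: u. Qed.

Lemma sq_ge0 I (u : ell2 R I) : 0 <= sq u.
Proof. by rewrite fine_ge0 ?sqsum_ge0. Qed.

Lemma norm2E I (u : ell2 R I) : norm2 u = Num.sqrt (sq u).
Proof. by []. Qed.

Lemma sq_cvg I (u : ell2 R I) :
  (fun A : {fset I} => \sum_(i <- A) normsq (u i)) @ totally --> sq u.
Proof. by apply: psum_cvg => [i|]; [exact: normsq_ge0|case: u]. Qed.

Lemma ell2P I (u v : ell2 R I) : (forall i, u i = v i) -> u = v.
Proof. by move=> uv; apply/val_inj/funext. Qed.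

Lemma ell2D I (u v : ell2 R I) i : (u + v) i = (u i : C) + v i. Proof. by []. Qed.
Lemma ell2Z I (c : C) (u : ell2 R I) i : (c *: u) i = c * (u i : C). Proof. by []. Qed.

Lemma ell2_sum I (K : Type) (s : seq K) (P : pred K) (f : K -> ell2 R I) i :
  (\sum_(k <- s | P k) f k) i = \sum_(k <- s | P k) f k i.
Proof.
elim: s => [|k s IH]; first by rewrite !big_nil.
by rewrite !big_cons; case: (P k); rewrite ?ell2D IH.
Qed.

Lemma conjCD (z w : C) : conjc (z + w) = conjc z + conjc w. Proof. exact: rmorphD. Qed.
Lemma conjCM (z w : C) : conjc (z * w) = conjc z * conjc w. Proof. exact: rmorphM. Qed.

Lemma conjCN (z : C) : conjc (- z) = - conjc z. Proof. exact: rmorphN. Qed.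

Lemma normsqE (z : C) : (normsq z)%:C%C = z * z^*%C.
Proof. by rewrite /normsq add_Re2_Im2 sqr_normc. Qed.

(** Polarization in one coordinate: it reduces the convergence of an inner product to that of four
    sums of squares. *)
Lemma polar (z w : C) : z * w^*%C = 4^-1 * ((normsq (z + w))%:C%C +
  (-1) * (normsq (z + (-1) * w))%:C%C + 'i%C * (normsq (z + 'i%C * w))%:C%C +
  (- 'i%C) * (normsq (z + (- 'i%C) * w))%:C%C).
Proof.
rewrite !normsqE !conjCD !conjCM.
rewrite !conjCN conjc1.
have ci : conjc 'i%C = - 'i%C :> C by apply/eqP; rewrite eq_complex /= oppr0 !eqxx.
rewrite ci opprK.
have ii : 'i%C * 'i%C = -1 :> C by rewrite -expr2 sqr_i.
set i := 'i%C in ii *; set z' := (z^*)%C; set w' := (w^*)%C.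
transitivity (4^-1 * (2 * (z * w' + z' * w) - 2 * (i * i) * (z * w') +
   2 * (i * i) * (z' * w))); last first.
  by congr (_ * _); ring.
by rewrite ii; field.
Qed.

Lemma tendsto_real (T : Type) (F : set_system T) {FF : Filter F} (f : T -> R) (l : R) :
  f @ F --> l -> tendsto F (fun x => (f x)%:C%C) (l%:C)%C.
Proof. by move=> fl; apply: tendstoP => //=; exact: cvg_cst. Qed.

Definition ip I (u v : ell2 R I) : C := inner u v.

(** [inner] is a bare [lim], so nothing can be computed with it before convergence is known. All
    algebraic rules for [ip] below follow from this lemma and uniqueness of limits. *)
Lemma ip_cvg I (u v : ell2 R I) :
  tendsto totally (fun A : {fset I} => \sum_(i <- A) (u i : C) * conjc (v i)) (ip u v).
Proof.
suff [l hl] : exists l, tendsto totally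
    (fun A : {fset I} => \sum_(i <- A) (u i : C) * conjc (v i)) l.
  rewrite /ip /inner (_ : partial_sum _ =
    fun A : {fset I} => \sum_(i <- A) (u i : C) * conjc (v i)).
    by rewrite (tendsto_lim hl).
  by apply/funext => A; rewrite psumE.
have sqc (w : ell2 R I) : tendsto totally
    (fun A : {fset I} => \sum_(i <- A) (normsq (w i))%:C%C) (sq w)%:C%C.
  rewrite (_ : (fun A => _) = fun A : {fset I} => ((\sum_(i <- A) normsq (w i))%:C)%C).
    by apply: tendsto_real; exact: sq_cvg.
  by apply/funext => A; rewrite rmorph_sum.
eexists.
rewrite (_ : (fun A => _) = fun A : {fset I} => 4^-1 *
   (\sum_(i <- A) (normsq ((u + v) i))%:C%C +
   (-1) * (\sum_(i <- A) (normsq ((u + (-1) *: v) i))%:C%C) +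
   'i%C * (\sum_(i <- A) (normsq ((u + 'i%C *: v) i))%:C%C) +
   (- 'i%C) * (\sum_(i <- A) (normsq ((u + (- 'i%C) *: v) i))%:C%C))).
  apply: tendstoZ; apply: tendstoD; last by apply: tendstoZ; exact: sqc.
  apply: tendstoD; last by apply: tendstoZ; exact: sqc.
  by apply: tendstoD; [exact: sqc|apply: tendstoZ; exact: sqc].
apply/funext => A; rewrite !mulr_sumr -!big_split /= mulr_sumr.
by apply: eq_bigr => i _; exact: polar.
Qed.

Lemma ipDl I (u v w : ell2 R I) : ip (u + v) w = ip u w + ip v w.
Proof.
apply: (tendsto_unique (ip_cvg _ _) _).
rewrite (_ : (fun A => _) = fun A : {fset I} =>
  \sum_(i <- A) (u i : C) * conjc (w i) + \sum_(i <- A) (v i : C) * conjc (w i)).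
  by apply: tendstoD; exact: ip_cvg.
apply/funext => A; rewrite -big_split /=; apply: eq_bigr => i _.
exact: mulrDl.
Qed.

Lemma ipZl I (c : C) (u w : ell2 R I) : ip (c *: u) w = c * ip u w.
Proof.
apply: (tendsto_unique (ip_cvg _ _) _).
rewrite (_ : (fun A => _) = fun A : {fset I} => c * \sum_(i <- A) (u i : C) * conjc (w i)).
  by apply: tendstoZ; exact: ip_cvg.
by apply/funext => A; rewrite mulr_sumr; apply: eq_bigr => i _; rewrite mulrA.
Qed.

Lemma ipC I (u v : ell2 R I) : ip u v = conjc (ip v u).
Proof.
apply: (tendsto_unique (ip_cvg _ _) _).
rewrite (_ : (fun A => _) = fun A : {fset I} => conjc (\sum_(i <- A) (v i : C) * conjc (u i))).
  by apply: tendsto_conj; exact: ip_cvg.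
apply/funext => A; rewrite rmorph_sum; apply: eq_bigr => i _.
by rewrite [RHS]conjCM conjcK mulrC.
Qed.

Lemma ipxx I (u : ell2 R I) : ip u u = (sq u)%:C%C.
Proof.
apply: (tendsto_unique (ip_cvg _ _) _).
rewrite (_ : (fun A => _) = fun A : {fset I} => ((\sum_(i <- A) normsq (u i))%:C)%C).
  by apply: tendsto_real; exact: sq_cvg.
by apply/funext => A; rewrite rmorph_sum; apply: eq_bigr => i _; rewrite -normsqE.
Qed.

Lemma ipDr I (u v w : ell2 R I) : ip w (u + v) = ip w u + ip w v.
Proof. by rewrite ipC ipDl conjCD -!ipC. Qed.
Lemma ipZr I (c : C) (u w : ell2 R I) : ip w (c *: u) = conjc c * ip w u.
Proof. by rewrite ipC ipZl conjCM -!ipC. Qed.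
Lemma ip0l I (w : ell2 R I) : ip 0 w = 0.
Proof. by rewrite -(scale0r (0 : ell2 R I)) ipZl mul0r. Qed.
Lemma ip0r I (w : ell2 R I) : ip w 0 = 0.
Proof. by rewrite ipC ip0l conjc0. Qed.
Lemma ipNl I (u w : ell2 R I) : ip (- u) w = - ip u w.
Proof. by rewrite -scaleN1r ipZl mulN1r. Qed.
Lemma ipNr I (u w : ell2 R I) : ip w (- u) = - ip w u.
Proof. by rewrite ipC ipNl raddfN /= -ipC. Qed.
Lemma ipBl I (u v w : ell2 R I) : ip (u - v) w = ip u w - ip v w.
Proof. by rewrite ipDl ipNl. Qed.
Lemma ipBr I (u v w : ell2 R I) : ip w (u - v) = ip w u - ip w v.
Proof. by rewrite ipDr ipNr. Qed.

Lemma ip_suml I (K : Type) (s : seq K) (P : pred K) (f : K -> ell2 R I) w :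
  ip (\sum_(k <- s | P k) f k) w = \sum_(k <- s | P k) ip (f k) w.
Proof.
elim: s => [|k s IH]; first by rewrite !big_nil ip0l.
by rewrite !big_cons; case: (P k); rewrite ?ipDl IH.
Qed.

Lemma ip_sumr I (K : Type) (s : seq K) (P : pred K) (f : K -> ell2 R I) w :
  ip w (\sum_(k <- s | P k) f k) = \sum_(k <- s | P k) ip w (f k).
Proof.
elim: s => [|k s IH]; first by rewrite !big_nil ip0r.
by rewrite !big_cons; case: (P k); rewrite ?ipDr IH.
Qed.

Lemma sqRe I (u : ell2 R I) : sq u = Re (ip u u).
Proof. by rewrite ipxx. Qed.

Lemma sqD I (u v : ell2 R I) : sq (u + v) = sq u + sq v + 2 * Re (ip u v).
Proof.
rewrite !sqRe ipDl !ipDr (ipC v u).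
by case: (ip u u) (ip v v) (ip u v) => [? ?] [? ?] [? ?] /=; ring.
Qed.

Lemma sqZ I (c : C) (u : ell2 R I) : sq (c *: u) = normsq c * sq u.
Proof.
by apply: complexI; rewrite -ipxx ipZl ipZr ipxx mulrA -normsqE -rmorphM.
Qed.

Lemma sqN I (u : ell2 R I) : sq (- u) = sq u.
Proof. by rewrite !sqRe ipNl ipNr opprK. Qed.

Lemma sqB I (u v : ell2 R I) : sq (u - v) = sq u + sq v - 2 * Re (ip u v).
Proof. by rewrite sqD sqN ipNr raddfN /= mulrN. Qed.

Lemma sq0 I : sq (0 : ell2 R I) = 0.
Proof. by rewrite sqRe ip0l. Qed.

Lemma normsq_eq0 (z : C) : (normsq z == 0) = (z == 0).
Proof. by rewrite -(inj_eq (@complexI R)) normsqE -sqr_normc sqrf_eq0 normr_eq0. Qed.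

Lemma normsq_le_sq I (u : ell2 R I) i : normsq (u i) <= sq u.
Proof.
rewrite -lee_fin sqE.
have := @psum_le_esum R I (fun i => normsq (u i)) [fset i]%fset.
by rewrite big_seq_fset1; apply=> j; exact: normsq_ge0.
Qed.

Lemma sq_eq0 I (u : ell2 R I) : sq u = 0 -> u = 0.
Proof.
move=> u0; apply: ell2P => i; apply/eqP; rewrite -normsq_eq0 eq_le normsq_ge0 andbT.
by rewrite -u0 normsq_le_sq.
Qed.

Lemma normsq_ip_le I (u v : ell2 R I) : normsq (ip u v) <= sq u * sq v.
Proof.
have [v0|v0] := eqVneq (sq v) 0.
  by rewrite (sq_eq0 v0) ip0r normsq0 mulr_ge0 ?sq_ge0.
have vp : 0 < sq v by rewrite lt_neqAle eq_sym v0 sq_ge0.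
(* The expansion is [|v|^2 (|u|^2 |v|^2 - |<u, v>|^2)], which gives Cauchy-Schwarz after division by
   [|v|^2]. *)
have := sq_ge0 ((sq v)%:C%C *: u - ip u v *: v).
rewrite sqB !sqZ ipZl ipZr (mulrC (conjc _)) -normsqE -rmorphM.
rewrite -[Re _]/(sq v * normsq (ip u v)).
have -> : normsq (sq v)%:C%C = sq v * sq v by rewrite /normsq /= expr0n addr0 expr2.
move=> h; rewrite -subr_ge0 -(pmulr_rge0 _ vp); nra.
Qed.

Lemma delta_proof I (i : I) : ell2_pred (fun j => (j == i)%:R : C).
Proof.
rewrite /ell2_pred /sqsum.
rewrite (_ : (fun j => _) = fun j => if j \in [set i] then 1%:E else 0%E :> \bar R).
  by rewrite -esum_mkcond esum_set1 ?ltry.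
apply/funext => j; rewrite in_set1; case: (j == i); rewrite /normsq /=.
  by rewrite expr1n expr0n addr0.
by rewrite expr0n addr0.
Qed.
Definition delta I (i : I) : ell2 R I := Ell2 (delta_proof i).

Lemma deltaE I (i j : I) : delta i j = (j == i)%:R :> C. Proof. by []. Qed.

Lemma tendsto_near_cst (T : Type) (F : set_system T) {FF : Filter F} (f : T -> C) (l : C) :
  (\forall x \near F, f x = l) -> tendsto F f l.
Proof. by move=> h; constructor; apply: cvg_near_cst. Qed.

Lemma ip_delta I (u : ell2 R I) i : ip u (delta i) = u i :> C.
Proof.
apply: (tendsto_unique (ip_cvg _ _) _); apply: tendsto_near_cst.
exists [fset i]%fset => // A /= /fsubsetP/(_ i); rewrite inE eqxx => /(_ isT) iA.
rewrite (big_fsetD1 i) //= eqxx conjc1 mulr1 big1_seq ?addr0// => j.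
by rewrite !inE => /andP[_ /andP[/negPf ji _]]; rewrite /= ji conjc0 mulr0.
Qed.

Lemma ip_fin (I : finType) (u v : ell2 R I) :
  ip u v = \sum_i (u i : C) * conjc (v i).
Proof.
apply: (tendsto_unique (ip_cvg _ _) _); apply: tendsto_near_cst.
exists [fset i | i in I]%fset => // A /= /fsubsetP AI.
rewrite -big_enum /=; apply: perm_big; apply: uniq_perm; rewrite ?fset_uniq ?enum_uniq//.
by move=> i; rewrite mem_enum; apply: AI; apply/imfsetP; exists i.
Qed.

Lemma sq_fin (I : finType) (u : ell2 R I) : sq u = \sum_i normsq (u i).
Proof.
apply: complexI; rewrite -ipxx ip_fin rmorph_sum; apply: eq_bigr => i _.
by rewrite -normsqE.
Qed.

End Inner.

(** * Adjoints and positivity of bounded operators *)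

Section Ops.
Variable R : realType.
Notation C := R[i].
Local Notation Re := complex.Re.
Local Notation Im := complex.Im.
Implicit Types I J K : choiceType.

Lemma tendsto_normsq (T : Type) (F : set_system T) {FF : Filter F} (f : T -> C) (l : C)
    (g : T -> R) :
  (forall x, normsq (l - f x) <= g x) -> g @ F --> (0 : R) -> tendsto F f l.
Proof.
move=> fg /cvgrPdist_lt g0.
have small (h : C -> R) : (forall z, h z ^+ 2 <= normsq z) ->
    {morph h : a b / a - b} -> (fun x => h (f x)) @ F --> h l.
  move=> hz hB; apply/cvgrPdist_lt => e e0; near=> x; rewrite -hB.
  have : `|0 - g x| < e ^+ 2 by near: x; apply: g0; rewrite exprn_gt0.
  rewrite sub0r normrN => ge.
  rewrite -(@ltr_pXn2r _ 2)// ?nnegrE ?(ltW e0)// real_normK ?num_real//.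
  by apply: le_lt_trans (hz _) _; apply: le_lt_trans (fg x) _; exact: le_lt_trans (ler_norm _) ge.
apply: tendstoP; apply: small => [z|].
- by rewrite /normsq lerDl sqr_ge0.
- by move=> [? ?] [? ?].
- by rewrite /normsq lerDr sqr_ge0.
- by move=> [? ?] [? ?].
Unshelve. all: by end_near.
Qed.

Definition trunc I (A : {fset I}) (g : I -> C) : ell2 R I :=
  \sum_(i <- A) g i *: delta R i.

Lemma truncE I (A : {fset I}) (g : I -> C) j :
  trunc A g j = if j \in A then g j else 0 :> C.
Proof.
rewrite /trunc ell2_sum; case: ifPn => jA.
  rewrite (big_fsetD1 j) //= /delta big1_seq => [|i].
    by rewrite addr0; change (g j * (j == j)%:R = g j :> C); rewrite eqxx mulr1.
  rewrite !inE => /andP[_ /andP[/negPf ij _]].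
  by change (g i * (j == i)%:R = 0 :> C); rewrite eq_sym ij mulr0.
rewrite big1_seq// => i /andP[_ iA].
change (g i * (j == i)%:R = 0 :> C); case: eqP => [ji|]; last by rewrite mulr0.
by rewrite ji iA in jA.
Qed.

Lemma ip_trunc I (A : {fset I}) (g : I -> C) (u : ell2 R I) :
  ip u (trunc A g) = \sum_(i <- A) (u i : C) * conjc (g i).
Proof.
rewrite ip_sumr; apply: eq_bigr => i _; rewrite ipZr ip_delta mulrC.
by [].
Qed.

Lemma sq_trunc I (A : {fset I}) (g : I -> C) :
  sq (trunc A g) = \sum_(i <- A) normsq (g i).
Proof.
apply: complexI; rewrite -ipxx ip_trunc rmorph_sum; apply: eq_big_seq => i iA.
by rewrite truncE iA -normsqE.
Qed.

Lemma sq_sub_trunc I (A : {fset I}) (u : ell2 R I) :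
  sq (u - trunc A u) = sq u - \sum_(i <- A) normsq (u i).
Proof.
rewrite sqB sq_trunc ip_trunc.
have -> : \sum_(i <- A) (u i : C) * conjc (u i) = ((\sum_(i <- A) normsq (u i))%:C)%C.
  by rewrite rmorph_sum; apply: eq_bigr => i _; rewrite -normsqE.
rewrite -[Re _]/(\sum_(i <- A) normsq (u i)); lra.
Qed.

Definition bform I J (M : R) (B : ell2 R I -> ell2 R J -> C) : Prop :=
  [/\ 0 <= M, forall c u u' v, B (c *: u + u') v = c * B u v + B u' v,
    forall c u v v', B u (c *: v + v') = conjc c * B u v + B u v' &
    forall u v, normsq (B u v) <= M * (sq u * sq v)].

(** * Riesz representation of bounded sesquilinear forms *)

Section Riesz.
Variables (I J : choiceType) (M : R) (B : ell2 R I -> ell2 R J -> C).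
Hypothesis BB : bform M B.

Let M0 : 0 <= M. Proof. by case: BB. Qed.

Lemma bform_sumr (T : Type) (s : seq T) (c : T -> C) (f : T -> ell2 R J) u :
  B u (\sum_(i <- s) c i *: f i) = \sum_(i <- s) conjc (c i) * B u (f i).
Proof.
case: BB => _ _ Br _.
have B0 : B u 0 = 0.
  have := Br 1 u 0 0; rewrite scaler0 addr0 conjc1 mul1r => /eqP.
  by rewrite -subr_eq0 opprD addrA subrr sub0r oppr_eq0 => /eqP.
elim: s => [|i s IH]; first by rewrite !big_nil.
by rewrite !big_cons Br IH.
Qed.

Let riesz_fun (u : ell2 R I) : J -> R[i]^o := fun j => B u (delta R j).

Let riesz_bound u : (sqsum (riesz_fun u) <= (M * sq u)%:E)%E.
Proof.
rewrite /sqsum ge_ereal_sup// => _ [X [finX _] <-].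
rewrite fsbig_finite// sumEFin lee_fin.
set A := fset_set X; set s := \sum_(i <- A) _.
have s0 : 0 <= s by apply: sumr_ge0 => i _; exact: normsq_ge0.
(* Tested on the truncation of the candidate vector itself, the form takes the value [s]; so
   [s^2 <= M |u|^2 s], and [s] cancels unless it is zero. *)
have [_ _ _ /(_ u (trunc A (riesz_fun u)))] := BB.
rewrite sq_trunc -/s {1}/trunc bform_sumr.
have -> : \sum_(i <- A) conjc (riesz_fun u i) * B u (delta R i) = (s%:C)%C.
  by rewrite rmorph_sum; apply: eq_bigr => i _; rewrite mulrC -normsqE.
rewrite /normsq /= expr0n addr0 expr2.
have [->|sn] := eqVneq s 0; first by rewrite mulr_ge0 ?sq_ge0.
by rewrite mulrA ler_pM2r// lt_neqAle eq_sym sn.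
Qed.

Let riesz_proof u : ell2_pred (riesz_fun u).
Proof. by apply: le_lt_trans (riesz_bound u) _; rewrite ltry. Qed.

Let riesz_bop : bop_pred (fun u => Ell2 (riesz_proof u)).
Proof.
apply/asboolP; split.
  by move=> a u v; apply: ell2P => j; case: BB => _ Bl _ _; exact: Bl.
apply/bounded_mapP; exists M => // u.
by rewrite -(sqE u) -EFinM; exact: riesz_bound.
Qed.

(** The coordinates of [T u] are the values [B u e_j]. The identity holds for truncations of [v] and
    extends because [B u] is continuous and the truncations converge to [v]. Both adjoints and weak
    limits of operators are obtained from this lemma. *)
Lemma riesz : exists T : bop R I J,
  (forall u v, ip (T u) v = B u v) /\ (forall u, sq (T u) <= M * sq u).
Proof.
exists (Bop riesz_bop); split=> [u v|u]; last first.
  by rewrite -lee_fin sqE; exact: riesz_bound.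
apply: (tendsto_unique (ip_cvg _ _) _).
have tE (A : {fset J}) : \sum_(i <- A) (B u (delta R i) : C) * conjc (v i) = B u (trunc A v).
  by rewrite bform_sumr; apply: eq_bigr => i _; rewrite mulrC.
rewrite (_ : (fun A => _) = fun A : {fset J} => B u (trunc A v)); last first.
  by apply/funext => A; exact: tE.
apply: (@tendsto_normsq _ _ _ _ _
  (fun A : {fset J} => M * sq u * (sq v - \sum_(i <- A) normsq (v i)))).
  move=> A; rewrite -sq_sub_trunc -mulrA.
  have -> : B u v - B u (trunc A v) = B u (v - trunc A v).
    have [_ _ Br _] := BB.
    have -> : v - trunc A v = (-1) *: trunc A v + v by rewrite scaleN1r addrC.
    by rewrite Br conjCN conjc1 mulN1r addrC.
  by case: BB.
rewrite -[X in _ --> X](mulr0 (M * sq u)); apply: cvgMl_tmp.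
rewrite -[X in _ --> X](subrr (sq v)); apply: cvgB; first exact: cvg_cst.
exact: sq_cvg.
Qed.

End Riesz.

Lemma bop_bd I J (T : bop R I J) : exists2 M, 0 <= M & forall u, sq (T u) <= M * sq u.
Proof.
have /bounded_mapP[M M0 h] := bop_bounded T; exists M => // u.
by rewrite -lee_fin EFinM !sqE.
Qed.

Lemma bopP I J (S T : bop R I J) : (forall u, S u = T u) -> S = T.
Proof. by move=> ST; apply/val_inj/funext. Qed.

Lemma bop0E I J u : (0 : bop R I J) u = 0. Proof. by []. Qed.
Lemma bopDE I J (S T : bop R I J) u : (S + T) u = S u + T u. Proof. by []. Qed.
Lemma bopNE I J (S : bop R I J) u : (- S) u = - S u. Proof. by []. Qed.
Lemma bopZE I J c (S : bop R I J) u : (c *: S) u = c *: S u. Proof. by []. Qed.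
Lemma bop_sumE I J (K : Type) (s : seq K) (P : pred K) (f : K -> bop R I J) u :
  (\sum_(k <- s | P k) f k) u = \sum_(k <- s | P k) f k u.
Proof.
elim: s => [|k s IH]; first by rewrite !big_nil.
by rewrite !big_cons; case: (P k); rewrite ?bopDE IH.
Qed.

Lemma ip_extr I (u w : ell2 R I) : (forall v, ip u v = ip w v) -> u = w.
Proof. by move=> uw; apply: ell2P => i; have := uw (delta R i); rewrite !ip_delta. Qed.

Lemma bop_ipP I J (S T : bop R I J) : (forall u v, ip (S u) v = ip (T u) v) -> S = T.
Proof. by move=> ST; apply: bopP => u; apply: ip_extr. Qed.

(** [adj] is an [xget], so its defining property requires a witness: the operator representing the
    form [(v, u) |-> conj <T u, v>]. *)
Lemma adjP I J (T : bop R I J) u v : ip (T u) v = ip u (adj T v).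
Proof.
have [M M0 TM] := bop_bd T.
have [|S [SP _]] := @riesz J I M (fun v u => conjc (ip (T u) v)).
  split=> //.
  - by move=> c x x' y; rewrite ipDr ipZr conjCD conjCM conjcK.
  - by move=> c x y y'; rewrite linearP ipDl ipZl conjCD conjCM.
  move=> x y; have -> : normsq (conjc (ip (T y) x)) = normsq (ip (T y) x).
    by case: (ip _ _) => p q; rewrite /normsq /= sqrrN.
  apply: le_trans (normsq_ip_le _ _) _.
  by rewrite mulrC mulrCA ler_wpM2l ?sq_ge0.
suff : [set S : bop R J I | forall u v, inner (T u) v = inner u (S v)] (adj T).
  by apply.
apply: (@xgetPex _ 0 [set S : bop R J I | forall u v, inner (T u) v = inner u (S v)]).
exists S => x y /=.
by rewrite -[RHS]/(ip _ _) ipC SP conjcK.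
Qed.

Lemma adj_uniq I J (T : bop R I J) (S : bop R J I) :
  (forall u v, ip (T u) v = ip u (S v)) -> adj T = S.
Proof.
move=> TS; apply: bopP => v; apply: ip_extr => u.
by rewrite ipC -adjP TS -ipC.
Qed.

Lemma adjPr I J (T : bop R I J) u v : ip u (T v) = ip (adj T u) v.
Proof. by rewrite ipC adjP -ipC. Qed.

Lemma adjK I J (T : bop R I J) : adj (adj T) = T.
Proof. by apply: adj_uniq => u v; rewrite adjPr. Qed.

Lemma adjD I J (S T : bop R I J) : adj (S + T) = adj S + adj T.
Proof. by apply: adj_uniq => u v; rewrite !bopDE ipDl ipDr !adjP. Qed.

Lemma adjN I J (S : bop R I J) : adj (- S) = - adj S.
Proof. by apply: adj_uniq => u v; rewrite !bopNE ipNl ipNr !adjP. Qed.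

Lemma adj_scale I J c (S : bop R I J) : adj (c *: S) = conjc c *: adj S.
Proof. by apply: adj_uniq => u v; rewrite !bopZE ipZl ipZr !adjP conjcK. Qed.

Lemma adj0 I J : adj (0 : bop R I J) = 0.
Proof. by apply: adj_uniq => u v; rewrite !bop0E ip0l ip0r. Qed.

Lemma adj_sum I J (K : Type) (s : seq K) (P : pred K) (f : K -> bop R I J) :
  adj (\sum_(k <- s | P k) f k) = \sum_(k <- s | P k) adj (f k).
Proof.
elim: s => [|k s IH]; first by rewrite !big_nil adj0.
by rewrite !big_cons; case: (P k); rewrite ?adjD IH.
Qed.

Lemma adj_comp I J K (S : bop R J K) (T : bop R I J) : adj (S *o T) = adj T *o adj S.
Proof. by apply: adj_uniq => u v; rewrite /= !adjP. Qed.

Lemma adj_id I : adj (idop R I) = idop R I.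
Proof. by apply: adj_uniq. Qed.

(** The index types may be infinite, where a vector is no finite combination of the [delta]. Moving
    [S] and [T] to the other side of the inner product leaves only the coordinates of [adj S e_j]
    and [adj T e_j], which are conjugate matrix entries. *)
Lemma bop_deltaP I J (S T : bop R I J) :
  (forall i j, S (delta R i) j = T (delta R i) j :> C) -> S = T.
Proof.
move=> ST; apply: bopP => u; apply: ell2P => j.
rewrite -[LHS]ip_delta -[RHS]ip_delta !adjP; congr ip.
apply: ell2P => i; rewrite -[LHS]ip_delta -[RHS]ip_delta.
by rewrite -!adjPr ipC (ipC _ (T _)) !ip_delta ST.
Qed.

(* With [rq T u = Re <T u, u>], positivity splits into self-adjointness and a real
   inequality, so that limits and sums only involve real numbers. *)
Definition rq I (T : bop R I I) (u : ell2 R I) : R := Re (ip (T u) u).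

Lemma selfadj_Im I (T : bop R I I) u : selfadj T -> Im (ip (T u) u) = 0.
Proof.
move=> sT; have : ip (T u) u = conjc (ip (T u) u) by rewrite -ipC adjP sT.
by case: (ip _ _) => p q [] /=; lra.
Qed.

Lemma oppos_selfadj I (T : bop R I I) : oppos T -> selfadj T.
Proof.
move=> T0; have Ti u : Im (ip (T u) u) = 0 by apply: ger0_Im; exact: T0.
apply: adj_uniq => u v.
(* Reality of the form at [u + v] compares the imaginary parts of [<T u, v>] and [<T v, u>]; at
   [u + i v] it compares the real parts. *)
have h1 := Ti (u + v); have h2 := Ti (u + 'i%C *: v).
have hu := Ti u; have hv := Ti v; move: h1 h2.
rewrite !linearD !linearZ !ipDl !ipDr !ipZl !ipZr (ipC u (T v)).
case: (ip (T u) u) hu (ip (T v) v) hv (ip (T u) v) (ip (T v) u).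
move=> p1 q1 /= -> [p2 q2] /= -> [p3 q3] [p4 q4] /= h1 h2.
by apply/eqP; rewrite eq_complex /=; apply/andP; split; apply/eqP; lra.
Qed.

Lemma opposP I (T : bop R I I) : oppos T <-> selfadj T /\ forall u, 0 <= rq T u.
Proof.
split=> [T0|[sT T0] u].
  split; first exact: oppos_selfadj.
  by move=> u; have := T0 u; rewrite lecE => /andP[_].
by rewrite lecE -[inner _ _]/(ip _ _) (selfadj_Im _ sT) eqxx /=; exact: T0.
Qed.

Lemma oplePf I (S T : bop R I I) : selfadj S -> selfadj T ->
  ople S T <-> forall u, rq S u <= rq T u.
Proof.
move=> sS sT; rewrite /ople opposP; split=> [[_ h] u|h].
  by have := h u; rewrite /rq bopDE bopNE ipBl raddfB /= subr_ge0.
split=> [|u]; first by rewrite /selfadj adjD adjN sS sT.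
by rewrite /rq bopDE bopNE ipBl raddfB /= subr_ge0; exact: h.
Qed.

Lemma opnorm_le I J (T : bop R I J) (M : R) : 0 <= M ->
  (forall u, sq (T u) <= M ^+ 2 * sq u) -> opnorm T <= M.
Proof.
move=> M0 TM; apply: ge_inf; first by exists 0 => x [].
split=> // u; rewrite !norm2E -[M in leRHS]ger0_norm// -sqrtr_sqr -sqrtrM ?sqr_ge0//.
by rewrite ler_sqrt ?mulr_ge0 ?sqr_ge0 ?sq_ge0.
Qed.

Lemma opnorm_ge0 I J (T : bop R I J) : 0 <= opnorm T.
Proof.
have [M hM] := bop_bounded T.
apply: lb_le_inf; last by move=> x [].
exists `|M|; split=> // u; apply: le_trans (hM u) _.
by rewrite ler_wpM2r ?sqrtr_ge0 ?ler_norm.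
Qed.

End Ops.

(** * Tensor products and weak convergence *)

Section Tensor.
Variable R : realType.
Notation C := R[i].
Implicit Types I J K : choiceType.

Lemma row_inj I J (i i' : I) (u : ell2 R J) :
  rowop R J i (injop R J i' u) = if i == i' then u else 0.
Proof.
apply: ell2P => j; rewrite -[LHS]/(inj_fun i' u (i, j)) /inj_fun /=.
by case: (i == i').
Qed.

Lemma row_delta I J (i i' : I) (j : J) :
  rowop R J i (delta R (i', j)) = if i == i' then delta R j else 0.
Proof.
apply: ell2P => j'; rewrite -[LHS]/((((i, j') == (i', j)))%:R : C) xpair_eqE.
by case: (i == i').
Qed.

Lemma inj_delta I J (i : I) (j : J) : injop R J i (delta R j) = delta R (i, j).
Proof.
apply: ell2P => -[i' j']; rewrite -[LHS]/(inj_fun i (delta R j) (i', j')) /inj_fun /=.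
by rewrite xpair_eqE; case: (i' == i).
Qed.

Lemma adj_inj I J (i : I) : adj (injop R J i) = rowop R J i.
Proof.
apply: bop_deltaP => -[i' j'] j; rewrite row_delta.
rewrite -ip_delta -adjPr inj_delta ipC ip_delta.
rewrite -[delta R (i, j) (i', j')]/((((i', j') == (i, j)))%:R : C) xpair_eqE eq_sym.
rewrite conjc_nat; case: (i == i') => //.
by rewrite andTb eq_sym.
Qed.

Lemma adj_row I J (i : I) : adj (rowop R J i) = injop R J i.
Proof. by rewrite -adj_inj adjK. Qed.

Lemma ampl_inj I J J' (T : bop R J J') i u :
  ampl I T (injop R J i u) = injop R J' i (T u).
Proof.
apply: ell2P => -[i' j]; rewrite -[LHS]/(T (rowop R J i' (injop R J i u)) j).
rewrite row_inj -[RHS]/(inj_fun i (T u) (i', j)) /inj_fun /=.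
by case: (i' == i) => //; rewrite linear0.
Qed.

Lemma row_ampl I J J' (T : bop R J J') i u :
  rowop R J' i (ampl I T u) = T (rowop R J i u).
Proof. by apply: ell2P => j. Qed.

Lemma ip_inj I J i i' (u v : ell2 R J) :
  ip (injop R J (i : I) u) (injop R J i' v) = if i == i' then ip u v else 0.
Proof. by rewrite adjP adj_inj row_inj; case: (i == i') => //; rewrite ip0r. Qed.

Lemma adj_ampl I J J' (T : bop R J J') : adj (ampl I T) = ampl I (adj T).
Proof.
apply: bop_deltaP => -[i j] [i' j'].
rewrite -[LHS]ip_delta -adjPr -[RHS]ip_delta -!inj_delta !ampl_inj !ip_inj.
by case: (i == i') => //; rewrite adjPr.
Qed.

Lemma ampl_comp I J J' K (S : bop R J' K) (T : bop R J J') :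
  ampl I (S *o T) = ampl I S *o ampl I T.
Proof.
apply: bopP => u; apply: ell2P => -[i j].
by rewrite -[RHS]/(S (rowop R J' i (ampl I T u)) j) row_ampl.
Qed.

Lemma ampl_id I J : ampl I (idop R J) = idop R (I * J)%type.
Proof. by apply: bopP => u; apply: ell2P => -[i j]. Qed.

Lemma amplD I J J' (S T : bop R J J') : ampl I (S + T) = ampl I S + ampl I T.
Proof. by apply: bopP => u; apply: ell2P => -[i j]. Qed.

Lemma amplZ I J J' c (S : bop R J J') : ampl I (c *: S) = c *: ampl I S.
Proof. by apply: bopP => u; apply: ell2P => -[i j]. Qed.

Lemma block_ampl (I I' J J' K K' : choiceType) (S : bop R J K)
    (T : bop R (I' * K')%type (I * J)%type)
    (U : bop R J' K') i i' :
  block (ampl I S *o T *o ampl I' U) i i' = S *o block T i i' *o U.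
Proof.
apply: bopP => u; rewrite -[LHS]/(rowop R K i (ampl I S (T (ampl I' U (injop R J' i' u))))).
by rewrite ampl_inj row_ampl.
Qed.

Lemma ip_prod (I : finType) J (u v : ell2 R (I * J)%type) :
  ip u v = \sum_i ip (rowop R J i u) (rowop R J i v).
Proof.
have vE : v = \sum_i injop R J i (rowop R J i v).
  apply: ell2P => -[i j]; rewrite ell2_sum (bigD1 i) //= big1 => [|i' /negPf i'i].
    by rewrite addr0 -[RHS]/(inj_fun i (rowop R J i v) (i, j)) /inj_fun /= eqxx.
  by rewrite -[LHS]/(inj_fun i' (rowop R J i' v) (i, j)) /inj_fun /= eq_sym i'i.
by rewrite [in LHS]vE ip_sumr; apply: eq_bigr => i _; rewrite [LHS]adjPr adj_inj.
Qed.

Lemma sq_prod (I : finType) J (u : ell2 R (I * J)%type) :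
  sq u = \sum_i sq (rowop R J i u).
Proof.
apply: complexI; rewrite -ipxx ip_prod rmorph_sum; apply: eq_bigr => i _.
exact: ipxx.
Qed.

Lemma row_blockop (I I' : finType) J J' (A : I' -> I -> bop R J J') i' u :
  rowop R J' i' (blockop A u) = \sum_i A i' i (rowop R J i u).
Proof.
rewrite /blockop bop_sumE linear_sum.
rewrite (eq_bigr (fun k => if i' == k then \sum_i A k i (rowop R J i u) else 0)).
  by rewrite -big_mkcond (big_pred1 i')// => k; rewrite eq_sym.
move=> k _; rewrite bop_sumE linear_sum.
rewrite (eq_bigr (fun i => if i' == k then A k i (rowop R J i u) else 0)) => [|i _].
  by case: ifP => // _; rewrite big1.
exact: row_inj.
Qed.

Lemma blockE (I I' J J' : choiceType) (T : bop R (I * J)%type (I' * J')%type) i' i u :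
  block T i' i u = rowop R J' i' (T (injop R J i u)).
Proof. by []. Qed.

Lemma big_delta (I : finType) (V : nmodType) i (f : I -> V) :
  (forall k, k != i -> f k = 0) -> \sum_k f k = f i.
Proof. by move=> f0; rewrite (bigD1 i)//= big1 ?addr0. Qed.

Lemma block_blockop (I I' : finType) J J' (A : I' -> I -> bop R J J') i' i :
  block (blockop A) i' i = A i' i.
Proof.
apply: bopP => u; rewrite blockE row_blockop (@big_delta _ _ i) => [|k ki].
  by rewrite row_inj eqxx.
by rewrite row_inj (negPf ki) linear0.
Qed.

Lemma blockP (I I' : choiceType) J J' (S T : bop R (I * J)%type (I' * J')%type) :
  (forall i' i, block S i' i = block T i' i) -> S = T.
Proof.
move=> ST; apply: bop_deltaP => -[i j] [i' j'].
have := congr1 (fun X : bop R J J' => X (delta R j) j') (ST i' i).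
by rewrite !blockE !inj_delta.
Qed.

(** For finite [I] the block operator with entries [psi (block T i i')] is a witness for the [xget]
    in [idtens]. *)
Lemma block_idtens (I : finType) J J' (psi : bop R J J -> bop R J' J')
    (T : bop R (I * J)%type (I * J)%type) i i' :
  block (idtens psi T) i i' = psi (block T i i').
Proof.
move: i i'; apply: (@xgetPex _ 0 [set S | forall i i' : I, block S i i' = psi (block T i i')]).
by exists (blockop (fun i i' => psi (block T i i'))) => i i' /=; rewrite block_blockop.
Qed.

Lemma ip_block (I : finType) J (T : bop R (I * J)%type (I * J)%type) u v :
  ip (T u) v = \sum_i \sum_i' ip (block T i i' (rowop R J i' u)) (rowop R J i v).
Proof.
rewrite -[T in LHS](@blockP _ _ _ _ (blockop (fun i i' => block T i i'))); last first.
  by move=> ? ?; rewrite block_blockop.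
rewrite ip_prod; apply: eq_bigr => i _; rewrite row_blockop ip_suml.
by [].
Qed.

Lemma ptws_cvgP (U : choiceType) (V : topologicalType) (F : set_system {ptws U -> V})
    {FF : Filter F} (f : {ptws U -> V}) :
  F --> f <-> forall t, (fun g : {ptws U -> V} => g t) @ F --> f t.
Proof.
split=> [Ff t|h].
  have h := @proj_continuous U (fun=> V) t f.
  apply: cvg_trans; last exact: h.
  exact: cvg_app Ff.
apply/cvg_sup => i A [B [[W oW <-] Wf WA]].
apply: filterS WA _; apply: (h i); exact: open_nbhs_nbhs.
Qed.

Lemma bop_cvgP I J (T : Type) (F : set_system T) {FF : Filter F} (f : T -> bop R I J)
    (S : bop R I J) :
  f @ F --> S <-> forall w1 w2, tendsto F (fun x => ip (ampl nat (f x) w1) w2)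
     (ip (ampl nat S w1) w2).
Proof.
split=> [fS w1 w2|h].
  constructor; have := (@initial_continuous _ _ (@ultraweak R I J) S).
  move=> /(cvg_comp _ _ fS) /ptws_cvgP /(_ (w1, w2)).
  exact.
move=> U [? [[W oW <-]] /= WS /filterS]; apply.
have : (fun x => ultraweak (f x)) @ F --> ultraweak S.
  by apply/ptws_cvgP => -[w1 w2]; case: (h w1 w2).
by apply; exact: open_nbhs_nbhs.
Qed.

(** A pair of vectors is a pair of square-summable sequences concentrated at index [0], so the weak*
    functionals include all [T |-> <T u, v>]. *)
Lemma bop_weak_cvg I J (T : Type) (F : set_system T) {FF : Filter F} (f : T -> bop R I J)
    (S : bop R I J) : f @ F --> S ->
  forall u v, tendsto F (fun x => ip (f x u) v) (ip (S u) v).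
Proof.
move=> /bop_cvgP h u v; have := h (injop R I 0%N u) (injop R J 0%N v).
rewrite ampl_inj adjPr adj_inj row_inj eqxx.
rewrite (_ : (fun x => _) = fun x => ip (f x u) v)//.
by apply/funext => x; rewrite ampl_inj adjPr adj_inj row_inj eqxx.
Qed.

Lemma opsum_weak (N : choiceType) I J (T : N -> bop R I J) S : opsum T S ->
  forall u v, tendsto totally (fun A : {fset N} => \sum_(i <- A) ip (T i u) v) (ip (S u) v).
Proof.
move=> /bop_weak_cvg h u v.
rewrite (_ : (fun A => _) = fun A : {fset N} => ip (partial_sum T A u) v) //.
by apply/funext => A; rewrite psumE bop_sumE ip_suml.
Qed.

Lemma opsum_fin (N : finType) I J (T : N -> bop R I J) : opsum T (\sum_i T i).
Proof.
apply: cvg_near_cst; exists [fset i | i in N]%fset => // A /= /fsubsetP AI.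
rewrite psumE -[RHS]big_enum /=; apply: perm_big; apply: uniq_perm; rewrite ?fset_uniq ?enum_uniq//.
by move=> i; rewrite mem_enum; apply: AI; apply/imfsetP; exists i.
Qed.

End Tensor.

(** * Ultralimits of bounded operators *)

Section Ultra.
Variable R : realType.
Notation C := R[i].
Local Notation Re := complex.Re.
Local Notation Im := complex.Im.
Implicit Types I J K : choiceType.

Lemma ultra_bounded_cvg (T : Type) (U : set_system T) (f : T -> R) (M : R) :
  UltraFilter U -> (forall x, `|f x| <= M) -> exists l : R, f @ U --> l.
Proof.
move=> UU fM.
have : (f @ U) `[- M, M]%classic.
  apply: (@filterS _ U _ setT) => [x _ /=|]; last exact: filterT.
  by rewrite in_itv /= -ler_norml.
move=> /(@segment_compact _ _ _ _ _)[l [_ lc]]; exists l => V nV.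
have [//|nU] := in_ultra_setVsetC (f @^-1` V) UU.
by have [y [ny Vy]] := lc (~` V) V nU nV.
Qed.

Lemma normsq_Re (z : C) : Re z ^+ 2 <= normsq z.
Proof. by rewrite /normsq lerDl sqr_ge0. Qed.

Lemma normsq_Im (z : C) : Im z ^+ 2 <= normsq z.
Proof. by rewrite /normsq lerDr sqr_ge0. Qed.

Lemma sqr_le_norm (x M : R) : x ^+ 2 <= M -> `|x| <= 1 + M.
Proof. by move=> h; rewrite ler_norml; nra. Qed.

Lemma ultra_bounded_tendsto (T : Type) (U : set_system T) (f : T -> C) (M : R) :
  UltraFilter U -> (forall x, normsq (f x) <= M) -> exists l : C, tendsto U f l.
Proof.
move=> UU fM.
have [|a ha] := @ultra_bounded_cvg T U (fun x => Re (f x)) (1 + M) UU.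
  by move=> x; apply: sqr_le_norm; apply: le_trans (normsq_Re _) _.
have [|b hb] := @ultra_bounded_cvg T U (fun x => Im (f x)) (1 + M) UU.
  by move=> x; apply: sqr_le_norm; apply: le_trans (normsq_Im _) _.
by exists (Complex a b); apply: tendstoP.
Qed.

Lemma tendsto_le (T : Type) (F : set_system T) {FF : ProperFilter F} (f g : T -> C)
    (l m : C) : tendsto F f l -> tendsto F g m ->
  (\forall x \near F, Re (f x) <= Re (g x)) -> Re l <= Re m.
Proof.
move=> fl gm fg; rewrite -subr_ge0.
have -> : Re m - Re l = Re (m + (-1) * l) by case: (m) (l) => [? ?] [? ?] /=; ring.
apply: (tendsto_ge0 (tendstoD gm (tendstoZ (-1) fl))).
apply: filterS fg => x; rewrite -subr_ge0.
by case: (f x) (g x) => [? ?] [? ?] /= h; lra.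
Qed.

Lemma tendsto_normsq_le (T : Type) (F : set_system T) {FF : ProperFilter F} (f : T -> C)
    (l : C) (M : R) : tendsto F f l -> (\forall x \near F, normsq (f x) <= M) ->
  normsq l <= M.
Proof.
move=> fl fM.
have h1 : (fun x => normsq (f x)) @ F --> normsq l.
  rewrite /normsq; apply: cvgD; rewrite expr2.
    under eq_fun do rewrite expr2.
    by apply: cvgM; exact: tendsto_Re.
  under eq_fun do rewrite expr2.
  by apply: cvgM; exact: tendsto_Im.
exact: (cvgr_to_le h1).
Qed.

(** Weak compactness of bounded sets of operators: along an ultrafilter every bounded scalar family
    [<f x u, v>] converges, and the limits form a bounded sesquilinear form, hence an operator by
    [riesz]. *)
Lemma bop_ulim (T : Type) (U : set_system T) I J (f : T -> bop R I J) (M : R) :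
  UltraFilter U -> 0 <= M ->
  (forall x u v, normsq (ip (f x u) v) <= M * (sq u * sq v)) ->
  exists S : bop R I J, forall u v, tendsto U (fun x => ip (f x u) v) (ip (S u) v).
Proof.
move=> UU M0 fM.
have /choice [B' hB'] (w : ell2 R I * ell2 R J) :
    exists l, tendsto U (fun x => ip (f x w.1) w.2) l.
  exact: (ultra_bounded_tendsto _ (fun x => fM x w.1 w.2)).
pose B u v := B' (u, v).
have hB u v : tendsto U (fun x => ip (f x u) v) (B u v) by exact: hB' (u, v).
have [|S [SB _]] := @riesz R I J M B; last by exists S => u v; rewrite SB.
split=> //.
- move=> c u u' v; apply: (tendsto_unique (hB _ _)).
  rewrite (_ : (fun x => _) = fun x => c * ip (f x u) v + ip (f x u') v).
    by apply: tendstoD => //; apply: tendstoZ.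
  by apply/funext => x; rewrite linearP ipDl ipZl.
- move=> c u v v'; apply: (tendsto_unique (hB _ _)).
  rewrite (_ : (fun x => _) = fun x => conjc c * ip (f x u) v + ip (f x u) v').
    by apply: tendstoD => //; apply: tendstoZ.
  by apply/funext => x; rewrite ipDr ipZr.
- move=> u v; apply: (tendsto_normsq_le (hB u v)).
  by apply: filterS filterT => x _; exact: fM.
Qed.

(** For self-adjoint [S] and [0 <= M] this is the bound [|S| <= M], expressed through the quadratic
    form so that it passes directly to sums of compressions and to weak limits. *)
Definition sabound I (M : R) (S : bop R I I) : Prop :=
  selfadj S /\ forall u, `|rq S u| <= M * sq u.

Lemma le_sqB I (u v : ell2 R I) : 2 * Re (ip u v) <= sq u + sq v.
Proof. by have := sq_ge0 (u - v); rewrite sqB; lra. Qed.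

(** For self-adjoint operators the numerical radius bounds the norm: polarization gives
    [2 Re <S u, v> <= M (|u|^2 + |v|^2)], and [v] is then taken parallel to [S u]. *)
Lemma sabound_sq I (M : R) (S : bop R I I) u : 0 <= M -> sabound M S ->
  sq (S u) <= M ^+ 2 * sq u.
Proof.
move=> M0 [sS SM].
have key v : 2 * Re (ip (S u) v) <= M * (sq u + sq v).
  have := SM (u + v); have := SM (u - v).
  rewrite !ler_norml sqB sqD /rq linearB linearD !ipDl !ipDr !ipNl !ipNr.
  have -> : ip (S v) u = conjc (ip (S u) v) by rewrite -ipC adjP sS.
  case: (ip (S u) v) (ip u v) (ip (S u) u) (ip (S v) v) => [p q] [p' q'] [a b] [a' b'] /=.
  by move=> /andP[h1 h2] /andP[h3 h4]; nra.
have [M00|Mn] := eqVneq M 0.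
  have := key (S u); rewrite M00 mul0r expr0n mul0r ipxx /=; have := sq_ge0 (S u); lra.
have Mp : 0 < M by rewrite lt_neqAle eq_sym Mn.
(* [v = S u / M] balances the two terms; for [M = 0] the choice [v = S u] has already settled the
   claim. *)
have := key ((M^-1)%:C%C *: S u).
rewrite sqZ ipZr ipxx conjc_real -rmorphM /=.
have -> : normsq (M^-1)%:C%C = M^-1 ^+ 2 by rewrite /normsq /= expr0n addr0.
move=> h.
have : M * (2 * (M^-1 * sq (S u))) <= M * (M * (sq u + M^-1 ^+ 2 * sq (S u))).
  by rewrite ler_pM2l.
have -> : M * (2 * (M^-1 * sq (S u))) = 2 * sq (S u) by field.
have -> : M * (M * (sq u + M^-1 ^+ 2 * sq (S u))) = M ^+ 2 * sq u + sq (S u) by field.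
lra.
Qed.

Lemma selfadj_lim (T : Type) (F : set_system T) {FF : ProperFilter F} I
    (f : T -> bop R I I) (S : bop R I I) :
  (forall u v, tendsto F (fun x => ip (f x u) v) (ip (S u) v)) ->
  (\forall x \near F, selfadj (f x)) -> selfadj S.
Proof.
move=> fS sf; apply: adj_uniq => u v; rewrite (ipC u).
apply: (tendsto_unique (fS u v)).
have h := tendsto_conj (fS v u); move: h => [h]; constructor.
apply: cvg_trans h; apply: near_eq_cvg; apply: filterS sf => x sx.
by rewrite -ipC adjPr sx.
Qed.

Lemma sabound_ulim (T : Type) (U : set_system T) I (f : T -> bop R I I) (M : R) :
  UltraFilter U -> 0 <= M -> (forall x, sabound M (f x)) ->
  exists2 S : bop R I I, sabound M S &
    forall u v, tendsto U (fun x => ip (f x u) v) (ip (S u) v).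
Proof.
move=> UU M0 fM.
have [|x u v|S hS] := @bop_ulim T U I I f (M ^+ 2) UU; first exact: sqr_ge0.
  apply: le_trans (normsq_ip_le _ _) _; rewrite mulrA ler_wpM2r ?sq_ge0//.
  exact: sabound_sq.
exists S => //; split.
  by apply: (selfadj_lim hS); apply: filterS filterT => x _; case: (fM x).
move=> u; rewrite ler_norml; apply/andP; split.
  have hc : tendsto U (fun=> (- (M * sq u))%:C%C) ((- (M * sq u))%:C%C).
    exact: tendsto_cst.
  suff: Re ((- (M * sq u))%:C%C) <= Re (ip (S u) u) by [].
  apply: (tendsto_le hc (hS u u)); apply: filterS filterT => x _ /=.
  by case: (fM x) => _ /(_ u); rewrite ler_norml => /andP[].
have hc : tendsto U (fun=> (M * sq u)%:C%C) ((M * sq u)%:C%C).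
  exact: tendsto_cst.
suff: Re (ip (S u) u) <= Re ((M * sq u)%:C%C) by [].
apply: (tendsto_le (hS u u) hc); apply: filterS filterT => x _ /=.
by case: (fM x) => _ /(_ u); rewrite ler_norml => /andP[].
Qed.

Lemma bop_cvg_lin (T : Type) (F : set_system T) {FF : Filter F} I J
    (f g : T -> bop R I J) (S S' : bop R I J) (a b : C) :
  f @ F --> S -> g @ F --> S' -> (fun x => a *: f x + b *: g x) @ F --> a *: S + b *: S'.
Proof.
move=> /bop_cvgP hf /bop_cvgP hg; apply/bop_cvgP => w1 w2.
rewrite (_ : (fun x => _) = fun x => a * ip (ampl nat (f x) w1) w2 + b * ip (ampl nat (g x) w1) w2).
  by rewrite amplD !amplZ bopDE !bopZE ipDl !ipZl; apply: tendstoD; apply: tendstoZ.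
by apply/funext => x; rewrite amplD !amplZ bopDE !bopZE ipDl !ipZl.
Qed.

Lemma bop_cvg_adj (T : Type) (F : set_system T) {FF : Filter F} I J
    (f : T -> bop R I J) (S : bop R I J) : f @ F --> S -> (fun x => adj (f x)) @ F --> adj S.
Proof.
move=> /bop_cvgP hf; apply/bop_cvgP => w1 w2.
rewrite (_ : (fun x => _) = fun x => conjc (ip (ampl nat (f x) w2) w1)).
  by rewrite -adj_ampl -adjPr ipC; apply: tendsto_conj.
by apply/funext => x; rewrite -adj_ampl -adjPr ipC.
Qed.

Lemma opsum_lin (N : choiceType) I J (f g : N -> bop R I J) (S S' : bop R I J) (a b : C) :
  opsum f S -> opsum g S' -> opsum (fun x => a *: f x + b *: g x) (a *: S + b *: S').
Proof.
move=> hf hg; rewrite /opsum.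
rewrite (_ : partial_sum _ = fun A => a *: partial_sum f A + b *: partial_sum g A).
  exact: bop_cvg_lin.
by apply/funext => A; rewrite !psumE big_split /= -!scaler_sumr.
Qed.

Lemma opsum_adj (N : choiceType) I J (f : N -> bop R I J) (S : bop R I J) :
  opsum f S -> opsum (fun x => adj (f x)) (adj S).
Proof.
move=> hf; rewrite /opsum.
rewrite (_ : partial_sum _ = fun A => adj (partial_sum f A)); first exact: bop_cvg_adj.
by apply/funext => A; rewrite !psumE adj_sum.
Qed.

Lemma comp_pen (I J K : choiceType) (S : bop R J K) (T : bop R I J) (X : bop R J J)
    (a b : C) :
  S *o (a *: idop R J + b *: (X + adj X)) *o T =
  a *: (S *o T) + b *: (S *o X *o T + S *o adj X *o T).
Proof.
apply: bopP => u.
have key p q r : S (a *: p + b *: (q + r)) = a *: S p + b *: (S q + S r).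
  by rewrite linearD !linearZ linearD.
exact: key.
Qed.

(** * Affine functions of one coordinate, and the nc ball as a system of affine inequalities *)

Section Pencil.
Variable k : nat.

(* The ball contains tuples that are not self-adjoint, so the coordinates enter through
   [x_j + x_j^*]. *)
Definition pen (j : 'I_k) (a b : C) : ncfun R k :=
  fun n x => a *: idop R (idx n) + b *: (x j + adj (x j)).

Lemma pen_cont_affine (r : R) j a b : cont_affine r (pen j a b).
Proof.
split; first split.
- move=> N n d x al y _ _ ial s1 sx; have sx' := opsum_adj (sx j).
  have sum2 := @opsum_lin _ _ _ _ _ _ _ 1 1 (sx j) sx'.
  have := @opsum_lin _ _ _ _ _ _ _ a b s1 sum2.
  rewrite /pen !scale1r; congr (opsum _ _); apply/funext => i.
  rewrite comp_pen !scale1r.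
  rewrite !adj_comp adjK; congr (_ + _ *: (_ + _)).
  by apply: bopP.
- move=> n m x g _ ig; rewrite /pen comp_pen ig; congr (_ + _ *: (_ + _)).
  by rewrite /conjt !adj_comp adjK; apply: bopP.
- move=> n; apply: continuous_subspaceT => x; rewrite /pen.
  have hx : (fun y : tuples R k n => y j) @ x --> x j.
    by have /ptws_cvgP := @cvg_id _ (nbhs x); apply.
  have FF : Filter (nbhs x) by exact: nbhs_filter.
  have hx' := @bop_cvg_adj _ _ FF _ _ _ _ hx.
  have h2 : (fun y : tuples R k n => y j + adj (y j)) @ x --> x j + adj (x j).
    have -> : (fun y : tuples R k n => y j + adj (y j)) =
        fun y => 1 *: y j + 1 *: adj (y j).
      by apply/funext => y; rewrite !scale1r.
    have := @bop_cvg_lin _ _ FF _ _ _ _ _ _ 1 1 hx hx'.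
    by rewrite !scale1r.
  have hid : (fun=> idop R (idx n)) @ x --> idop R (idx n) by exact: cvg_cst.
  have := @bop_cvg_lin _ _ FF _ _ _ _ _ _ a b hid h2.
  by [].
Qed.

Lemma ncball_adjP (r : R) n (x : tuples R k n) :
  ncball r x <-> forall u, \sum_j sq (adj (x j) u) <= r ^+ 2 * sq u.
Proof.
have rqE u : rq (\sum_(j < k) x j *o adj (x j)) u = \sum_j sq (adj (x j) u).
  rewrite /rq bop_sumE ip_suml; apply: complexI.
  rewrite (_ : \sum_(i < k) _ = (\sum_j sq (adj (x j) u))%:C%C) //.
  rewrite rmorph_sum; apply: eq_bigr => j _.
  by rewrite -[LHS]/(ip (x j (adj (x j) u)) u) adjP; exact: ipxx.
have sE u : rq ((r ^+ 2)%:C%C *: idop R (idx n)) u = r ^+ 2 * sq u.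
  by rewrite /rq bopZE ipZl ipxx -rmorphM.
rewrite /ncball /= oplePf.
- by split=> h u; have := h u; rewrite rqE sE.
- by rewrite /selfadj adj_sum; apply: eq_bigr => j _; rewrite adj_comp adjK.
- by rewrite /selfadj adj_scale adj_id conjc_real.
Qed.

(* AM-GM linearization: this form of the row-contraction condition is affine in
   [x], hence stable under convex combinations and weak limits. *)
Lemma ncballP (r : R) n (x : tuples R k n) :
  ncball r x <-> forall u (v : 'I_k -> ell2 R (idx n)),
    2 * \sum_j Re (ip (x j (v j)) u) <= r ^+ 2 * sq u + \sum_j sq (v j).
Proof.
rewrite ncball_adjP; split=> [h u v|h u].
  rewrite mulr_sumr; apply: le_trans (lerD (h u) (lexx _)).
  rewrite -big_split /=; apply: ler_sum => j _.
  by rewrite adjP ipC complexRe_conj; exact: le_sqB.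
have := h u (fun j => adj (x j) u).
have -> : \sum_j Re (ip (x j (adj (x j) u)) u) = \sum_j sq (adj (x j) u).
  by apply: eq_bigr => j _; rewrite adjP sqRe.
lra.
Qed.

Lemma ncball_sq (r : R) n (x : tuples R k n) j u : 0 < r -> ncball r x ->
  sq (x j u) <= r ^+ 2 * sq u.
Proof.
move=> r0 /ncballP h.
(* The factor [r^2] is chosen so that the inequality becomes [2 r^2 |x_j u|^2 <= r^2 |x_j u|^2 + r^4
   |u|^2]. *)
have := h (x j u) (fun i => if i == j then (r ^+ 2)%:C%C *: u else 0).
rewrite (@big_delta _ _ j) => [|i /negPf ij]; last by rewrite ij linear0 ip0l.
rewrite (@big_delta _ _ j) => [|i /negPf ij]; last by rewrite ij sq0.
rewrite eqxx linearZ ipZl ipxx -rmorphM /= sqZ.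
have -> : normsq (r ^+ 2)%:C%C = r ^+ 2 * r ^+ 2 by rewrite /normsq /= expr0n addr0 -expr2.
have r2 : 0 < r ^+ 2 by rewrite exprn_gt0.
by move=> h'; rewrite -(ler_pM2l r2); lra.
Qed.

End Pencil.
End Ultra.

(** * Matrix pencils *)

Section Cuts.
Variable R : realType.
Notation C := R[i].
Local Notation Re := complex.Re.

Lemma tendsto_sub (T : Type) (F G : set_system T) (f : T -> C) l :
  F `<=` G -> tendsto F f l -> tendsto G f l.
Proof. by move=> FG [h]; constructor; apply: cvg_trans h => A; exact: FG. Qed.

Lemma complexReD (z w : C) : Re (z + w) = Re z + Re w. Proof. exact: raddfD. Qed.
Lemma complexReZ (a : R) (z : C) : Re (a%:C%C * z) = a * Re z.
Proof. by case: z => x y /=; rewrite mul0r subr0. Qed.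
Lemma complexRe_sum (K : Type) (s : seq K) (P : pred K) (f : K -> C) :
  Re (\sum_(k <- s | P k) f k) = \sum_(k <- s | P k) Re (f k).
Proof. exact: raddf_sum. Qed.

Lemma ler_term (I : finType) (f : I -> R) i : (forall j, 0 <= f j) -> f i <= \sum_j f j.
Proof. by move=> f0; rewrite (bigD1 i)//= lerDl sumr_ge0. Qed.

Lemma adj_blockop (I I' : finType) (J J' : choiceType) (A : I' -> I -> bop R J J') :
  adj (blockop A) = blockop (fun i i' => adj (A i' i)).
Proof.
apply: adj_uniq => u v; rewrite !ip_prod.
under eq_bigr do rewrite row_blockop ip_suml.
under [RHS]eq_bigr do rewrite row_blockop ip_sumr.
rewrite exchange_big; apply: eq_bigr => i _; apply: eq_bigr => i' _.
exact: adjP.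
Qed.

Lemma selfadj_conj (I J : choiceType) (T : bop R J J) (V : bop R I J) :
  selfadj T -> selfadj (adj V *o T *o V).
Proof. by move=> sT; rewrite /selfadj !adj_comp adjK sT; apply: bopP. Qed.

Lemma rq_conj (I J : choiceType) (T : bop R J J) (V : bop R I J) u :
  rq (adj V *o T *o V) u = rq T (V u).
Proof. by rewrite /rq -[ip _ u]/(ip (adj V (T (V u))) u) -adjPr. Qed.

Lemma rqD (I : choiceType) (S T : bop R I I) u : rq (S + T) u = rq S u + rq T u.
Proof. by rewrite /rq bopDE ipDl complexReD. Qed.

Lemma rq_sum (I : choiceType) (K : Type) (s : seq K) (P : pred K)
    (f : K -> bop R I I) u :
  rq (\sum_(k <- s | P k) f k) u = \sum_(k <- s | P k) rq (f k) u.
Proof. by rewrite /rq bop_sumE ip_suml complexRe_sum. Qed.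

Lemma selfadj_sum (I : choiceType) (K : Type) (s : seq K) (P : pred K)
    (f : K -> bop R I I) : (forall k, selfadj (f k)) ->
  selfadj (\sum_(k <- s | P k) f k).
Proof. by move=> sf; rewrite /selfadj adj_sum; apply: eq_bigr => k _; exact: sf. Qed.

Lemma rq_ampl (I : finType) (J : choiceType) (T : bop R J J) u :
  rq (ampl I T) u = \sum_i rq T (rowop R J i u).
Proof. by rewrite /rq ip_prod complexRe_sum. Qed.

Lemma sq_ampl (I : finType) (J J' : choiceType) (T : bop R J J') u :
  sq (ampl I T u) = \sum_i sq (T (rowop R J i u)).
Proof. by rewrite sq_prod. Qed.

Lemma selfadj_ampl (I J : choiceType) (T : bop R J J) : selfadj T -> selfadj (ampl I T).
Proof. by move=> sT; rewrite /selfadj adj_ampl sT. Qed.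

(** The partial sums of [sum_i |al_i u|^2] increase, and their limit is [|u|^2]. This bounds every
    finite part of a convex combination, before any convergence question. *)
Lemma sum_sq_isom (N I : choiceType) (d : N -> choiceType) (al : forall i : N, bop R I (d i)) :
  opsum (fun i => adj (al i) *o al i) (idop R I) ->
  forall (A : {fset N}) u, \sum_(i <- A) sq (al i u) <= sq u.
Proof.
move=> /opsum_weak h A u; have := h u u => hu.
have hc : tendsto (@totally N) (fun=> (\sum_(i <- A) sq (al i u))%:C%C)
    ((\sum_(i <- A) sq (al i u))%:C%C) by exact: tendsto_cst.
have := tendsto_le hc hu; rewrite ipxx; apply.
exists A => // B /= AB; rewrite complexRe_sum.
rewrite [leRHS](eq_bigr (fun i => sq (al i u))) => [|i _]; last first.
  by rewrite sqRe -[ip ((_ *o _) u) u]/(ip (adj (al i) (al i u)) u) -adjPr.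
rewrite [leRHS](big_fsetID _ (mem A)) /=.
rewrite (_ : [fset x in B | x \in A]%fset = A).
  by rewrite lerDl sumr_ge0// => i _; exact: sq_ge0.
apply/fsetP => x; rewrite !inE /= andbC; case: (boolP (x \in A)) => //=.
exact: (fsubsetP AB).
Qed.

Variables (k s p : nat).

Section Form.
Variables A B : 'I_s -> 'I_s -> 'I_p -> 'I_p -> C.

Definition pformW (w z : 'I_s -> 'I_s -> 'I_p -> 'I_p -> C) : C :=
  \sum_s1 \sum_s2 \sum_p1 \sum_p2
    (A s1 s2 p1 p2 * w s1 s2 p1 p2 +
     B s1 s2 p1 p2 * (z s1 s2 p1 p2 + conjc (z s2 s1 p2 p1))).

Definition pform n (x : opM R n n) (xi : 'I_s -> 'I_p -> ell2 R (idx n)) : C :=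
  pformW (fun s1 s2 p1 p2 => ip (xi s2 p2) (xi s1 p1))
         (fun s1 s2 p1 p2 => ip (x (xi s2 p2)) (xi s1 p1)).

Lemma pformW_cvg (T : Type) (F : set_system T) {FF : Filter F}
    (w z : T -> 'I_s -> 'I_s -> 'I_p -> 'I_p -> C) w0 z0 :
  (forall s1 s2 p1 p2, tendsto F (fun t => w t s1 s2 p1 p2) (w0 s1 s2 p1 p2)) ->
  (forall s1 s2 p1 p2, tendsto F (fun t => z t s1 s2 p1 p2) (z0 s1 s2 p1 p2)) ->
  tendsto F (fun t => pformW (w t) (z t)) (pformW w0 z0).
Proof.
move=> hw hz; do 4!(apply: tendsto_sum => ?).
apply: tendstoD; apply: tendstoZ => //.
by apply: tendstoD => //; exact: tendsto_conj.
Qed.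

Lemma pformW_sum (T : choiceType) (l : seq T)
    (w z : T -> 'I_s -> 'I_s -> 'I_p -> 'I_p -> C) :
  \sum_(t <- l) pformW (w t) (z t) =
  pformW (fun s1 s2 p1 p2 => \sum_(t <- l) w t s1 s2 p1 p2)
         (fun s1 s2 p1 p2 => \sum_(t <- l) z t s1 s2 p1 p2).
Proof.
rewrite /pformW exchange_big; apply: eq_bigr => s1 _.
rewrite exchange_big; apply: eq_bigr => s2 _.
rewrite exchange_big; apply: eq_bigr => p1 _.
rewrite exchange_big; apply: eq_bigr => p2 _.
rewrite big_split /= -!mulr_sumr big_split /=; congr (_ + _ * (_ + _)).
by rewrite rmorph_sum.
Qed.

(** The bound is crude, entry by entry. What matters is that [L] depends neither on the level [n]
    nor on [x], so that a single multiple of the identity lies in the cut at every point of the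
    ball. *)
Lemma pform_bound (r : R) : 0 < r -> exists L : R, 0 <= L /\
  forall n (x : opM R n n), (forall u, sq (x u) <= r ^+ 2 * sq u) ->
  forall xi, Re (pform x xi) <= L * \sum_s1 \sum_p1 sq (xi s1 p1).
Proof.
move=> r0.
(* Each entry is estimated by [Re (a <u, v>) <= (|a|^2 t + 1) X], with [t = 1] for [A] and [t = r^2]
   for the two terms carrying [B]. *)
pose c s1 s2 p1 p2 := (normsq (A s1 s2 p1 p2) + 1) + 2 * (normsq (B s1 s2 p1 p2) * r ^+ 2 + 1).
have c0 s1 s2 p1 p2 : 0 <= c s1 s2 p1 p2.
  have := normsq_ge0 (A s1 s2 p1 p2).
  have : 0 <= normsq (B s1 s2 p1 p2) * r ^+ 2 by rewrite mulr_ge0 ?normsq_ge0 ?sqr_ge0.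
  rewrite /c; lra.
exists (\sum_s1 \sum_s2 \sum_p1 \sum_p2 c s1 s2 p1 p2); split.
  by do 4!(apply: sumr_ge0 => ? _).
move=> n x xr xi; set X := \sum_s1 \sum_p1 sq (xi s1 p1).
have Xle s1 p1 : sq (xi s1 p1) <= X.
  apply: (@le_trans _ _ (\sum_p1 sq (xi s1 p1))).
    by apply: (@ler_term _ (fun p1 => sq (xi s1 p1))) => ?; exact: sq_ge0.
  apply: (@ler_term _ (fun s1 => \sum_p1 sq (xi s1 p1))) => ?.
  by apply: sumr_ge0 => ? _; exact: sq_ge0.
have key (a : C) (u v : ell2 R (idx n)) t : 0 <= t -> sq u <= t * X -> sq v <= X ->
    Re (a * ip u v) <= (normsq a * t + 1) * X.
  move=> t0 hu hv; have := le_sqB (a *: u) v; rewrite sqZ ipZl => h.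
  have h1 : normsq a * sq u <= normsq a * (t * X) by rewrite ler_wpM2l ?normsq_ge0.
  have X0 : 0 <= X by apply: le_trans (sq_ge0 v) hv.
  have h2 : 0 <= normsq a * (t * X) by rewrite !mulr_ge0 ?normsq_ge0.
  nra.
rewrite /pform /pformW !complexRe_sum mulr_suml; apply: ler_sum => s1 _.
rewrite !complexRe_sum mulr_suml; apply: ler_sum => s2 _.
rewrite !complexRe_sum mulr_suml; apply: ler_sum => p1 _.
rewrite !complexRe_sum mulr_suml; apply: ler_sum => p2 _.
set a := A _ _ _ _; set b := B _ _ _ _; rewrite mulrDr !complexReD.
have h1 : Re (a * ip (xi s2 p2) (xi s1 p1)) <= (normsq a * 1 + 1) * X.
  by apply: key; [exact: ler01|rewrite mul1r; exact: Xle|exact: Xle].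
have xX u : sq u <= X -> sq (x u) <= r ^+ 2 * X.
  by move=> h; apply: le_trans (xr u) _; rewrite ler_wpM2l ?sqr_ge0.
have h2 : Re (b * ip (x (xi s2 p2)) (xi s1 p1)) <= (normsq b * r ^+ 2 + 1) * X.
  by apply: key; [exact: sqr_ge0|apply: xX; exact: Xle|exact: Xle].
have h3 : Re (b * conjc (ip (x (xi s1 p1)) (xi s2 p2))) <= (normsq b * r ^+ 2 + 1) * X.
  have -> : Re (b * conjc (ip (x (xi s1 p1)) (xi s2 p2))) =
      Re (conjc b * ip (x (xi s1 p1)) (xi s2 p2)).
    by rewrite -complexRe_conj conjCM conjcK.
  have -> : normsq b = normsq (conjc b) by case: (b) => ? ?; rewrite /normsq /= sqrrN.
  by apply: key; [exact: sqr_ge0|apply: xX; exact: Xle|exact: Xle].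
apply: (@le_trans _ _ ((normsq a * 1 + 1) * X +
  ((normsq b * r ^+ 2 + 1) * X + (normsq b * r ^+ 2 + 1) * X))).
  by apply: lerD => //; apply: lerD.
rewrite /c -/a -/b; lra.
Qed.

Lemma ip_evalpen (j : 'I_k) n (x : tuples R k n) (z : ell2 R ('I_s * ('I_p * idx n))%type) :
  ip (evalmx (fun s1 s2 p1 p2 => pen j (A s1 s2 p1 p2) (B s1 s2 p1 p2)) x z) z =
  pform (x j) (fun s1 p1 => rowop R _ p1 (rowop R _ s1 z)).
Proof.
rewrite /evalmx ip_prod; apply: eq_bigr => s1 _.
rewrite row_blockop ip_suml; apply: eq_bigr => s2 _.
rewrite ip_prod; apply: eq_bigr => p1 _.
rewrite row_blockop ip_suml; apply: eq_bigr => p2 _.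
rewrite /pen bopDE !bopZE bopDE ipDl !ipZl ipDl.
by rewrite -[ip (adj _ _) _]adjPr (ipC _ (x j _)).
Qed.

Lemma selfadj_evalpen (j : 'I_k) n (x : tuples R k n) :
  (forall s1 s2 p1 p2, A s1 s2 p1 p2 = conjc (A s2 s1 p2 p1)) ->
  (forall s1 s2 p1 p2, B s1 s2 p1 p2 = conjc (B s2 s1 p2 p1)) ->
  selfadj (evalmx (fun s1 s2 p1 p2 => pen j (A s1 s2 p1 p2) (B s1 s2 p1 p2)) x).
Proof.
move=> hA hB; rewrite /selfadj /evalmx adj_blockop; congr blockop.
apply/funext => s1; apply/funext => s2; rewrite adj_blockop; congr blockop.
apply/funext => p1; apply/funext => p2.
rewrite /pen adjD !adj_scale adj_id adjD adjK -hA -hB.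
by congr (_ + _ *: _); rewrite addrC.
Qed.

End Form.

End Cuts.

(** * Truncated cut maps *)

Section Truncation.
Variable R : realType.
Notation C := R[i].
Local Notation Re := complex.Re.
Variables (k s p q : nat) (hp : (0 < p)%N) (hq : (0 < q)%N).
Variable jj : 'I_q -> 'I_k.
Variables A B : 'I_q -> 'I_s -> 'I_s -> 'I_p -> 'I_p -> C.
Hypothesis hA : forall i s1 s2 p1 p2, A i s1 s2 p1 p2 = conjc (A i s2 s1 p2 p1).
Hypothesis hB : forall i s1 s2 p1 p2, B i s1 s2 p1 p2 = conjc (B i s2 s1 p2 p1).

Definition pencut : forall i : 'I_q, 'I_s -> 'I_s -> 'I_p -> 'I_p -> ncfun R k :=
  fun i s1 s2 p1 p2 => pen (jj i) (A i s1 s2 p1 p2) (B i s1 s2 p1 p2).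

Definition pencutmap : mvfun R k (Fin hp) := cutmap hp (s := fun=> s) pencut.

Lemma pencutP n (x : tuples R k n) (al : opMp R (Fin hp) n) :
  pencutmap x al <-> selfadj al /\ forall i (z : ell2 R ('I_s * ('I_p * idx n))%type),
    Re (pform (A i) (B i) (x (jj i)) (fun s1 p1 => rowop R _ p1 (rowop R _ s1 z)))
    <= \sum_s1 rq al (rowop R _ s1 z).
Proof.
split=> [h|[sal h] i _].
  (* Self-adjointness is part of each cut, so it is read off cut [0]; this is where [0 < q]
     enters. *)
  have sal : selfadj al by have [] := h (Ordinal hq) I.
  split=> // i z; have [_] := h i I.
  rewrite oplePf; last 2 first.
  - exact: selfadj_evalpen.
  - exact: selfadj_ampl.
  by move=> /(_ z); rewrite /rq ip_evalpen -[Re (ip (ampl _ _ _) _)]/(rq _ _) rq_ampl.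
split=> //; rewrite oplePf; last 2 first.
- exact: selfadj_evalpen.
- exact: selfadj_ampl.
by move=> z; rewrite rq_ampl /rq ip_evalpen; exact: h.
Qed.

Definition trunccut (lam : R) : mvfun R k (Fin hp) := fun n x al =>
  selfadj al /\ exists al', [/\ sabound lam al', pencutmap x al' & ople al' al].

Lemma pencut_up n (x : tuples R k n) (al be : opMp R (Fin hp) n) :
  pencutmap x al -> selfadj be -> ople al be -> pencutmap x be.
Proof.
move=> /pencutP[sal h] sbe; rewrite oplePf// => ab; apply/pencutP; split=> // i z.
by apply: le_trans (h i z) _; apply: ler_sum => s1 _; exact: ab.
Qed.

Lemma trunccut_sub lam n (x : tuples R k n) : trunccut lam x `<=` pencutmap x.
Proof. by move=> al [sal [al' [_ h1 h2]]]; exact: pencut_up h2. Qed.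

Lemma ople_refl (I : choiceType) (T : bop R I I) : ople T T.
Proof. by move=> u; rewrite subrr -[inner _ _]/(ip _ _) bop0E ip0l. Qed.

Lemma ople_trans (I : choiceType) (S T U : bop R I I) : selfadj S -> selfadj T ->
  selfadj U -> ople S T -> ople T U -> ople S U.
Proof.
move=> sS sT sU /(oplePf sS sT) h1 /(oplePf sT sU) h2; apply/(oplePf sS sU) => u.
exact: le_trans (h1 u) (h2 u).
Qed.

Lemma selfadj_sabound (I : choiceType) (T : bop R I I) : selfadj T ->
  exists lam0 : R, forall lam, lam0 <= lam -> sabound lam T.
Proof.
move=> sT; have [M M0 TM] := bop_bd T; exists (1 + M) => lam hl; split=> // u.
have h : normsq (ip (T u) u) <= M * sq u ^+ 2.
  by apply: le_trans (normsq_ip_le _ _) _; rewrite expr2 mulrA ler_wpM2r ?sq_ge0.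
have h2 := normsq_Re (ip (T u) u); have u0 := sq_ge0 u.
have : `|rq T u| <= (1 + M) * sq u.
  rewrite -(@ler_pXn2r _ 2)// ?nnegrE ?mulr_ge0 ?addr_ge0// real_normK ?num_real//.
  apply: le_trans h2 _; apply: le_trans h _; rewrite exprMn ler_wpM2r ?sqr_ge0//; nra.
by move=> h3; apply: le_trans h3 _; rewrite ler_wpM2r.
Qed.

(** The truncations exhaust the cut map, so a statement about a single element of the cut map can be
    proved in a truncation with large [lam]. *)
Lemma pencut_trunc n (x : tuples R k n) (al : opMp R (Fin hp) n) :
  pencutmap x al -> exists lam0 : R, forall lam, lam0 <= lam -> trunccut lam x al.
Proof.
move=> h; have [sal _] := (pencutP x al).1 h.
have [l0 hl] := selfadj_sabound sal; exists l0 => lam ll; split=> //.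
by exists al; split; [exact: hl| |exact: ople_refl].
Qed.

Lemma trunccut_nonempty (r : R) : 0 < r -> exists2 lam0 : R, 0 < lam0 &
  forall lam, lam0 <= lam -> forall n (x : tuples R k n), ncball r x ->
    trunccut lam x (lam%:C%C *: idop R _).
Proof.
move=> r0; have /choice[L hL] i := pform_bound (A i) (B i) r0.
(* The sum dominates every [L i]; the summand [1] makes the bound strictly positive. *)
exists (1 + \sum_i L i).
  by rewrite ltr_pwDl// sumr_ge0// => i _; case: (hL i).
move=> lam hl n x xr.
have lam0 : 0 <= lam.
  by apply: le_trans hl; rewrite addr_ge0// sumr_ge0// => i _; case: (hL i).
have rqE (I : choiceType) (u : ell2 R I) : rq (lam%:C%C *: idop R I) u = lam * sq u.
  by rewrite /rq bopZE ipZl complexReZ -sqRe.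
have sl : selfadj (lam%:C%C *: idop R (idx (Fin hp) * idx n)%type).
  by rewrite /selfadj adj_scale adj_id conjc_real.
split=> //; exists (lam%:C%C *: idop R _); split; last exact: ople_refl.
  by split=> // u; rewrite rqE ger0_norm ?mulr_ge0 ?sq_ge0.
apply/pencutP; split=> // i z.
have [Li0 Lip] := hL i.
apply: le_trans (Lip _ _ _ _) _.
  by move=> u; exact: ncball_sq.
rewrite mulr_sumr; apply: ler_sum => s1 _; rewrite rqE sq_prod.
rewrite ler_wpM2r ?sumr_ge0// => [? _|]; first exact: sq_ge0.
apply: le_trans hl; rewrite ler_wpDl//.
by apply: (@ler_term _ _ L) => j; case: (hL j).
Qed.

(** Minorants [T' i] of the [T i] with [|T' i| <= lam] are chosen. The finite sums [P D] of their
    conjugates are again bounded by [lam], since the [V i] form a column contraction. They are not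
    assumed to converge; any ultralimit [S'] of them lies below [S] and satisfies the cuts. *)
Lemma trunccut_convex (lam r : R) : 0 <= lam -> mv_convex r (trunccut lam).
Proof.
move=> lam0 N n d x T al y S hg _ s1 sx sT.
have isoA (D : {fset idx N}) u := sum_sq_isom s1 D u.
have xw i j u v : ip ((adj (al i) *o x i j *o al i) u) v = ip (x i j (al i u)) (al i v).
  by rewrite -[ip _ v]/(ip (adj (al i) (x i j (al i u))) v) -adjPr.
split=> /=.
  apply/ncballP => u v.
  have hl : tendsto (@totally (idx N)) (fun D : {fset idx N} => \sum_j
      \sum_(i <- D) ip ((adj (al i) *o x i j *o al i) (v j)) u) (\sum_j ip (y j (v j)) u).
    by apply: tendsto_sum => j; exact: opsum_weak.
  have hc : tendsto (@totally (idx N)) (fun=> ((r ^+ 2 * sq u + \sum_j sq (v j)) / 2)%:C%C)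
     ((r ^+ 2 * sq u + \sum_j sq (v j)) / 2)%:C%C by exact: tendsto_cst.
  have : Re (\sum_j ip (y j (v j)) u) <= (r ^+ 2 * sq u + \sum_j sq (v j)) / 2.
    apply: (tendsto_le hl hc); apply: (@filterS _ _ _ setT) => [D _|]; last exact: filterT.
    rewrite exchange_big complexRe_sum [leRHS]/= ler_pdivlMr// mulrC mulr_sumr.
    apply: (@le_trans _ _ (\sum_(i <- D) (r ^+ 2 * sq (al i u) + \sum_j sq (al i (v j))))).
      apply: ler_sum => i _; have [/ncballP/(_ (al i u) (fun j => al i (v j))) h _] := hg i.
      apply: le_trans _ h; rewrite complexRe_sum.
      by under eq_bigr do rewrite xw.
    rewrite big_split /= -mulr_sumr; apply: lerD; first by rewrite ler_wpM2l ?sqr_ge0 ?isoA.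
    by rewrite exchange_big; apply: ler_sum => j _; exact: isoA.
  by rewrite complexRe_sum; lra.
have hT i : exists al', [/\ sabound lam al', pencutmap (x i) al' & ople al' (T i)].
  by have [_ [_]] := hg i.
pose T' i := projT1 (cid (hT i)).
have hT' i : [/\ sabound lam (T' i), pencutmap (x i) (T' i) & ople (T' i) (T i)].
  exact: projT2 (cid (hT i)).
have sTi i : selfadj (T i) by have [_ []] := hg i.
pose V i : bop R (idx (Fin hp) * idx n)%type (idx (Fin hp) * idx (d i))%type :=
  ampl (idx (Fin hp)) (al i).
have VE i : ampl (idx (Fin hp)) (adj (al i)) = adj (V i) by rewrite adj_ampl.
have isoV (D : {fset idx N}) u : \sum_(i <- D) sq (V i u) <= sq u.
  rewrite sq_prod; under eq_bigr do rewrite sq_ampl.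
  by rewrite exchange_big; apply: ler_sum => j _; exact: isoA.
pose P (D : {fset idx N}) := \sum_(i <- D) adj (V i) *o T' i *o V i.
have rqP D u : rq (P D) u = \sum_(i <- D) rq (T' i) (V i u).
  by rewrite /P rq_sum; apply: eq_bigr => i _; rewrite rq_conj.
have PB D : sabound lam (P D).
  split; first by apply: selfadj_sum => i; apply: selfadj_conj; case: (hT' i) => -[].
  move=> u; rewrite rqP; apply: le_trans (ler_norm_sum _ _ _) _.
  apply: (@le_trans _ _ (\sum_(i <- D) lam * sq (V i u))).
    by apply: ler_sum => i _; case: (hT' i) => -[_ h] _ _; exact: h.
  by rewrite -mulr_sumr ler_wpM2l.
(* An ultrafilter finer than [totally] keeps the given limits of [opsum] while forcing one for
   [P]. *)
have [U [UU totU]] := ultraFilterLemma (@totally_filter (idx N)).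
have [S' S'B S'l] := sabound_ulim UU lam0 PB.
have sS : selfadj S.
  apply: (selfadj_lim (bop_weak_cvg sT)).
  apply: (@filterS _ _ _ setT) => [D _|]; last exact: filterT.
  by rewrite psumE; apply: selfadj_sum => i; rewrite VE; exact: selfadj_conj.
split=> //; exists S'; split=> //; last first.
  have [sS' _] := S'B; apply/(oplePf sS' sS) => u.
  have hS := tendsto_sub totU (opsum_weak sT u u).
  apply: (tendsto_le (S'l u u) hS); apply: (@filterS _ _ _ setT) => [D _|]; last exact: filterT.
  rewrite -[leLHS]/(rq (P D) u) rqP complexRe_sum; apply: ler_sum => i _.
  rewrite VE -[leRHS]/(rq (adj (V i) *o T i *o V i) u) rq_conj.
  have [[sT'i _] _] := hT' i; rewrite (oplePf sT'i (sTi i)); exact.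
apply/pencutP; split=> [|i z]; first by case: S'B.
pose xi s1 p1 := rowop R (idx n) p1 (rowop R ('I_p * idx n)%type (s1 : 'I_s) z).
have w1 u v : tendsto U (fun D : {fset idx N} => \sum_(t <- D) ip (al t u) (al t v)) (ip u v).
  have := tendsto_sub totU (opsum_weak s1 u v).
  rewrite (_ : (fun D => _) = fun D : {fset idx N} => \sum_(t <- D) ip (al t u) (al t v))//.
  apply/funext => D; apply: eq_bigr => t _.
  by rewrite -[ip _ v]/(ip (adj (al t) (al t u)) v) -adjPr.
have w2 u v : tendsto U (fun D : {fset idx N} =>
    \sum_(t <- D) ip (x t (jj i) (al t u)) (al t v)) (ip (y (jj i) u) v).
  have := tendsto_sub totU (opsum_weak (sx (jj i)) u v).
  rewrite (_ : (fun D => _) = fun D : {fset idx N} =>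
    \sum_(t <- D) ip (x t (jj i) (al t u)) (al t v))//.
  by apply/funext => D; apply: eq_bigr => t _; rewrite xw.
have hl : tendsto U (fun D : {fset idx N} => \sum_(t <- D)
    pform (A i) (B i) (x t (jj i)) (fun s1 p1 => al t (xi s1 p1)))
    (pform (A i) (B i) (y (jj i)) xi).
  rewrite (_ : (fun D => _) = fun D : {fset idx N} => pformW (A i) (B i)
     (fun s1 s2 p1 p2 => \sum_(t <- D) ip (al t (xi s2 p2)) (al t (xi s1 p1)))
     (fun s1 s2 p1 p2 => \sum_(t <- D) ip (x t (jj i) (al t (xi s2 p2))) (al t (xi s1 p1)))).
    by apply: pformW_cvg => *; [exact: w1|exact: w2].
  by apply/funext => D; rewrite -pformW_sum.
have hr : tendsto U (fun D : {fset idx N} => \sum_s1 ip (P D (rowop R _ s1 z)) (rowop R _ s1 z))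
    (\sum_s1 ip (S' (rowop R _ s1 z)) (rowop R _ s1 z)).
  by apply: tendsto_sum => s2; exact: S'l.
rewrite -complexRe_sum; apply: (tendsto_le hl hr).
apply: (@filterS _ _ _ setT) => [D _|]; last exact: filterT.
rewrite !complexRe_sum.
under [leRHS]eq_bigr => s2 _ do rewrite -[Re _]/(rq (P D) _) rqP.
rewrite exchange_big; apply: ler_sum => t _.
have [_ /pencutP[_ /(_ i (ampl 'I_s (V t) z)) H] _] := hT' t.
have E : (fun s1 p1 => rowop R (idx (d t)) p1 (rowop R _ s1 (ampl 'I_s (V t) z))) =
    fun s1 p1 => al t (xi s1 p1).
  by apply/funext => s2; apply/funext => p1; rewrite !row_ampl.
rewrite E in H; apply: le_trans H _; apply: ler_sum => s2 _.
by rewrite row_ampl.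
Qed.

End Truncation.

(** * Truncated cut maps as nc majorization functions *)

Section Majorization.
Variable R : realType.
Notation C := R[i].
Local Notation Re := complex.Re.
Variables (k : nat).

Lemma mv_convex_fin (p n m : ncdim) (r : R) (F : mvfun R k p) (x : tuples R k n) T l
    (al : 'I_l.+1 -> opM R n m) :
  mv_convex r F -> ncball r x -> F n x T ->
  \sum_i adj (al i) *o al i = idop R (idx m) ->
  graph r F ((fun j => \sum_i adj (al i) *o x j *o al i : opM R m m) : tuples R k m,
    \sum_i ampl (idx p) (adj (al i)) *o T *o ampl (idx p) (al i)).
Proof.
move=> cF xr FT s1.
apply: (cF (Fin (ltn0Sn l)) m (fun=> n) (fun=> x) (fun=> T) al) => //.
- exists (\sum_j opnorm (x j) + opnorm T) => _; split=> [j|].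
    rewrite ler_wpDr ?opnorm_ge0//.
    by apply: (@ler_term _ _ (fun j => opnorm (x j))) => ?; exact: opnorm_ge0.
  by rewrite ler_wpDl// sumr_ge0// => ? _; exact: opnorm_ge0.
- by rewrite -s1; exact: opsum_fin.
- by move=> j; exact: opsum_fin.
- exact: opsum_fin.
Qed.

Lemma mv_convex_conj (p n m : ncdim) (r : R) (F : mvfun R k p) (x : tuples R k n) T
    (V : opM R n m) : mv_convex r F -> ncball r x -> F n x T ->
  adj V *o V = idop R (idx m) ->
  graph r F (conjt V x, ampl (idx p) (adj V) *o T *o ampl (idx p) V).
Proof.
move=> cF xr FT VV.
have V1 : \sum_(i < 1) adj V *o V = idop R (idx m) by rewrite big_ord1.
have := @mv_convex_fin p n m r F x T 0 (fun=> V) cF xr FT V1.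
set y := fun j => _; set S := \sum_i _.
have -> : y = conjt V x by apply/funext => j; rewrite /y big_ord1.
by have -> : S = ampl (idx p) (adj V) *o T *o ampl (idx p) V by rewrite /S big_ord1.
Qed.

Lemma conjt_unitary (n : ncdim) (V : opM R n n) (x : tuples R k n) : unitary_op V ->
  conjt V (conjt (adj V) x) = x.
Proof.
move=> [VV _]; apply/funext => j; apply: bopP => u.
rewrite -[LHS]/(adj V (adj (adj V) (x j (adj V (V u))))) adjK.
rewrite -[adj V (V u)]/((adj V *o V) u) VV.
by rewrite -[LHS]/((adj V *o V) (x j u)) VV.
Qed.

Lemma unitary_adj (n : ncdim) (V : opM R n n) : unitary_op V -> unitary_op (adj V).
Proof. by move=> [h1 h2]; split; rewrite adjK. Qed.

(** Both set equalities in [mv_nc] reduce to one inclusion: conjugation by [V] is undone by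
    conjugation by [adj V], and adding [0] is always allowed. *)
Lemma mv_ncP (p : ncdim) (r : R) (F : mvfun R k p) :
  (forall n (x : tuples R k n), ncball r x -> F n x !=set0) ->
  (forall n (x : tuples R k n), ncball r x -> F n x `<=` @selfadj R _) ->
  (forall n (x : tuples R k n) T S, ncball r x -> F n x T -> selfadj S -> ople T S ->
     F n x S) ->
  (forall n (x : tuples R k n) T (V : opM R n n), ncball r x -> F n x T -> unitary_op V ->
     graph r F (conjt V x, ampl (idx p) (adj V) *o T *o ampl (idx p) V)) ->
  mv_nc r F.
Proof.
move=> F0 Fs Fu Fc n x xr; split=> //; [exact: F0|exact: Fs| |].
- move=> V uV; apply/seteqP; split=> [T FT|_ [T FT <-]]; last first.
    by have [] := Fc _ _ _ _ xr FT uV.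
  have uV' := unitary_adj uV.
  (* A point of [F x] is needed here only because membership of [conjt V x] in the ball is obtained
     through the graph. *)
  have [T0 FT0] := F0 _ _ xr; have [xr' _] := Fc _ _ _ _ xr FT0 uV.
  have [_ /= h] := Fc _ _ _ _ xr' FT uV'; move: h.
  have := conjt_unitary x uV'; rewrite adjK => -> h.
  exists (ampl (idx p) V *o T *o ampl (idx p) (adj V)) => //.
  have [VV _] := uV; apply: bopP => u.
  have VA w : ampl (idx p) (adj V) (ampl (idx p) V w) = w.
    by rewrite -[LHS]/((ampl (idx p) (adj V) *o ampl (idx p) V) w) -ampl_comp VV ampl_id.
  rewrite -[LHS]/(ampl (idx p) (adj V)
    (ampl (idx p) V (T (ampl (idx p) (adj V) (ampl (idx p) V u))))).
  by rewrite !VA.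
- apply/seteqP; split=> [T FT|_ [T FT] [P P0 <-]].
    exists T => //; exists 0; last by rewrite addr0.
    by move=> u; rewrite -[inner _ _]/(ip _ _) bop0E ip0l.
  apply: (Fu _ _ T _ xr FT); last by move=> u; rewrite addrC addKr; exact: P0.
  by rewrite /selfadj adjD (Fs _ _ xr _ FT) (oppos_selfadj P0).
Qed.

Section Pencut.
Variables (s p q : nat) (hp : (0 < p)%N) (hq : (0 < q)%N).
Variable jj : 'I_q -> 'I_k.
Variables A B : 'I_q -> 'I_s -> 'I_s -> 'I_p -> 'I_p -> C.
Hypothesis hA : forall i s1 s2 p1 p2, A i s1 s2 p1 p2 = conjc (A i s2 s1 p2 p1).
Hypothesis hB : forall i s1 s2 p1 p2, B i s1 s2 p1 p2 = conjc (B i s2 s1 p2 p1).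

Local Notation tc := (@trunccut _ _ _ _ _ hp jj A B).
Local Notation pc := (@pencutmap _ _ _ _ _ hp jj A B).

Lemma trunccut_up lam n (x : tuples R k n) T S :
  tc lam x T -> selfadj S -> ople T S -> tc lam x S.
Proof.
move=> [sT [T' [T'B T'x T'T]]] sS TS.
split; first exact: sS.
exists T'; split; [exact: T'B|exact: T'x|].
have sT' := T'B.1.
exact: (ople_trans sT' sT sS T'T TS).
Qed.

Lemma trunccut_bounded lam r : 0 < lam -> mv_bounded r (tc lam).
Proof.
move=> lam0; exists lam => // n x _ T [sT [T' [T'B T'x T'T]]].
have lam0' := ltW lam0.
exists T'; split; [|exact: T'T|].
  split; first exact: T'B.1.
  exists T'; split; [exact: T'B|exact: T'x|exact: ople_refl].
apply: (opnorm_le lam0') => u; exact: sabound_sq lam0' T'B.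
Qed.

(** Along a net in the graph the dominated elements need not be bounded, but their minorants are, by
    [lam]; an ultralimit of the minorants witnesses that the limit point belongs to the graph. *)
Lemma trunccut_lsc lam r : 0 <= lam -> mv_lsc r (tc lam).
Proof.
move=> lam0 n z; rewrite closureEcvg => -[G GG [Gz Gg]].
have [U [UU GU]] := ultraFilterLemma GG.
have UFz : (@id (tuples R k n * opMp R (Fin hp) n)) @ U --> z.
  by move=> V /Gz /GU.
have gU : U (graph r (tc lam) (n:=n)) by apply: GU; exact: Gg.
have UF : Filter U by case: UU => -[].
have c1 j u v : tendsto U (fun w => ip (w.1 j u) v) (ip (z.1 j u) v).
  have h1 : (fun w : tuples R k n * opMp R (Fin hp) n => w.1) @ U --> z.1.
    exact: (cvg_comp _ _ UFz cvg_fst).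
  have h2 : (fun w : tuples R k n * opMp R (Fin hp) n => w.1 j) @ U --> z.1 j.
    exact: (cvg_comp _ _ h1 (@proj_continuous 'I_k (fun=> opM R n n) j z.1)).
  exact: (bop_weak_cvg h2).
have c2 u v : tendsto U (fun w => ip (w.2 u) v) (ip (z.2 u) v).
  have h1 : (fun w : tuples R k n * opMp R (Fin hp) n => w.2) @ U --> z.2.
    exact: (cvg_comp _ _ UFz cvg_snd).
  exact: (bop_weak_cvg h1).
have /choice[T' hT'] (w : tuples R k n * opMp R (Fin hp) n) : exists al',
    sabound lam al' /\ (graph r (tc lam) w -> pc w.1 al' /\ ople al' w.2).
  have [[wr [_ [al' [h1 h2 h3]]]]|nw] := pselect (graph r (tc lam) w).
    by exists al'.
  (* Outside the graph [0] serves as a default, so that the bound holds for every [w]; the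
     ultrafilter contains the graph and ignores these values. *)
  exists 0; split=> //; split=> [|u]; first exact: adj0.
  by rewrite /rq bop0E ip0l normr0 mulr_ge0 ?sq_ge0.
have [S SB Sl] := sabound_ulim UU lam0 (fun w => (hT' w).1).
have sz : selfadj z.2.
  by apply: (selfadj_lim c2); apply: filterS gU => w [_ []].
split.
  apply/ncballP => u v.
  have hl : tendsto U (fun w => \sum_j ip (w.1 j (v j)) u) (\sum_j ip (z.1 j (v j)) u).
    by apply: tendsto_sum.
  have hc : tendsto U (fun=> ((r ^+ 2 * sq u + \sum_j sq (v j)) / 2)%:C%C)
     ((r ^+ 2 * sq u + \sum_j sq (v j)) / 2)%:C%C by exact: tendsto_cst.
  have : Re (\sum_j ip (z.1 j (v j)) u) <= (r ^+ 2 * sq u + \sum_j sq (v j)) / 2.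
    apply: (tendsto_le hl hc); apply: filterS gU => w [/ncballP/(_ u v) h _].
    by rewrite complexRe_sum [leRHS]/= ler_pdivlMr// mulrC.
  by rewrite complexRe_sum; lra.
split=> //; exists S; split=> //; last first.
  apply/(oplePf SB.1 sz) => u; apply: (tendsto_le (Sl u u) (c2 u u)).
  apply: filterS gU => w wg; have [_ h] := (hT' w).2 wg.
  move: h; rewrite oplePf; [exact|exact: (hT' w).1.1|].
  by case: wg => _ [].
apply: (pencutP hq jj hA hB z.1 S).2; split=> [|i y]; first exact: SB.1.
have hl : tendsto U (fun w => pform (A i) (B i) (w.1 (jj i))
      (fun s1 p1 => rowop R (idx n) p1 (rowop R ('I_p * idx n)%type s1 y)))
    (pform (A i) (B i) (z.1 (jj i))
      (fun s1 p1 => rowop R (idx n) p1 (rowop R ('I_p * idx n)%type s1 y))).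
  by apply: pformW_cvg => *; [exact: tendsto_cst|exact: c1].
have hr : tendsto U (fun w => \sum_s1 ip (T' w (rowop R _ s1 y)) (rowop R _ s1 y))
    (\sum_s1 ip (S (rowop R _ s1 y)) (rowop R _ s1 y)).
  by apply: tendsto_sum => s2; exact: Sl.
rewrite -complexRe_sum; apply: (tendsto_le hl hr).
apply: filterS gU => w wg; have [/(pencutP hq jj hA hB _ _)[_ h] _] := (hT' w).2 wg.
by rewrite [leRHS]complexRe_sum; exact: h.
Qed.

Lemma trunccut_majorization (r : R) : 0 < r -> exists2 lam0 : R, 0 < lam0 &
  forall lam, lam0 <= lam -> nc_majorization r (tc lam).
Proof.
move=> r0; have [lam0 l0 ne] := trunccut_nonempty hp hq jj hA hB r0.
exists lam0 => // lam ll; have lp : 0 < lam by apply: lt_le_trans ll.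
have lp' := ltW lp.
have cv : mv_convex r (tc lam) by exact: trunccut_convex.
split=> //; [|exact: trunccut_bounded|exact: trunccut_lsc].
apply: mv_ncP.
- by move=> n x xr; eexists; exact: ne xr.
- by move=> n x _ T [].
- by move=> n x T S _; exact: trunccut_up.
- by move=> n x T V xr FT [VV _]; exact: mv_convex_conj.
Qed.

(** Covariance is borrowed from a truncation containing the given element: a truncation is convex,
    hence stable under compression by isometries. *)
Lemma pencutmap_nc (r : R) : 0 < r -> mv_nc r pc.
Proof.
move=> r0; have [lam0 l0 ne] := trunccut_nonempty hp hq jj hA hB r0.
apply: mv_ncP.
- move=> n x xr; eexists; apply: (trunccut_sub hq hA hB); exact: (ne _ (lexx _) _ _ xr).
- by move=> n x _ T /(pencutP hq jj hA hB _ _)[].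
- by move=> n x T S _ h sS; exact: (pencut_up hq hA hB h sS).
- move=> n x T V xr /(pencut_trunc hq hA hB)[l1 h1] [VV _].
  have [lam [h2 h3]] : exists lam : R, l1 <= lam /\ 0 <= lam.
    exists (`|l1|); split; [exact: ler_norm|exact: normr_ge0].
  have cv : mv_convex r (tc lam) by exact: trunccut_convex.
  have [yr yF] := mv_convex_conj cv xr (h1 _ h2) VV.
  by split=> //; exact: (trunccut_sub hq hA hB yF).
Qed.

End Pencut.
End Majorization.

(** * Finite-dimensional operators *)

Section Finite.
Variable R : realType.
Notation C := R[i].
Local Notation Re := complex.Re.

Lemma rank1_proof (I J : choiceType) (u : ell2 R J) (v : ell2 R I) :
  bop_pred (fun x : ell2 R I => ip x v *: u).
Proof.
apply/asboolP; split=> [a x y|]; first by rewrite ipDl ipZl scalerDl scalerA.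
apply/bounded_mapP; exists (sq v * sq u) => [|x]; first by rewrite mulr_ge0 ?sq_ge0.
rewrite -!sqE -EFinM lee_fin sqZ mulrAC ler_wpM2r ?sq_ge0// mulrC.
exact: normsq_ip_le.
Qed.
Definition rank1 (I J : choiceType) (u : ell2 R J) (v : ell2 R I) : bop R I J :=
  Bop (rank1_proof u v).

Lemma rank1E (I J : choiceType) (u : ell2 R J) (v x : ell2 R I) :
  rank1 u v x = ip x v *: u.
Proof. by []. Qed.

Lemma adj_rank1 (I J : choiceType) (u : ell2 R J) (v : ell2 R I) :
  adj (rank1 u v) = rank1 v u.
Proof.
apply: adj_uniq => x y.
by rewrite !rank1E ipZl ipZr (ipC u) mulrC.
Qed.

Lemma rq_rank1 (I : choiceType) (v x : ell2 R I) : rq (rank1 v v) x = normsq (ip x v).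
Proof. by rewrite /rq rank1E ipZl (ipC v) -normsqE. Qed.

Lemma rank1_sandwich (I J K L : choiceType) (a : ell2 R L) (b : ell2 R K)
    (Y : bop R J K) (c : ell2 R J) (d : ell2 R I) :
  rank1 a b *o Y *o rank1 c d = ip (Y c) b *: rank1 a d.
Proof.
apply: bopP => x.
rewrite -[LHS]/(ip (Y (ip x d *: c)) b *: a) linearZ ipZl.
by rewrite bopZE rank1E scalerA mulrC.
Qed.

Lemma selfadj_rq0 (I : choiceType) (X : bop R I I) :
  selfadj X -> (forall u, rq X u = 0) -> X = 0.
Proof.
move=> sX X0; apply: bopP => u; apply: sq_eq0; apply/eqP.
rewrite eq_le sq_ge0 andbT.
have := @sabound_sq R I 0 X u (lexx _); rewrite expr0n mul0r; apply.
by split=> // v; rewrite X0 normr0 mul0r.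
Qed.

Lemma selfadjB (I : choiceType) (S T : bop R I I) :
  selfadj S -> selfadj T -> selfadj (S - T).
Proof. by move=> sS sT; rewrite /selfadj adjD adjN sS sT. Qed.

Lemma rqB (I : choiceType) (S T : bop R I I) u : rq (S - T) u = rq S u - rq T u.
Proof. by rewrite /rq bopDE bopNE ipBl raddfB. Qed.

Lemma rqZ (I : choiceType) (a : R) (T : bop R I I) u : rq (a%:C%C *: T) u = a * rq T u.
Proof. by rewrite /rq bopZE ipZl complexReZ. Qed.

Lemma selfadj_rq_eq (I : choiceType) (S T : bop R I I) :
  selfadj S -> selfadj T -> (forall u, rq S u = rq T u) -> S = T.
Proof.
move=> sS sT ST; apply/eqP; rewrite -subr_eq0; apply/eqP.
by apply: selfadj_rq0 => [|u]; [exact: selfadjB|rewrite rqB ST subrr].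
Qed.

Lemma psd_CS (I : choiceType) (S : bop R I I) u w : oppos S ->
  normsq (ip (S u) w) <= rq S u * rq S w.
Proof.
move=> /opposP[sS S0].
have ex (a b : R) : 0 <= a ^+ 2 * rq S u - 2 * (a * b * normsq (ip (S u) w))
    + b ^+ 2 * normsq (ip (S u) w) * rq S w.
  have := S0 (a%:C%C *: u - (b%:C%C * ip (S u) w) *: w); rewrite /rq.
  have -> (c e : C) : S (c *: u - e *: w) = c *: S u - e *: S w.
    by rewrite linearB !linearZ.
  rewrite ipBl !ipBr !ipZl !ipZr conjCM.
  have -> : ip (S w) u = conjc (ip (S u) w) by rewrite -ipC adjP sS.
  have := selfadj_Im u sS; have := selfadj_Im w sS; rewrite /normsq.
  case: (ip (S u) w) (ip (S u) u) (ip (S w) w) => [x y] [p p'] [r r'] /= -> ->.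
  by move=> h; apply: le_trans h _; rewrite le_eqVlt; apply/orP; left; apply/eqP; ring.
have := S0 w; rewrite le_eqVlt => /orP[/eqP w0|wp].
  rewrite -w0 mulr0 leNgt; apply/negP => X0.
  (* If [<S w, w> = 0], the quadratic expression is affine in [b]; this [b] makes it equal to
     [- rq S u - 2], which is negative. *)
  have := ex 1 ((rq S u + 1) / normsq (ip (S u) w)).
  rewrite -w0 mulr0 addr0 expr1n !mul1r divfK ?gt_eqF//.
  have := S0 u; lra.
have := ex (rq S w) 1; rewrite expr1n mul1r mulr1 => h.
rewrite -(ler_pM2l wp); lra.
Qed.

Lemma psd_rq0 (I : choiceType) (S : bop R I I) u : oppos S -> rq S u = 0 -> S u = 0.
Proof.
move=> S0 u0; apply: sq_eq0; apply/eqP; rewrite eq_le sq_ge0 andbT.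
have := psd_CS u (S u) S0; rewrite u0 mul0r ipxx.
rewrite /normsq /= expr0n addr0 => h.
have : sq (S u) ^+ 2 <= 0 ^+ 2 by rewrite expr0n.
by rewrite ler_pXn2r ?nnegrE ?sq_ge0.
Qed.

(* Cholesky: subtracting [S e_x (S e_x)^* / <S e_x, e_x>] kills a diagonal entry. *)
Lemma psd_decomp (I : finType) (S : bop R I I) : oppos S ->
  exists r : seq (ell2 R I), S = \sum_(v <- r) rank1 v v.
Proof.
(* Induction on the number of nonzero diagonal entries: by [0 <= rq S' <= rq S], subtraction creates
   no new one and removes the one at [x]. *)
have [n] := ubnP #|[set x | rq S (delta R x) != 0]|%SET.
elim: n S => // n IH S; rewrite ltnS => leSn S0.
have [/eqP|] := posnP #|[set x | rq S (delta R x) != 0]|%SET.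
  rewrite cards_eq0 => /eqP e0; exists [::]; rewrite big_nil.
  apply: bop_deltaP => x y; have : x \notin [set x | rq S (delta R x) != 0]%SET.
    by rewrite e0 inE.
  by rewrite inE negbK => /eqP/(psd_rq0 S0) ->.
case/card_gt0P => x; rewrite inE => dn.
set d := rq S (delta R x) in dn.
have [sS rS] := (opposP S).1 S0.
have dp : 0 < d by rewrite lt_neqAle eq_sym dn rS.
set v := ((Num.sqrt d)^-1)%:C%C *: S (delta R x).
have rv u : normsq (ip u v) = normsq (ip (S u) (delta R x)) / d.
  rewrite /v ipZr normsqM mulrC adjP sS; congr (_ * _).
  by rewrite /normsq /= oppr0 expr0n addr0 exprVn sqr_sqrtr// ltW.
set S' := S - rank1 v v.
have rS' u : rq S' u = rq S u - normsq (ip (S u) (delta R x)) / d.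
  by rewrite rqB rq_rank1 rv.
have S'0 : oppos S'.
  apply/opposP; split; first by apply: selfadjB => //; exact: adj_rank1.
  by move=> u; rewrite rS' subr_ge0 ler_pdivrMr//; exact: psd_CS.
have rS'x : rq S' (delta R x) = 0.
  rewrite rS'; have := selfadj_Im (delta R x) sS.
  have : Re (ip (S (delta R x)) (delta R x)) = d by [].
  case: (ip _ _) => p p' /= -> ->; rewrite /normsq /= expr0n addr0 -/d.
  by field.
have sub : [set x | rq S' (delta R x) != 0]%SET \proper [set x | rq S (delta R x) != 0]%SET.
  apply/properP; split; last by exists x; rewrite !inE ?rS'x ?eqxx.
  apply/fintype.subsetP => y; rewrite !inE; apply: contraNneq => y0.
  have := (opposP S').1 S'0 => -[_ /(_ (delta R y))]; rewrite rS' y0 sub0r oppr_ge0 => h.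
  have h' : 0 <= normsq (ip (S (delta R y)) (delta R x)) / d.
    by rewrite divr_ge0 ?normsq_ge0// ltW.
  by rewrite oppr_eq0 eq_le h h'.
have [r hr] := IH S' (leq_trans (proper_card sub) leSn) S'0.
by exists (v :: r); rewrite big_cons -hr /S' addrCA subrr addr0.
Qed.

Definition mtrace (I : finType) (S : bop R I I) : R := \sum_x rq S (delta R x).

Lemma delta_expand (I : finType) (u : ell2 R I) : u = \sum_x (u x : C) *: delta R x.
Proof.
apply: ell2P => y; rewrite ell2_sum (@big_delta _ _ y) => [|x xy].
  by rewrite ell2Z deltaE eqxx mulr1.
by rewrite ell2Z deltaE eq_sym (negPf xy) mulr0.
Qed.

Lemma bop_expand (I J : finType) (X : bop R I J) :
  X = \sum_x \sum_y (X (delta R y) x : C) *: rank1 (delta R x) (delta R y).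
Proof.
apply: bopP => u; rewrite [u in LHS]delta_expand linear_sum bop_sumE.
under [RHS]eq_bigr do rewrite bop_sumE.
rewrite exchange_big; apply: eq_bigr => y _.
rewrite linearZ.
transitivity ((u y : C) *: \sum_x (X (delta R y) x : C) *: delta R x).
  by rewrite -delta_expand.
rewrite scaler_sumr.
by apply: eq_bigr => x _; rewrite bopZE rank1E ip_delta scalerA scalerA mulrC.
Qed.

(** With [S = sum_v v v^*] the trace is [sum_v |v|^2], while [<S u, u>] is [sum_v |<u, v>|^2].
    Bounded traces thus provide the uniform bound required for an ultralimit. *)
Lemma psd_trace_bound (I : finType) (S : bop R I I) : oppos S -> sabound (mtrace S) S.
Proof.
move=> S0; have [sS rS] := (opposP S).1 S0; split=> // u.
rewrite ger0_norm//; have [r hr] := psd_decomp S0.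
have sv (v : ell2 R I) : sq v = \sum_x rq (rank1 v v) (delta R x).
  rewrite sq_fin; apply: eq_bigr => x _; rewrite rq_rank1 ipC ip_delta.
  by case: (v x) => a b; rewrite /normsq /= sqrrN.
have -> : mtrace S = \sum_(v <- r) sq v.
  rewrite /mtrace [in LHS]hr; under eq_bigr do rewrite rq_sum.
  by rewrite exchange_big; apply: eq_bigr => v _.
rewrite hr rq_sum mulr_suml; apply: ler_sum => v _.
by rewrite rq_rank1 mulrC; exact: normsq_ip_le.
Qed.

Lemma psd_trace0 (I : finType) (S : bop R I I) : oppos S -> mtrace S = 0 -> S = 0.
Proof.
move=> S0 t0; have [sS hS] := psd_trace_bound S0.
apply: selfadj_rq0 => // u; apply/eqP; rewrite -normr_le0.
by have := hS u; rewrite t0 mul0r.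
Qed.

Lemma adj_block (P I : choiceType) (S : bop R (P * I)%type (P * I)%type) u v :
  adj (block S u v) = block (adj S) v u.
Proof. by rewrite /block !adj_comp adj_row adj_inj; apply: bopP. Qed.

(** * Choi matrices and Kraus operators *)

Section Choi.
Variables (P I : finType).
Implicit Types (S : bop R (P * I)%type (P * I)%type) (Y : bop R P P).

(* The value at [Y] of the linear map whose Choi matrix is [S]. *)
Definition choi S Y : bop R I I :=
  \sum_u \sum_v ip (Y (delta R v)) (delta R u) *: block S u v.

Lemma choiD S Y Z : choi S (Y + Z) = choi S Y + choi S Z.
Proof.
rewrite /choi -big_split; apply: eq_bigr => u _ /=; rewrite -big_split.
by apply: eq_bigr => v _ /=; rewrite -scalerDl -ipDl.
Qed.

Lemma choiZ S c Y : choi S (c *: Y) = c *: choi S Y.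
Proof.
rewrite /choi scaler_sumr; apply: eq_bigr => u _; rewrite scaler_sumr.
by apply: eq_bigr => v _; rewrite bopZE ipZl scalerA.
Qed.

Lemma choi1 S : choi S (idop R P) = \sum_u block S u u.
Proof.
rewrite /choi; apply: eq_bigr => u _; rewrite (@big_delta _ _ u) => [|v vu].
  by rewrite ip_delta -[idop R P (delta R u) u]/((u == u)%:R : C) eqxx scale1r.
by rewrite ip_delta -[idop R P (delta R v) u]/((u == v)%:R : C) eq_sym (negPf vu) scale0r.
Qed.

Lemma adj_choi S Y : selfadj S -> adj (choi S Y) = choi S (adj Y).
Proof.
move=> sS; rewrite /choi adj_sum exchange_big; apply: eq_bigr => u _.
rewrite adj_sum; apply: eq_bigr => v _.
rewrite adj_scale adj_block sS -ipC; congr (_ *: _).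
by rewrite adjPr.
Qed.

(** Choi's theorem: each vector [w] of a rank-one decomposition of [S] is reshaped into the operator
    [x |-> sum_u <x, w_u> e_u], where [w_u] is the row of [w] at [u]. *)
Lemma choi_psd S : oppos S -> exists al : seq (bop R I P),
  forall Y, choi S Y = \sum_(a <- al) adj a *o Y *o a.
Proof.
move=> /psd_decomp[r hr].
pose f (w : ell2 R (P * I)%type) : bop R I P := \sum_u rank1 (delta R u) (rowop R I u w).
exists (map f r) => Z; rewrite big_map /choi.
have bE u v : block S u v = \sum_(w <- r) rank1 (rowop R I u w) (rowop R I v w).
  apply: bopP => x; rewrite blockE hr [RHS]bop_sumE.
  rewrite (_ : (\sum_(v0 <- r) rank1 v0 v0) (injop R I v x) =
    \sum_(v0 <- r) rank1 v0 v0 (injop R I v x)); last exact: bop_sumE.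
  rewrite linear_sum.
  by apply: eq_bigr => w _; rewrite !rank1E linearZ adjP adj_inj.
have fE w : adj (f w) *o Z *o f w = \sum_u \sum_v
    ip (Z (delta R v)) (delta R u) *: rank1 (rowop R I u w) (rowop R I v w).
  apply: bopP => x; rewrite /f adj_sum.
  rewrite -[LHS]/((\sum_u adj (rank1 (delta R u) (rowop R I u w)))
    (Z ((\sum_u rank1 (delta R u) (rowop R I u w)) x))) !bop_sumE.
  apply: eq_bigr => u _; rewrite !linear_sum bop_sumE.
  apply: eq_bigr => v _; rewrite adj_rank1.
  by rewrite -rank1_sandwich.
rewrite (eq_bigr _ (fun w _ => fE w)) [RHS]exchange_big; apply: eq_bigr => u _.
rewrite [RHS]exchange_big; apply: eq_bigr => v _.
by rewrite bE scaler_sumr.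
Qed.

End Choi.
End Finite.

(** * The separating cuts *)

Section CutMatrix.
Variable R : realType.
Notation C := R[i].
Local Notation Re := complex.Re.
Variable (p : nat).

Definition sum4 (f : 'I_p -> 'I_p -> 'I_p -> 'I_p -> C) : C :=
  \sum_s1 \sum_s2 \sum_p1 \sum_p2 f s1 s2 p1 p2.

Lemma eq_sum4 f g : (forall s1 s2 p1 p2, f s1 s2 p1 p2 = g s1 s2 p1 p2) -> sum4 f = sum4 g.
Proof. by move=> fg; do 4!(apply: eq_bigr => ? _). Qed.

Lemma sum4D f g : sum4 (fun s1 s2 p1 p2 => f s1 s2 p1 p2 + g s1 s2 p1 p2) = sum4 f + sum4 g.
Proof.
rewrite /sum4 -big_split; apply: eq_bigr => ? _; rewrite -big_split.
apply: eq_bigr => ? _; rewrite -big_split; apply: eq_bigr => ? _.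
by rewrite -big_split.
Qed.

Lemma sum4Z c f : sum4 (fun s1 s2 p1 p2 => c * f s1 s2 p1 p2) = c * sum4 f.
Proof. by rewrite /sum4; do 4!(rewrite mulr_sumr; apply: eq_bigr => ? _). Qed.

Lemma sum4_sum (I : finType) (f : I -> 'I_p -> 'I_p -> 'I_p -> 'I_p -> C) :
  sum4 (fun s1 s2 p1 p2 => \sum_i f i s1 s2 p1 p2) = \sum_i sum4 (f i).
Proof.
rewrite /sum4; do 4!(rewrite [RHS]exchange_big; apply: eq_bigr => ? _).
by [].
Qed.

Definition comb (J : choiceType) (c : 'I_p -> 'I_p -> C) (xi : 'I_p -> 'I_p -> ell2 R J) :
  ell2 R J := \sum_s \sum_u c s u *: xi s u.

Lemma sum4_comb (J : choiceType) (c : 'I_p -> 'I_p -> C) (x : bop R J J) xi :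
  sum4 (fun s1 s2 p1 p2 => conjc (c s1 p1) * c s2 p2 * ip (x (xi s2 p2)) (xi s1 p1)) =
  ip (x (comb c xi)) (comb c xi).
Proof.
rewrite [X in ip _ X]/comb ip_sumr; apply: eq_bigr => s1 _.
rewrite exchange_big ip_sumr; apply: eq_bigr => p1 _; rewrite ipZr.
rewrite /comb linear_sum ip_suml mulr_sumr; apply: eq_bigr => s2 _.
rewrite linear_sum ip_suml mulr_sumr; apply: eq_bigr => p2 _.
by rewrite linearZ ipZl mulrA.
Qed.

Definition defect (w v : 'I_p -> 'I_p -> C) s' u' s u : C :=
  ((s == s') && (u == u'))%:R - w s' u' * v s u.

(* If [sum v w = 1] and [eta = comb v xi], the quadratic form of the pencil with
   coefficients [cutA], [cutB] at a self-adjoint [x] is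
   [(1 - t^2) |eta|^2 + 2 t <x eta, eta> - lam sum |xi - w eta|^2]: the penalty vanishes
   exactly on the families [xi = w eta]. *)
Definition cutA (w v : 'I_p -> 'I_p -> C) (t lam : R) s1 s2 p1 p2 : C :=
  (1 - t ^+ 2)%:C%C * (conjc (v s1 p1) * v s2 p2) +
  (- lam)%:C%C * \sum_k conjc (defect w v k.1 k.2 s1 p1) * defect w v k.1 k.2 s2 p2.

Definition cutB (v : 'I_p -> 'I_p -> C) (t : R) (s1 s2 p1 p2 : 'I_p) : C :=
  t%:C%C * (conjc (v s1 p1) * v s2 p2).

Lemma cutA_herm w v t lam s1 s2 p1 p2 :
  cutA w v t lam s1 s2 p1 p2 = conjc (cutA w v t lam s2 s1 p2 p1).
Proof.
rewrite /cutA conjCD !conjCM !conjc_real conjcK rmorph_sum /=.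
congr (_ * _ + _ * _); first by rewrite mulrC.
by apply: eq_bigr => k _; rewrite conjCM conjcK mulrC.
Qed.

Lemma cutB_herm v t s1 s2 p1 p2 : cutB v t s1 s2 p1 p2 = conjc (cutB v t s2 s1 p2 p1).
Proof. by rewrite /cutB !conjCM conjc_real conjcK; congr (_ * _); rewrite mulrC. Qed.

Lemma comb_defect (J : choiceType) w v s u (xi : 'I_p -> 'I_p -> ell2 R J) :
  comb (defect w v s u) xi = xi s u - w s u *: comb v xi.
Proof.
transitivity (\sum_s' (\sum_u' (((s' == s) && (u' == u))%:R : C) *: xi s' u' -
    w s u *: \sum_u' v s' u' *: xi s' u')).
  apply: eq_bigr => s' _; rewrite scaler_sumr -sumrB; apply: eq_bigr => u' _.
  by rewrite /defect scalerBl scalerA.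
rewrite sumrB -scaler_sumr; congr (_ - _).
rewrite (@big_delta _ _ s) => [|s' /negPf ss]; last first.
  by rewrite big1// => u' _; rewrite ss scale0r.
rewrite (@big_delta _ _ u) => [|u' /negPf uu]; last by rewrite uu andbF scale0r.
by rewrite !eqxx scale1r.
Qed.

Lemma cut_pform (n : ncdim) w v t lam (x : opM R n n) xi :
  Re (pform (cutA w v t lam) (cutB v t) x xi) =
  (1 - t ^+ 2) * sq (comb v xi) + 2 * t * rq x (comb v xi) -
  lam * \sum_k sq (xi k.1 k.2 - w k.1 k.2 *: comb v xi).
Proof.
have -> : pform (cutA w v t lam) (cutB v t) x xi =
    (1 - t ^+ 2)%:C%C * (sq (comb v xi))%:C%C +
    (- lam)%:C%C * (\sum_k sq (xi k.1 k.2 - w k.1 k.2 *: comb v xi))%:C%C +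
    t%:C%C * (ip (x (comb v xi)) (comb v xi) + conjc (ip (x (comb v xi)) (comb v xi))).
  rewrite -ipxx -[ip (comb v xi) _]/(ip (idop R _ (comb v xi)) _) -sum4_comb -sum4Z.
  have -> : ((\sum_k sq (xi k.1 k.2 - w k.1 k.2 *: comb v xi))%:C)%C =
     sum4 (fun s1 s2 p1 p2 => \sum_k conjc (defect w v k.1 k.2 s1 p1) *
        defect w v k.1 k.2 s2 p2 * ip (idop R _ (xi s2 p2)) (xi s1 p1)).
    rewrite sum4_sum rmorph_sum; apply: eq_bigr => k _.
    by rewrite sum4_comb comb_defect; symmetry; exact: ipxx.
  rewrite -sum4Z -sum4D -sum4_comb.
  have -> : conjc (sum4 (fun s1 s2 p1 p2 => conjc (v s1 p1) * v s2 p2 *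
        ip (x (xi s2 p2)) (xi s1 p1))) =
      sum4 (fun s1 s2 p1 p2 => conjc (v s1 p1) * v s2 p2 * conjc (ip (x (xi s1 p1)) (xi s2 p2))).
    rewrite [RHS]exchange_big rmorph_sum; apply: eq_bigr => s2 _.
    rewrite rmorph_sum; apply: eq_bigr => s1 _.
    rewrite [RHS]exchange_big rmorph_sum; apply: eq_bigr => p2 _.
    rewrite rmorph_sum; apply: eq_bigr => p1 _.
    by rewrite [LHS]conjCM conjCM conjcK [X in X * _]mulrC.
  rewrite -sum4D -sum4Z -sum4D; apply: eq_sum4 => s1 s2 p1 p2.
  rewrite /cutA /cutB mulrDl -!mulrA -mulr_suml; congr (_ + _ + _).
  by rewrite -!mulrDr.
rewrite !complexReD !complexReZ complexReD complexRe_conj /rq /=; ring.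
Qed.

Definition fvec (f : 'I_p -> C) : ell2 R 'I_p := \sum_i f i *: delta R i.

Lemma fvecE (f : 'I_p -> C) i : fvec f i = f i :> C.
Proof.
rewrite /fvec ell2_sum (@big_delta _ _ i) => [|j ji]; first by rewrite ell2Z deltaE eqxx mulr1.
by rewrite ell2Z deltaE eq_sym (negPf ji) mulr0.
Qed.

(** The unnormalized maximally entangled vector. [rank1 omega omega] has blocks [E_uv]: it is the
    Choi matrix of the identity, the element [T] at [b]. *)
Definition omega : ell2 R ('I_p * 'I_p)%type := \sum_u delta R (u, u).

Lemma row_omega u : rowop R 'I_p u omega = delta R u.
Proof.
rewrite /omega linear_sum (@big_delta _ _ u) => [|u' uu]; first by rewrite [LHS]row_delta eqxx.
by rewrite [LHS]row_delta eq_sym (negPf uu).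
Qed.

Lemma ip_omega z : ip z omega = \sum_u (rowop R 'I_p u z u : C).
Proof. by rewrite ip_prod; apply: eq_bigr => u _; rewrite row_omega ip_delta. Qed.

Lemma block_omega u v : block (rank1 omega omega) u v = rank1 (delta R u) (delta R v).
Proof.
apply: bopP => x; rewrite blockE !rank1E linearZ adjP adj_inj row_omega.
by congr (_ *: _); exact: row_omega.
Qed.

Lemma sum_sqr_le (n : nat) (f : 'I_n -> C) :
  normsq (\sum_i f i) <= n%:R * \sum_i normsq (f i).
Proof.
pose one : ell2 R 'I_n := \sum_i delta R i.
have oneE i : one i = 1 :> C.
  rewrite /one ell2_sum (@big_delta _ _ i) => [|j ji]; first by rewrite deltaE eqxx.
  by rewrite deltaE eq_sym (negPf ji).
pose g : ell2 R 'I_n := \sum_i f i *: delta R i.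
have gE i : g i = f i :> C.
  rewrite /g ell2_sum (@big_delta _ _ i) => [|j ji]; first by rewrite ell2Z deltaE eqxx mulr1.
  by rewrite ell2Z deltaE eq_sym (negPf ji) mulr0.
have := normsq_ip_le g one; rewrite ip_fin !sq_fin mulrC.
rewrite (eq_bigr f) => [|i _]; last by rewrite gE oneE conjc1 mulr1.
have -> : \sum_i normsq (one i) = n%:R.
  rewrite (eq_bigr (fun=> 1)) => [|i _]; first by rewrite sumr_const card_ord.
  by rewrite oneE /normsq /= expr1n expr0n addr0.
by rewrite [in X in _ <= _ * X](eq_bigr (fun i => normsq (f i))) => [//|i _]; rewrite gE.
Qed.

Section Membership.
Variables (b : bop R 'I_p 'I_p) (t : R).
Hypothesis t0 : t != 0.

Definition weight : bop R 'I_p 'I_p := idop R _ + t%:C%C *: b.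

Definition wmx (s u : 'I_p) : C := weight (delta R u) s.

(** Write [xi = w eta + zeta]. Pairing with [omega] sums the diagonal coordinates, so the right-hand
    side is [|W eta + Z|^2], where [Z] collects those of [zeta] and [|Z|^2 <= p sum |zeta|^2].
    Expanding, the cross terms with [Z] are absorbed by the slack [t^2 (|eta|^2 + |b eta|^2)] at the
    cost of [|Z|^2 / t^2]: hence the penalty weight [p / t^2]. *)
Lemma omega_cut (v : 'I_p -> 'I_p -> C) (z : ell2 R ('I_p * ('I_p * 'I_p))%type) xi :
  xi = (fun s u => rowop R 'I_p u (rowop R _ s z)) ->
  (1 - t ^+ 2) * sq (comb v xi) + 2 * t * rq b (comb v xi) -
    (p%:R / t ^+ 2) * \sum_k sq (xi k.1 k.2 - wmx k.1 k.2 *: comb v xi)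
  <= \sum_s rq (rank1 omega omega) (rowop R _ s z).
Proof.
move=> hxi; set eta := comb v xi.
pose zeta s u := xi s u - wmx s u *: eta.
pose Z := fvec (fun s => \sum_u (zeta s u u : C)).
have Om s : ip (rowop R _ s z) omega = ((weight eta + Z) s : C).
  have -> : ip (rowop R _ s z) omega = \sum_u (xi s u u : C) by rewrite ip_omega hxi.
  have wE : weight eta s = \sum_u (eta u : C) * wmx s u :> C.
    rewrite [X in weight X]delta_expand linear_sum ell2_sum.
    by apply: eq_bigr => u _; rewrite linearZ.
  have zE u : (zeta s u u : C) = (xi s u u : C) - wmx s u * (eta u : C) by [].
  rewrite ell2D fvecE wE -big_split; apply: eq_bigr => u _.
  by rewrite zE [LHS]/= mulrC [RHS]addrC subrK.
have -> : \sum_s rq (rank1 omega omega) (rowop R _ s z) = sq (weight eta + Z).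
  by rewrite sq_fin; apply: eq_bigr => s _; rewrite rq_rank1 Om.
have ZL : sq Z <= p%:R * \sum_k sq (zeta k.1 k.2).
  rewrite sq_fin -(pair_bigA _ (fun s u => sq (zeta s u))) /= mulr_sumr.
  apply: ler_sum => s _; rewrite fvecE; apply: le_trans (sum_sqr_le _) _.
  rewrite ler_wpM2l ?ler0n//; apply: ler_sum => u _; exact: normsq_le_sq.
have t2 : 0 < t ^+ 2 by rewrite exprn_even_gt0.
have ZL' : sq Z / t ^+ 2 <= p%:R / t ^+ 2 * \sum_k sq (zeta k.1 k.2).
  by rewrite mulrAC ler_pM2r ?invr_gt0.
have w1 : sq (weight eta) = sq eta + 2 * t * rq b eta + t ^+ 2 * sq (b eta).
  rewrite /weight bopDE bopZE -[idop R _ eta]/eta sqD sqZ ipZr conjc_real complexReZ.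
  have -> : Re (ip eta (b eta)) = rq b eta by rewrite ipC complexRe_conj.
  by rewrite /normsq /= expr0n addr0; ring.
have w2 : Re (ip (weight eta) Z) = Re (ip eta Z) + t * Re (ip (b eta) Z).
  by rewrite /weight bopDE bopZE -[idop R _ eta]/eta ipDl ipZl complexReD complexReZ.
(* Two applications of AM-GM: [- 2 Re <eta, Z> <= t^2 |eta|^2 + |Z|^2 / t^2] and [- 2 t Re <b eta,
   Z> <= t^2 |b eta|^2 + |Z|^2]. *)
have h1 := le_sqB (t%:C%C *: eta) (- (t^-1)%:C%C *: Z).
have h2 := le_sqB (t%:C%C *: b eta) (- Z).
move: h1 h2; rewrite scaleNr ipNr ipZl ipZr conjc_real mulrA -rmorphM /= mulfV// mul1r.
rewrite !sqN !sqZ !ipNr ipZl !raddfN /= complexReZ.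
have nr (r : R) : normsq r%:C%C = r ^+ 2 by rewrite /normsq /= expr0n addr0.
rewrite !nr sqD w1 w2 exprVn => h1 h2.
rewrite -/zeta; lra.
Qed.

End Membership.

(** On families of the form [W (x) eta], where the penalty vanishes, the form of [1 (x) S] is that
    of the image of [W^* W] under the map with Choi matrix [S]. This turns a cut at [a] into an
    inequality for [Phi]. *)
Lemma choi_weight (I : finType) (S : bop R ('I_p * I)%type ('I_p * I)%type)
    (W : bop R 'I_p 'I_p) (eta : ell2 R I) (z : ell2 R ('I_p * ('I_p * I))%type) :
  (forall s u, rowop R I u (rowop R _ s z) = (W (delta R u) s : C) *: eta) ->
  \sum_s rq S (rowop R _ s z) = rq (choi S (adj W *o W)) eta.
Proof.
move=> hz; rewrite /rq /choi bop_sumE ip_suml -complexRe_sum; congr complex.Re.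
under eq_bigr do rewrite ip_block.
rewrite exchange_big; apply: eq_bigr => u _.
rewrite exchange_big bop_sumE ip_suml; apply: eq_bigr => v _.
rewrite bopZE ipZl.
have -> : ip ((adj W *o W) (delta R v)) (delta R u) =
    \sum_s (W (delta R v) s : C) * conjc (W (delta R u) s).
  by rewrite -[LHS]/(ip (adj W (W (delta R v))) (delta R u)) -adjPr ip_fin.
rewrite mulr_suml; apply: eq_bigr => s _.
by rewrite !hz linearZ ipZl ipZr mulrA.
Qed.

End CutMatrix.

(** * Limits and positivity for [idtens] and [choi] *)

Section Idtens.
Variable R : realType.
Notation C := R[i].
Local Notation Re := complex.Re.

Lemma ip_blockE (P I : choiceType) (S : bop R (P * I)%type (P * I)%type) u v x y :
  ip (block S u v x) y = ip (S (injop R I v x)) (injop R I u y).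
Proof. by rewrite blockE [RHS]adjPr adj_inj. Qed.

Lemma rq_block (P I : choiceType) (S : bop R (P * I)%type (P * I)%type) u x :
  rq (block S u u) x = rq S (injop R I u x).
Proof. by rewrite /rq ip_blockE. Qed.

Lemma oppos_block (P I : choiceType) (S : bop R (P * I)%type (P * I)%type) u :
  oppos S -> oppos (block S u u).
Proof.
move=> /opposP[sS S0]; apply/opposP; split; first by rewrite /selfadj adj_block sS.
by move=> x; rewrite rq_block.
Qed.

Lemma oppos_lim (T : Type) (F : set_system T) {FF : ProperFilter F} (I : choiceType)
    (f : T -> bop R I I) (S : bop R I I) :
  (forall u v, tendsto F (fun x => ip (f x u) v) (ip (S u) v)) ->
  (\forall x \near F, oppos (f x)) -> oppos S.
Proof.
move=> fS f0; apply/opposP; split.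
  by apply: (selfadj_lim fS); apply: filterS f0 => x; exact: oppos_selfadj.
move=> u; apply: (tendsto_ge0 (fS u u)); apply: filterS f0 => x /opposP[_]; exact.
Qed.

Lemma opposZ (I : choiceType) (a : R) (S : bop R I I) :
  0 <= a -> oppos S -> oppos (a%:C%C *: S).
Proof.
move=> a0 /opposP[sS S0]; apply/opposP; split=> [|u].
  by rewrite /selfadj adj_scale conjc_real sS.
by rewrite rqZ mulr_ge0.
Qed.

Lemma oppos_anti (I : choiceType) (S : bop R I I) : oppos S -> oppos (- S) -> S = 0.
Proof.
move=> /opposP[sS S0] /opposP[_ S0']; apply: selfadj_rq0 => // u.
apply/eqP; rewrite eq_le S0 andbT; have := S0' u.
by rewrite /rq bopNE ipNl raddfN oppr_ge0.
Qed.

Lemma rank1_id (I : finType) : \sum_u rank1 (delta R u) (delta R u) = idop R I.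
Proof.
apply: bopP => x; rewrite bop_sumE -[RHS]/x [RHS]delta_expand.
by apply: eq_bigr => u _; rewrite rank1E ip_delta.
Qed.

Section Linear.
Variables (P I J : finType) (psi : {linear bop R I I -> bop R J J}).
Implicit Types S : bop R (P * I)%type (P * I)%type.

(** In finite dimension [(id (x) psi) S] is a finite linear expression in the matrix entries of [S];
    homogeneity and continuity under weak limits are read off it. *)
Lemma ip_idtens S z w : ip (idtens psi S z) w =
  \sum_u \sum_v \sum_x \sum_y ip (S (injop R I v (delta R y))) (injop R I u (delta R x)) *
    ip (psi (rank1 (delta R x) (delta R y)) (rowop R J v z)) (rowop R J u w).
Proof.
rewrite ip_block; apply: eq_bigr => u _; apply: eq_bigr => v _.
rewrite block_idtens (bop_expand (block S u v)) linear_sum bop_sumE ip_suml.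
apply: eq_bigr => x _; rewrite linear_sum bop_sumE ip_suml.
apply: eq_bigr => y _; rewrite linearZ bopZE ipZl; congr (_ * _).
by rewrite -ip_delta ip_blockE.
Qed.

Lemma idtensZ c S : idtens psi (c *: S) = c *: idtens psi S.
Proof.
apply: bop_ipP => z w; rewrite bopZE ipZl !ip_idtens.
do 4!(rewrite mulr_sumr; apply: eq_bigr => ? _).
by rewrite bopZE ipZl mulrA.
Qed.

Lemma idtens_lim (T : Type) (F : set_system T) {FF : Filter F}
    (f : T -> bop R (P * I)%type (P * I)%type) S :
  (forall u v, tendsto F (fun x => ip (f x u) v) (ip (S u) v)) ->
  forall u v, tendsto F (fun x => ip (idtens psi (f x) u) v) (ip (idtens psi S u) v).
Proof.
move=> fS z w; rewrite ip_idtens.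
rewrite (_ : (fun t => _) = fun t => \sum_u \sum_v \sum_x \sum_y
   ip (psi (rank1 (delta R x) (delta R y)) (rowop R J v z)) (rowop R J u w) *
   ip (f t (injop R I v (delta R y))) (injop R I u (delta R x))); last first.
  by apply/funext => t; rewrite ip_idtens; do 4!(apply: eq_bigr => ? _); rewrite mulrC.
do 4!(apply: tendsto_sum => ?); rewrite mulrC; apply: tendstoZ; exact: fS.
Qed.

Lemma ip_choi S Y z w : ip (choi S Y z) w = \sum_u \sum_v
  ip (Y (delta R v)) (delta R u) * ip (S (injop R I v z)) (injop R I u w).
Proof.
rewrite /choi bop_sumE ip_suml; apply: eq_bigr => u _; rewrite bop_sumE ip_suml.
by apply: eq_bigr => v _; rewrite bopZE ipZl ip_blockE.
Qed.

Lemma rq_choiZ (c : R) S Y z : rq (choi (c%:C%C *: S) Y) z = c * rq (choi S Y) z.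
Proof.
rewrite /rq -complexReZ; congr complex.Re; rewrite !ip_choi.
do 2!(rewrite mulr_sumr; apply: eq_bigr => ? _).
by rewrite bopZE ipZl mulrCA.
Qed.

Lemma choi_lim (T : Type) (F : set_system T) {FF : Filter F}
    (f : T -> bop R (P * I)%type (P * I)%type) S Y :
  (forall u v, tendsto F (fun x => ip (f x u) v) (ip (S u) v)) ->
  forall u v, tendsto F (fun x => ip (choi (f x) Y u) v) (ip (choi S Y u) v).
Proof.
move=> fS z w; rewrite ip_choi.
rewrite (_ : (fun t => _) = fun t => \sum_u \sum_v
   ip (Y (delta R v)) (delta R u) * ip (f t (injop R I v z)) (injop R I u w)); last first.
  by apply/funext => t; rewrite ip_choi.
do 2!(apply: tendsto_sum => ?); apply: tendstoZ; exact: fS.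
Qed.

End Linear.

Lemma quad_lim (X Y Z d : R) :
  (forall n : nat, 0 <= X + d / n.+1%:R * Y + (d / n.+1%:R) ^+ 2 * Z) -> 0 <= X.
Proof.
move=> h.
have h1 : (fun n : nat => d * harmonic n) @ \oo --> d * 0.
  by apply: cvgMl_tmp; exact: cvg_harmonic.
rewrite mulr0 in h1.
have h2 : (fun n : nat => X + d * harmonic n * Y + (d * harmonic n) * (d * harmonic n) * Z)
    @ \oo --> X + 0 * Y + 0 * 0 * Z.
  apply: cvgD; first by apply: cvgD; [exact: cvg_cst|exact: cvgMr_tmp].
  by apply: cvgMr_tmp; exact: cvgM.
rewrite !mul0r !addr0 in h2.
apply: (cvgr_to_ge h2); apply: (@filterS _ _ _ setT) => [n _|]; last exact: filterT.
by have := h n; rewrite expr2.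
Qed.

Lemma quad_lim1 (Y Z d : R) : 0 < d ->
  (forall n : nat, 0 <= d / n.+1%:R * Y + (d / n.+1%:R) ^+ 2 * Z) -> 0 <= Y.
Proof.
move=> d0 h; apply: (@quad_lim Y Z 0 d) => n; rewrite mulr0 addr0.
have dn : 0 < d / n.+1%:R by rewrite divr_gt0.
by rewrite -(pmulr_rge0 _ dn) mulrDr mulrA -expr2; exact: h.
Qed.

Lemma ucp_pos (n m : nat) (hn : (0 < n)%N) (hm : (0 < m)%N)
    (psi : opM R (Fin hn) (Fin hn) -> opM R (Fin hm) (Fin hm)) X :
  ucp psi -> oppos X -> oppos (psi X).
Proof.
move=> [_ h] X0.
pose T : opMp R (Fin (ltn0Sn 0)) (Fin hn) := blockop (fun _ _ : 'I_1 => X).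
have T0 : oppos T.
  move=> u; rewrite -[inner _ _]/(ip (T u) u) (@ip_block _ 'I_1) !big_ord1.
  by rewrite /T block_blockop; exact: X0.
have := oppos_block ord0 (h _ _ _ T0).
by rewrite (@block_idtens _ 'I_1) /T block_blockop.
Qed.

End Idtens.

(** * The countable list of test cuts *)

Section Testing.
Variable R : realType.
Notation C := R[i].
Variables (n1 n2 k : nat).
Hypotheses (hn1 : (0 < n1)%N) (hn2 : (0 < n2)%N) (hk : (0 < k)%N).
Variables (a : tuples R k (Fin hn1)) (b : tuples R k (Fin hn2)).
Hypothesis sb : forall j, selfadj (b j).

Let o : 'I_n2 := Ordinal hn2.
Let b00 j : R := rq (b j) (delta R o).
Let scale : R := 1 + \sum_j `|b00 j|.

Let scale_gt0 : 0 < scale.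
Proof. by rewrite ltr_pwDl// sumr_ge0. Qed.

(* Small enough for [pivot] to be defined: [1 + step c * b00 j] never vanishes. *)
Definition step (c : 'I_k * nat * bool) : R :=
  (if c.2 then 1 else - 1) / scale / c.1.2.+1%:R.

Lemma stepE : exists2 d : R, 0 < d & forall c,
  step c = (if c.2 then d else - d) / c.1.2.+1%:R.
Proof.
exists scale^-1; first by rewrite invr_gt0 scale_gt0.
by move=> c; rewrite /step; case: c.2; rewrite ?mulN1r ?mul1r.
Qed.

Lemma step_neq0 c : step c != 0.
Proof.
rewrite /step mulf_neq0 ?invr_eq0 ?pnatr_eq0// mulf_neq0 ?invr_eq0 ?(gt_eqF scale_gt0)//.
by case: c.2; rewrite ?oppr_eq0 oner_eq0.
Qed.

Lemma step_b00 c : 1 + step c * b00 c.1.1 != 0.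
Proof.
have h : `|b00 c.1.1| < scale.
  rewrite /scale; apply: (@le_lt_trans _ _ (\sum_j `|b00 j|)); last by rewrite ltrDr.
  exact: (@ler_term _ _ (fun j => `|b00 j|)).
have s1 : `|step c| <= scale^-1.
  rewrite /step !normrM !normfV.
  have -> : `|if c.2 then 1 else -1| = 1 :> R by case: c.2; rewrite ?normrN normr1.
  rewrite mul1r (gtr0_norm scale_gt0) normr_nat ler_piMr ?invr_ge0 ?(ltW scale_gt0)//.
  by rewrite invf_le1 ?ltr0n// ler1n.
have h1 : `|step c * b00 c.1.1| < 1.
  rewrite normrM; apply: (@le_lt_trans _ _ (scale^-1 * `|b00 c.1.1|)).
    by rewrite ler_wpM2r.
  by rewrite mulrC ltr_pdivrMr// mul1r.
by apply/eqP => e; move: h1; rewrite -[step c * _](addKr 1) e addr0 normrN normr1 ltxx.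
Qed.

Let W c : bop R 'I_n2 'I_n2 := weight (b c.1.1) (step c).
Let wm c : 'I_n2 -> 'I_n2 -> C := wmx (b c.1.1) (step c).

Lemma wm00 c : wm c o o != 0.
Proof.
have -> : wm c o o = (1 + step c * b00 c.1.1)%:C%C.
  have bE : b c.1.1 (delta R o) o = (b00 c.1.1)%:C%C :> C.
    rewrite -ip_delta; have := selfadj_Im (delta R o) (sb c.1.1); rewrite /b00 /rq.
    by case: (ip _ _) => x y /= ->.
  rewrite /wm /wmx /weight bopDE bopZE ell2D ell2Z bE.
  rewrite -[idop R _ (delta R o) o]/((o == o)%:R : C) eqxx; move: (step c) (b00 _) => t x.
  by rewrite rmorphD rmorphM rmorph1.
by rewrite (inj_eq (@complexI R) _ 0) step_b00.
Qed.

(** The coefficients [v] of the cut: [sum v w = 1] with a single nonzero entry, so [comb] recovers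
    [eta] from [w eta]. This requires [wm c o o] to be nonzero, which the size of [step]
    guarantees. *)
Definition pivot c (s u : 'I_n2) : C :=
  if (s == o) && (u == o) then (wm c o o)^-1 else 0.

Lemma comb_pivot (J : choiceType) c (xi : 'I_n2 -> 'I_n2 -> ell2 R J) :
  comb (pivot c) xi = (wm c o o)^-1 *: xi o o.
Proof.
rewrite /comb (@big_delta _ _ o) => [|s so]; last first.
  by rewrite big1// => u _; rewrite /pivot (negPf so) scale0r.
rewrite (@big_delta _ _ o) => [|u uo]; last by rewrite /pivot (negPf uo) andbF scale0r.
by rewrite /pivot !eqxx.
Qed.

(* Cut 0 is the trivial cut [0 <= al]; the others enumerate all [c = (j, n, sign)], with
   [t = step c]. *)
Definition decode (i : nat) : option ('I_k * nat * bool) :=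
  if i is i'.+1 then choice.unpickle i' else None.

Lemma decodeK c : decode (choice.pickle c).+1 = Some c.
Proof. by rewrite /= choice.pickleK. Qed.

Definition cut_j i : 'I_k := if decode i is Some c then c.1.1 else Ordinal hk.

Definition cut_A i : 'I_n2 -> 'I_n2 -> 'I_n2 -> 'I_n2 -> C :=
  if decode i is Some c
  then cutA (wm c) (pivot c) (step c) (n2%:R / step c ^+ 2) else fun _ _ _ _ => 0.

Definition cut_B i : 'I_n2 -> 'I_n2 -> 'I_n2 -> 'I_n2 -> C :=
  if decode i is Some c then cutB (pivot c) (step c) else fun _ _ _ _ => 0.

Lemma cut_A_herm i s1 s2 p1 p2 : cut_A i s1 s2 p1 p2 = conjc (cut_A i s2 s1 p2 p1).
Proof. by rewrite /cut_A; case: decode => [c|]; [exact: cutA_herm|rewrite conjc0]. Qed.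

Lemma cut_B_herm i s1 s2 p1 p2 : cut_B i s1 s2 p1 p2 = conjc (cut_B i s2 s1 p2 p1).
Proof. by rewrite /cut_B; case: decode => [c|]; [exact: cutB_herm|rewrite conjc0]. Qed.

Lemma pform0 n (x : opM R n n) (xi : 'I_n2 -> 'I_n2 -> ell2 R (idx n)) :
  pform (fun _ _ _ _ => 0) (fun _ _ _ _ => 0) x xi = 0.
Proof.
rewrite /pform /pformW; do 4!(rewrite big1// => ? _).
by rewrite !mul0r addr0.
Qed.

Section Family.
Variable N : nat.
Let jj (i : 'I_N.+1) := cut_j i.
Let A (i : 'I_N.+1) := cut_A i.
Let B (i : 'I_N.+1) := cut_B i.
Let hA (i : 'I_N.+1) := @cut_A_herm i.
Let hB (i : 'I_N.+1) := @cut_B_herm i.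

Definition testmap : mvfun R k (Fin hn2) := @pencutmap R k n2 n2 N.+1 hn2 jj A B.

Lemma omega_psd : oppos (rank1 (omega R n2) (omega R n2)).
Proof.
apply/opposP; split; first exact: adj_rank1.
by move=> u; rewrite rq_rank1 normsq_ge0.
Qed.

Lemma testmap_omega : testmap b (rank1 (omega R n2) (omega R n2)).
Proof.
apply: (pencutP (ltn0Sn N) jj hA hB b _).2; split=> [|i z]; first exact: adj_rank1.
rewrite /A /B /jj /cut_A /cut_B /cut_j; case: decode => [c|]; last first.
  rewrite pform0; apply: sumr_ge0 => s _.
  by have [_] := (opposP _).1 omega_psd; apply.
rewrite cut_pform.
exact: (omega_cut (b c.1.1) (step_neq0 c) (pivot c) (erefl _)).
Qed.

Lemma testmap_psd (S : opMp R (Fin hn2) (Fin hn1)) : testmap a S -> oppos S.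
Proof.
move=> /(pencutP (ltn0Sn N) jj hA hB a _).1[sS h]; apply/opposP; split=> // z.
(* Cut [0] has zero coefficients; placing [z] in a single row makes it say [0 <= <S z, z>]. *)
have := h ord0 (injop R ('I_n2 * 'I_n1)%type (o : 'I_n2) z).
have d0 : decode (ord0 : 'I_N.+1) = None by [].
rewrite /A /B /jj /cut_A /cut_B d0 pform0.
rewrite (@big_delta _ _ o) => [|s so]; first by rewrite row_inj eqxx.
by rewrite row_inj (negPf so) /rq linear0 ip0l.
Qed.

Lemma testmap_cut (S : bop R ('I_n2 * 'I_n1)%type ('I_n2 * 'I_n1)%type) c
    (eta : ell2 R 'I_n1) : testmap a S ->
  ((choice.pickle c).+1 < N.+1)%N ->
  (1 - step c ^+ 2) * sq eta + 2 * step c * rq (a c.1.1) eta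
  <= rq (choi S (adj (W c) *o W c)) eta.
Proof.
move=> /(pencutP (ltn0Sn N) jj hA hB a _).1[sS h] cN.
(* The family [w eta] stored as one vector: the penalty vanishes on it and [comb] with [pivot]
   returns [eta]. *)
pose z : ell2 R ('I_n2 * ('I_n2 * 'I_n1))%type :=
  \sum_s injop R _ s (\sum_u injop R _ u (wm c s u *: eta)).
have zE s u : rowop R 'I_n1 u (rowop R _ s z) = wm c s u *: eta.
  have -> : rowop R _ s z = \sum_u injop R _ u (wm c s u *: eta).
    rewrite /z linear_sum (@big_delta _ _ s) => [|s' ss]; first by rewrite [LHS]row_inj eqxx.
    by rewrite [LHS]row_inj eq_sym (negPf ss).
  rewrite linear_sum (@big_delta _ _ u) => [|u' uu]; first by rewrite [LHS]row_inj eqxx.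
  by rewrite [LHS]row_inj eq_sym (negPf uu).
rewrite -(choi_weight S zE).
have := h (Ordinal cN) z; rewrite /A /B /jj /cut_A /cut_B /cut_j [nat_of_ord _]/= decodeK.
rewrite cut_pform comb_pivot.
have -> : (wm c o o)^-1 *:
    rowop R (idx (Fin hn1)) o (rowop R ('I_n2 * idx (Fin hn1))%type o z) = eta.
  by rewrite (zE o o) scalerA mulVf ?wm00// scale1r.
rewrite [X in _ - _ * X]big1 => [|s _]; last by rewrite zE subrr sq0.
by rewrite mulr0 subr0.
Qed.

End Family.
End Testing.

(** * Passage to the limit *)

Section Limit.
Variable R : realType.
Notation C := R[i].
Local Notation Re := complex.Re.
Variables (m n1 n2 k : nat).
Hypotheses (hm : (0 < m)%N) (hn1 : (0 < n1)%N) (hn2 : (0 < n2)%N) (hk : (0 < k)%N).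
Variables (psi1 : {linear opM R (Fin hn1) (Fin hn1) -> opM R (Fin hm) (Fin hm)})
          (psi2 : {linear opM R (Fin hn2) (Fin hn2) -> opM R (Fin hm) (Fin hm)}).
Variables (a : tuples R k (Fin hn1)) (b : tuples R k (Fin hn2)).
Hypotheses (u1 : ucp psi1) (f1 : faithful psi1).
Hypothesis sb : forall j, selfadj (b j).

Local Notation bop12 := (bop R ('I_n2 * 'I_n1)%type ('I_n2 * 'I_n1)%type).
Let om := rank1 (omega R n2) (omega R n2).
Let st (c : 'I_k * nat * bool) : R := step b c.
Let W (c : 'I_k * nat * bool) : bop R 'I_n2 'I_n2 := weight (b c.1.1) (st c).
Let cut (S : bop12) c (eta : ell2 R 'I_n1) :=
  rq (choi S (adj (W c) *o W c)) eta.
Let bound c (eta : ell2 R 'I_n1) := (1 - st c ^+ 2) * sq eta + 2 * st c * rq (a c.1.1) eta.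
Let P1 : {linear bop R 'I_n1 'I_n1 -> bop R 'I_m 'I_m} := psi1.
Let P2 : {linear bop R 'I_n2 'I_n2 -> bop R 'I_m 'I_m} := psi2.

Lemma rqN (I : choiceType) (T : bop R I I) u : rq (- T) u = - rq T u.
Proof. by rewrite /rq bopNE ipNl raddfN. Qed.

Lemma psi1_pos (X : bop R 'I_n1 'I_n1) : oppos X -> oppos (P1 X).
Proof. exact: ucp_pos. Qed.

(** Each [psi1 (S_uu)] is both positive and negative, so [S_uu = 0] by faithfulness, and a positive
    operator with zero trace is zero. *)
Lemma psd_zero_blocks (S : bop12) : oppos S -> oppos (- idtens P1 S) -> S = 0.
Proof.
move=> S0 nS.
have b0 u : block S u u = 0.
  apply: f1; first exact: oppos_block.
  apply: oppos_anti; first by apply: psi1_pos; exact: oppos_block.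
  apply/opposP; split.
    rewrite /selfadj adjN; congr (- _).
    by have := oppos_selfadj (psi1_pos (oppos_block u S0)).
  move=> x; have [_ /(_ (injop R 'I_m u x))] := (opposP _).1 nS.
  by rewrite !rqN -rq_block block_idtens.
apply: psd_trace0 => //; rewrite /mtrace big1// => -[u x] _.
by rewrite -inj_delta -rq_block b0 /rq ip0l.
Qed.

(* The [S_N] are normalized so that [tr S_N + kappa_N = 1], which makes them bounded;
   faithfulness of [psi1] excludes that [kappa_N] tends to [0]. *)
Lemma limit_choi :
  (forall N, exists S : bop12,
     @testmap R n2 k hn2 hk b N _ a S /\ ople (idtens P1 S) (idtens P2 om)) ->
  exists S : bop12, [/\ oppos S, forall c eta, bound c eta <= cut S c eta &
    ople (idtens P1 S) (idtens P2 om)].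
Proof.
move=> /choice[Sn hS].
have Sn0 N : oppos (Sn N) by have [h _] := hS N; exact: (testmap_psd h).
have tr0 N : 0 <= mtrace (Sn N).
  by apply: sumr_ge0 => x _; have [_] := (opposP _).1 (Sn0 N); apply.
pose kap N := (1 + mtrace (Sn N))^-1.
have kap0 N : 0 < kap N by rewrite invr_gt0 ltr_pwDl.
have kapE N : kap N * (1 + mtrace (Sn N)) = 1 by rewrite mulVf// gt_eqF// ltr_pwDl.
have kap1 N : `|kap N| <= 1.
  by rewrite gtr0_norm// -(kapE N) ler_pMr// lerDl.
pose S' N := (kap N)%:C%C *: Sn N.
have S'0 N : oppos (S' N) by apply: opposZ => //; exact: ltW.
have S'tr N : mtrace (S' N) = kap N * mtrace (Sn N).
  by rewrite /mtrace mulr_sumr; apply: eq_bigr => x _; rewrite rqZ.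
have S'B N : sabound 1 (S' N).
  have [sS h] := psd_trace_bound (S'0 N); split=> // u.
  apply: le_trans (h u) _; rewrite ler_wpM2r ?sq_ge0// S'tr -(kapE N).
  by rewrite ler_pM2l// lerDr.
have [U [UU nU]] := ultraFilterLemma eventually_filter.
have PU : ProperFilter U by case: UU.
have FU : Filter U by case: PU.
have [kp hkp] := ultra_bounded_cvg UU kap1.
have [S SB Sl] := sabound_ulim UU ler01 S'B.
have S0 : oppos S.
  by apply: (oppos_lim Sl); apply: (@filterS _ _ _ setT) => [N _|]; [exact: S'0|exact: filterT].
have kp0 : 0 <= kp.
  apply: (cvgr_to_ge hkp); apply: (@filterS _ _ _ setT) => [N _|]; last exact: filterT.
  exact: ltW.
have kpC : tendsto U (fun N => (kap N)%:C%C) kp%:C%C by exact: tendsto_real.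
(* The normalization survives in the limit because the trace is a finite sum of entries. *)
have tr1 : mtrace S + kp = 1.
  have h : tendsto U (fun N => \sum_x ip (S' N (delta R x)) (delta R x) + (kap N)%:C%C)
      (\sum_x ip (S (delta R x)) (delta R x) + kp%:C%C).
    apply: tendstoD; last exact: kpC.
    by apply: tendsto_sum => x; exact: Sl.
  have hE N : Re (\sum_x ip (S' N (delta R x)) (delta R x) + (kap N)%:C%C) = 1.
    rewrite complexReD complexRe_sum -[X in X + _]/(mtrace (S' N)) S'tr -(kapE N) /=.
    by rewrite mulrDr mulr1 addrC.
  have -> : mtrace S + kp = Re (\sum_x ip (S (delta R x)) (delta R x) + kp%:C%C).
    by rewrite complexReD complexRe_sum.
  have hc : tendsto U (fun=> (1 : C)) 1 by exact: tendsto_cst.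
  apply/eqP; rewrite eq_le -[X in _ <= X]/(Re (1 : C)) -[X in _ && (X <= _)]/(Re (1 : C)).
  apply/andP; split.
    apply: (tendsto_le h hc); apply: (@filterS _ _ _ setT) => [N _|]; last exact: filterT.
    by rewrite hE.
  apply: (tendsto_le hc h); apply: (@filterS _ _ _ setT) => [N _|]; last exact: filterT.
  by rewrite hE.
have cutS c eta : kp * bound c eta <= cut S c eta.
  have h1 : tendsto U (fun N => (bound c eta)%:C%C * (kap N)%:C%C) ((bound c eta)%:C%C * kp%:C%C).
    exact: tendstoZ.
  have h2 : tendsto U (fun N => ip (choi (S' N) (adj (W c) *o W c) eta) eta)
    (ip (choi S (adj (W c) *o W c) eta) eta) by exact: choi_lim.
  have -> : kp * bound c eta = Re ((bound c eta)%:C%C * kp%:C%C) by rewrite complexReZ mulrC.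
  apply: (tendsto_le h1 h2).
  (* Cut [c] has index [(pickle c).+1], so it is present in [testmap] as soon as [pickle c < N], and
     [U] contains this set of [N]. *)
  have := nU _ (nbhs_infty_gt (choice.pickle c)); apply: filterS => N cN.
  rewrite complexReZ mulrC -[leRHS]/(rq (choi (S' N) (adj (W c) *o W c)) eta) rq_choiZ.
  rewrite -[Re _]/(kap N) ler_pM2l //; have [h _] := hS N.
  by apply: (testmap_cut sb eta h); rewrite ltnS.
pose Q N := (kap N)%:C%C *: idtens P2 om - idtens P1 (S' N).
have Q0 N : oppos (Q N).
  rewrite /Q idtensZ -scalerBr; apply: opposZ; first exact: ltW.
  by have [_] := hS N.
have Ql u v : tendsto U (fun N => ip (Q N u) v) (ip ((kp%:C%C *: idtens P2 om - idtens P1 S) u) v).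
  rewrite bopDE bopNE bopZE ipBl ipZl mulrC.
  rewrite (_ : (fun N => _) = fun N => ip (idtens P2 om u) v * (kap N)%:C%C +
      (-1) * ip (idtens P1 (S' N) u) v); last first.
    by apply/funext => N; rewrite /Q bopDE bopNE bopZE ipBl ipZl mulrC mulN1r.
  rewrite -[X in _ + X]mulN1r; apply: tendstoD; first exact: tendstoZ.
  by apply: tendstoZ; exact: (idtens_lim P1 Sl).
have Qlim : oppos (kp%:C%C *: idtens P2 om - idtens P1 S).
  apply: (oppos_lim Ql); apply: (@filterS _ _ _ setT) => [N _|]; last exact: filterT.
  exact: Q0.
(* If [kap N] tended to [0], the limit inequality would read [(id (x) psi1) S <= 0], forcing [S = 0]
   against trace [1]. Otherwise dividing by [kp] undoes the normalization. *)
have [kpe|kpn] := eqVneq kp 0.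
  move: Qlim; rewrite kpe scale0r sub0r => /(psd_zero_blocks S0) Se.
  by move: tr1; rewrite kpe addr0 Se /mtrace big1 => [|x _]; rewrite /rq ?ip0l//; lra.
have kpp : 0 < kp by rewrite lt_neqAle eq_sym kpn.
have ip0 : 0 <= kp^-1 by rewrite invr_ge0.
exists ((kp^-1)%:C%C *: S); split.
- exact: opposZ.
- by move=> c eta; rewrite /cut rq_choiZ ler_pdivlMl//; exact: cutS.
- rewrite /ople idtensZ.
  have -> : idtens P2 om - (kp^-1)%:C%C *: idtens P1 S =
      (kp^-1)%:C%C *: (kp%:C%C *: idtens P2 om - idtens P1 S).
    by rewrite scalerBr scalerA -rmorphM /= mulVf// scale1r.
  exact: opposZ.
Qed.

End Limit.

(** * The unital map and its Kraus operators *)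

Section Kraus.
Variable R : realType.
Notation C := R[i].
Variables (m n1 n2 k : nat).
Hypotheses (hm : (0 < m)%N) (hn1 : (0 < n1)%N) (hn2 : (0 < n2)%N) (hk : (0 < k)%N).
Variables (psi1 : {linear opM R (Fin hn1) (Fin hn1) -> opM R (Fin hm) (Fin hm)})
          (psi2 : {linear opM R (Fin hn2) (Fin hn2) -> opM R (Fin hm) (Fin hm)}).
Variables (a : tuples R k (Fin hn1)) (b : tuples R k (Fin hn2)).
Hypotheses (u1 : ucp psi1) (u2 : ucp psi2) (f1 : faithful psi1).
Hypotheses (sa : forall j, selfadj (a j)) (sb : forall j, selfadj (b j)).

Local Notation bop12 := (bop R ('I_n2 * 'I_n1)%type ('I_n2 * 'I_n1)%type).
Let om := rank1 (omega R n2) (omega R n2).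
Let W (c : 'I_k * nat * bool) : bop R 'I_n2 'I_n2 := weight (b c.1.1) (step b c).
Let P1 : {linear bop R 'I_n1 'I_n1 -> bop R 'I_m 'I_m} := psi1.
Let P2 : {linear bop R 'I_n2 'I_n2 -> bop R 'I_m 'I_m} := psi2.

Definition kraus (al : seq (bop R 'I_n1 'I_n2)) : Prop :=
  [/\ \sum_(v <- al) adj v *o v = idop R 'I_n1,
      forall j, \sum_(v <- al) adj v *o b j *o v = a j &
      forall Y, P1 (\sum_(v <- al) adj v *o Y *o v) = P2 Y].

Variable S : bop12.
Hypotheses (S0 : oppos S) (SP : ople (idtens P1 S) (idtens P2 om)).
Hypothesis Scut : forall c (eta : ell2 R 'I_n1),
  (1 - step b c ^+ 2) * sq eta + 2 * step b c * rq (a c.1.1) eta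
  <= rq (choi S (adj (W c) *o W c)) eta.

Let sS : selfadj S. Proof. exact: oppos_selfadj. Qed.

Lemma choi_weight_expand (B : bop R 'I_n2 'I_n2) (t : R) eta : selfadj B ->
  rq (choi S (adj (weight B t) *o weight B t)) eta =
  rq (choi S (idop R _)) eta + 2 * t * rq (choi S B) eta + t ^+ 2 * rq (choi S (B *o B)) eta.
Proof.
move=> sB.
have -> : adj (weight B t) *o weight B t =
    idop R _ + (2 * t)%:C%C *: B + (t ^+ 2)%:C%C *: (B *o B).
  rewrite /weight adjD adj_scale adj_id sB conjc_real; apply: bopP => u.
  rewrite -[LHS]/((u + t%:C%C *: B u) + t%:C%C *: B (u + t%:C%C *: B u)).
  rewrite -[RHS]/(u + (2 * t)%:C%C *: B u + (t ^+ 2)%:C%C *: B (B u)).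
  rewrite linearD linearZ scalerDr scalerA -rmorphM -expr2 mulrDl mul1r rmorphD scalerDl.
  by rewrite !addrA.
by rewrite !choiD !choiZ !rqD !rqZ.
Qed.

(** [X], [Y], [Z] are the coefficients of [1], [t], [t^2] in the cut inequality. [t -> 0] gives the
    sign of [X]; once [X = 0], dividing by [t] isolates [Y]. *)
Let X (eta : ell2 R 'I_n1) := rq (choi S (idop R _)) eta - sq eta.
Let Y j (eta : ell2 R 'I_n1) := 2 * (rq (choi S (b j)) eta - rq (a j) eta).
Let Z j (eta : ell2 R 'I_n1) := rq (choi S (b j *o b j)) eta + sq eta.

Let cutXYZ c eta : 0 <= X eta + step b c * Y c.1.1 eta + step b c ^+ 2 * Z c.1.1 eta.
Proof.
have := Scut c eta; rewrite (choi_weight_expand _ _ (sb c.1.1)) /X /Y /Z.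
move: (rq (choi S (idop R _)) eta) (rq (choi S (b _)) eta) (rq (choi S _) eta).
by move: (rq (a _) eta) (sq eta) (step b c) => x y t p q r; lra.
Qed.

Let X0 eta : 0 <= X eta.
Proof.
have [d d0 dE] := stepE b; pose j := Ordinal hk.
apply: (@quad_lim R _ (Y j eta) (Z j eta) d) => n.
by have := cutXYZ (j, n, true) eta; rewrite dE.
Qed.

Lemma rq_id (I : choiceType) (u : ell2 R I) : rq (idop R I) u = sq u.
Proof. by rewrite sqRe. Qed.

Let P := choi S (idop R _) - idop R 'I_n1.

Let sP : selfadj P.
Proof.
have h : selfadj (choi S (idop R 'I_n2)) by rewrite /selfadj (adj_choi _ sS) adj_id.
exact: (selfadjB h (adj_id _ _)).
Qed.

Let P_psd : oppos P.
Proof. by apply/opposP; split=> [|u]; [exact: sP|rewrite rqB rq_id; exact: X0]. Qed.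

(** The Choi matrix of [psi2 - psi1 o Phi]. *)
Let D := idtens P2 om - idtens P1 S.

Let blockB (I J : choiceType) (T T' : bop R (I * J)%type (I * J)%type) u v :
  block (T - T') u v = block T u v - block T' u v.
Proof. by apply: bopP => x; rewrite blockE bopDE bopNE linearB. Qed.

(** The diagonal blocks of [D] add up to [psi2 1 - psi1 (Phi 1)], which is [- psi1 (Phi 1 - 1)]
    because both maps are unital. The left side is nonnegative and the right side nonpositive, so
    both vanish. *)
Let D_diag x : \sum_u rq D (injop R 'I_m u x) = - rq (P1 P) x.
Proof.
have -> : \sum_u rq D (injop R 'I_m u x) = rq (\sum_u block D u u) x.
  by rewrite rq_sum; apply: eq_bigr => u _; rewrite rq_block.
have -> : \sum_u block D u u = P2 (idop R _) - P1 (choi S (idop R _)).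
  rewrite choi1 -rank1_id (linear_sum P2) (linear_sum P1) -sumrB; apply: eq_bigr => u _.
  by rewrite /D blockB !block_idtens block_omega.
have -> : P2 (idop R _) = P1 (idop R _) by rewrite [LHS](u2.1) [RHS](u1.1).
by rewrite -linearB -opprB linearN /rq bopNE ipNl raddfN.
Qed.

Let P1P : P1 P = 0.
Proof.
have pP := ucp_pos u1 P_psd.
have [sPP PP0] := (opposP _).1 pP.
apply: selfadj_rq0 => // x; apply/eqP; rewrite eq_le; apply/andP; split; last exact: PP0.
rewrite -oppr_ge0 -D_diag; apply: sumr_ge0 => u _.
by have [_] := (opposP _).1 SP; apply.
Qed.

Let choi_unit : choi S (idop R _) = idop R 'I_n1.
Proof. by apply/eqP; rewrite -subr_eq0; apply/eqP; exact: (f1 P_psd P1P). Qed.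

Let D0 : D = 0.
Proof.
apply: bop_deltaP => -[u x] y; rewrite -inj_delta.
have : rq D (injop R 'I_m u (delta R x)) = 0.
  have D_ge0 u' : 0 <= rq D (injop R 'I_m u' (delta R x)).
    by have [_] := (opposP _).1 SP; apply.
  apply/eqP; rewrite eq_le D_ge0 andbT.
  apply: le_trans (@ler_term _ _ (fun u' => rq D (injop R 'I_m u' (delta R x))) u D_ge0) _.
  by rewrite D_diag P1P /rq bop0E ip0l oppr0.
by move=> /(psd_rq0 SP) ->.
Qed.

Let choi_psi T : P1 (choi S T) = P2 T.
Proof.
have h u v : P2 (rank1 (delta R u) (delta R v)) = P1 (block S u v).
  have := congr1 (fun T => block T u v) D0; rewrite /D blockB !block_idtens block_omega.
  move=> e; apply/eqP; rewrite -subr_eq0; apply/eqP; rewrite e.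
  by apply: bopP => x; rewrite blockE bop0E linear0.
rewrite [T in RHS]bop_expand /choi !linear_sum; apply: eq_bigr => u _.
rewrite !linear_sum; apply: eq_bigr => v _; rewrite !linearZ h.
by congr (_ *: _); rewrite ip_delta.
Qed.

Let choi_b j : choi S (b j) = a j.
Proof.
have X00 eta : X eta = 0 by rewrite /X choi_unit rq_id subrr.
have h : selfadj (choi S (b j)) by rewrite /selfadj (adj_choi _ sS) (sb j).
apply: (selfadj_rq_eq h (sa j)) => eta.
have [d d0 dE] := stepE b.
have h1 : 0 <= Y j eta.
  apply: (@quad_lim1 R _ (Z j eta) d d0) => n.
  by have := cutXYZ (j, n, true) eta; rewrite X00 add0r dE.
(* The cuts with negative [t] give the opposite sign. *)
have h2 : 0 <= - Y j eta.
  apply: (@quad_lim1 R _ (Z j eta) d d0) => n.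
  have := cutXYZ (j, n, false) eta; rewrite X00 add0r dE /=.
  by rewrite !mulNr sqrrN mulrN.
move: h1 h2; rewrite /Y; lra.
Qed.

Lemma kraus_of_choi : exists al, kraus al.
Proof.
have [al hal] := choi_psd S0; exists al; split.
- rewrite -choi_unit hal; apply: eq_bigr => v _; exact: bopP.
- by move=> j; rewrite -hal choi_b.
- by move=> T; rewrite -hal choi_psi.
Qed.

End Kraus.

(** * From Kraus operators to majorization *)

Section Sufficiency.
Variable R : realType.

Lemma opsum_unique (N I J : choiceType) (T : N -> bop R I J) (S S' : bop R I J) :
  opsum T S -> opsum T S' -> S = S'.
Proof.
move=> h h'; apply: bop_ipP => u v.
exact: (tendsto_unique (opsum_weak h u v) (opsum_weak h' u v)).
Qed.

Lemma block_sum (I I' J J' : choiceType) (K : Type) (s : seq K)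
    (f : K -> bop R (I * J)%type (I' * J')%type) u v :
  block (\sum_(t <- s) f t) u v = \sum_(t <- s) block (f t) u v.
Proof.
apply: bopP => x; rewrite blockE !bop_sumE.
rewrite (_ : rowop R J' u (\sum_(t <- s) f t (injop R J v x)) =
  \sum_(t <- s) rowop R J' u (f t (injop R J v x))); last exact: linear_sum.
by [].
Qed.

Lemma ampl_sum (I J J' : choiceType) (K : Type) (s : seq K) (f : K -> bop R J J') :
  ampl I (\sum_(t <- s) f t) = \sum_(t <- s) ampl I (f t).
Proof.
elim: s => [|t s IH].
  rewrite !big_nil; have := amplZ I 0 (0 : bop R J J'); rewrite !scale0r; exact.
by rewrite !big_cons amplD IH.
Qed.

(** * Finite direct sums and isometric columns *)

Section DirectSum.
Variables (l n : nat).

(** The inclusion of the [i]-th summand. [mxvec_index] flattens pairs because a finite level is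
    indexed by an ordinal, not by a product. *)
Definition inc (i : 'I_l) : bop R 'I_n 'I_(l * n) :=
  \sum_u rank1 (delta R (mxvec_index i u)) (delta R u).

Lemma inc_delta i u : inc i (delta R u) = delta R (mxvec_index i u).
Proof.
rewrite /inc bop_sumE (@big_delta _ _ u) => [|v vu].
  by rewrite rank1E ip_delta deltaE eqxx scale1r.
by rewrite rank1E ip_delta deltaE (negPf vu) scale0r.
Qed.

Lemma mxvec_index_eq (i i' : 'I_l) (u u' : 'I_n) :
  (mxvec_index i u == mxvec_index i' u') = (i == i') && (u == u').
Proof.
apply/eqP/andP => [e|[/eqP-> /eqP->]//].
have [g gK _] := curry_mxvec_bij l n.
have e2 : (i, u) = (i', u') by rewrite -(gK (i, u) isT) -(gK (i', u') isT) /= e.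
by case: e2 => -> ->.
Qed.

Lemma adj_inc_delta i i' u :
  adj (inc i) (delta R (mxvec_index i' u)) = if i == i' then delta R u else 0.
Proof.
apply: ell2P => v; rewrite -ip_delta -adjPr inc_delta ip_delta deltaE mxvec_index_eq.
case: (i == i') => //; rewrite andTb deltaE eq_sym.
Qed.

Lemma adj_inc_inc i i' : adj (inc i) *o inc i' = if i == i' then idop R _ else 0.
Proof.
apply: bop_deltaP => u v; rewrite -[LHS]/(adj (inc i) (inc i' (delta R u)) v).
by rewrite inc_delta adj_inc_delta; case: (i == i').
Qed.

Lemma inc_adj_inc : \sum_i inc i *o adj (inc i) = idop R _.
Proof.
apply: bop_deltaP => x v; case/mxvec_indexP: x => i u.
rewrite bop_sumE (@big_delta _ _ i) => [|i' /negPf ii].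
  by rewrite -[(inc i *o _) _]/(inc i (adj (inc i) _)) adj_inc_delta eqxx inc_delta.
by rewrite -[(inc i' *o _) _]/(inc i' (adj (inc i') _)) adj_inc_delta ii linear0.
Qed.

Lemma sq_adj_inc u : \sum_i sq (adj (inc i) u) = sq u.
Proof.
have -> : sq u = rq (\sum_i inc i *o adj (inc i)) u by rewrite inc_adj_inc sqRe.
rewrite rq_sum; apply: eq_bigr => i _.
by rewrite sqRe /rq -[ip ((inc i *o _) u) u]/(ip (inc i (adj (inc i) u)) u) [in RHS]adjP.
Qed.

Lemma sq_sum_inc (x : 'I_l -> ell2 R 'I_n) : sq (\sum_i inc i (x i)) = \sum_i sq (x i).
Proof.
rewrite -sq_adj_inc; apply: eq_bigr => i _; congr sq.
rewrite linear_sum (@big_delta _ _ i) => [|i' /negPf ii].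
  by rewrite -[LHS]/((adj (inc i) *o inc i) (x i)) adj_inc_inc eqxx.
by rewrite -[LHS]/((adj (inc i) *o inc i') (x i')) adj_inc_inc eq_sym ii.
Qed.

Definition dsum (X : bop R 'I_n 'I_n) : bop R 'I_(l * n) 'I_(l * n) :=
  \sum_i inc i *o X *o adj (inc i).

Definition dcol (I : choiceType) (al : 'I_l -> bop R I 'I_n) : bop R I 'I_(l * n) :=
  \sum_i inc i *o al i.

Lemma adj_inc_dcol (I : choiceType) (al : 'I_l -> bop R I 'I_n) i :
  adj (inc i) *o dcol al = al i.
Proof.
apply: bopP => x; rewrite -[LHS]/(adj (inc i) (dcol al x)) /dcol bop_sumE linear_sum.
rewrite (@big_delta _ _ i) => [|i' /negPf ii].
  by rewrite -[LHS]/((adj (inc i) *o inc i) (al i x)) adj_inc_inc eqxx.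
by rewrite -[LHS]/((adj (inc i) *o inc i') (al i' x)) adj_inc_inc eq_sym ii.
Qed.

Lemma dsumE X w : dsum X w = \sum_i inc i (X (adj (inc i) w)).
Proof. by rewrite /dsum bop_sumE. Qed.

Lemma dcol_dsum (I : choiceType) (al : 'I_l -> bop R I 'I_n) X :
  adj (dcol al) *o dsum X *o dcol al = \sum_i adj (al i) *o X *o al i.
Proof.
apply: bopP => x; rewrite -[LHS]/(adj (dcol al) (dsum X (dcol al x))).
rewrite dsumE linear_sum bop_sumE; apply: eq_bigr => i _.
rewrite -[LHS]/((adj (dcol al) *o inc i) (X ((adj (inc i) *o dcol al) x))).
by rewrite adj_inc_dcol -[inc i]adjK -adj_comp adj_inc_dcol.
Qed.

Lemma dcol_isometry (I : choiceType) (al : 'I_l -> bop R I 'I_n) :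
  \sum_i adj (al i) *o al i = idop R I -> adj (dcol al) *o dcol al = idop R I.
Proof.
move=> s1; have := dcol_dsum al (idop R _).
have -> : dsum (idop R _) = idop R _.
  by rewrite -inc_adj_inc /dsum; apply: eq_bigr => i _; apply: bopP.
have -> : adj (dcol al) *o idop R 'I_(l * n) *o dcol al = adj (dcol al) *o dcol al by exact: bopP.
by move=> ->; rewrite -s1; apply: eq_bigr => i _; apply: bopP.
Qed.

End DirectSum.

Section Affine.
Variables (k n1 n2 : nat) (hn1 : (0 < n1)%N) (hn2 : (0 < n2)%N).
Variables (a : tuples R k (Fin hn1)) (b : tuples R k (Fin hn2)) (rho : R).
Variables (l : nat) (al : 'I_l.+1 -> bop R 'I_n1 'I_n2).
Hypothesis al1 : \sum_i adj (al i) *o al i = idop R 'I_n1.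
Hypothesis alb : forall j, \sum_i adj (al i) *o b j *o al i = a j.
Hypothesis bball : ncball rho b.

Let hn : (0 < l.+1 * n2)%N. Proof. by rewrite muln_gt0. Qed.
Let y : tuples R k (Fin hn) := fun j => dsum l.+1 (b j).

Let yball : ncball rho y.
Proof.
apply/ncball_adjP => u.
have yE j : sq (adj (y j) u) = \sum_i sq (adj (b j) (adj (inc n2 i) u)).
  rewrite /y /dsum adj_sum bop_sumE -sq_sum_inc; congr sq; apply: eq_bigr => i _.
  by rewrite !adj_comp adjK.
under eq_bigr do rewrite yE.
rewrite exchange_big -(sq_adj_inc (u : ell2 R 'I_(l.+1 * n2))) mulr_sumr; apply: ler_sum => i _.
exact: (ncball_adjP rho b).1 bball _.
Qed.

(** [f] is first evaluated at the direct sum [y] of copies of [b], a sum along the isometries [inc],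
    and then compressed by the isometry [dcol al], which takes [y] to [a]. *)
Lemma affine_kraus (f : ncfun R k) : affine_nc rho f ->
  f (Fin hn1) a = \sum_i adj (al i) *o f (Fin hn2) b *o al i.
Proof.
move=> [f1 f2].
have fy : f (Fin hn) y = dsum l.+1 (f (Fin hn2) b).
  apply: (@opsum_unique 'I_l.+1 _ _ (fun i => inc n2 i *o f (Fin hn2) b *o adj (inc n2 i))).
    apply: (f1 (Fin (ltn0Sn l)) (Fin hn) (fun=> Fin hn2) (fun=> b) (fun i => inc n2 i) y).
    - by move=> _.
    - exists (\sum_j opnorm (b j)) => _ j.
      by apply: (@ler_term _ _ (fun j => opnorm (b j))) => ?; exact: opnorm_ge0.
    - by move=> i; rewrite /isometry_op adj_inc_inc eqxx.
    - by rewrite -inc_adj_inc; exact: opsum_fin.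
    - by move=> j; exact: opsum_fin.
  exact: opsum_fin.
rewrite -dcol_dsum -fy -(f2 _ (Fin hn1) y (dcol al) yball (dcol_isometry al1)).
by congr f; apply/funext => j; rewrite -alb -dcol_dsum.
Qed.

Lemma ip_evalmx (s p : nat) (h : 'I_s -> 'I_s -> 'I_p -> 'I_p -> ncfun R k) (n : ncdim)
    (x : tuples R k n) z w :
  ip (evalmx h x z) w = \sum_s1 \sum_s2 \sum_p1 \sum_p2
    ip (h s1 s2 p1 p2 n x (rowop R _ p2 (rowop R _ s2 z)))
       (rowop R _ p1 (rowop R _ s1 w)).
Proof.
rewrite /evalmx ip_prod; apply: eq_bigr => s1 _.
rewrite row_blockop ip_suml; apply: eq_bigr => s2 _.
rewrite ip_prod; apply: eq_bigr => p1 _.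
by rewrite row_blockop ip_suml.
Qed.

Lemma evalmx_kraus (s p : nat) (h : 'I_s -> 'I_s -> 'I_p -> 'I_p -> ncfun R k) z :
  (forall s1 s2 p1 p2, affine_nc rho (h s1 s2 p1 p2)) ->
  ip (evalmx h a z) z = \sum_i
    ip (evalmx h b (ampl 'I_s (ampl 'I_p (al i)) z)) (ampl 'I_s (ampl 'I_p (al i)) z).
Proof.
move=> hf; under [RHS]eq_bigr do rewrite ip_evalmx.
rewrite ip_evalmx; do 4!(rewrite [RHS]exchange_big; apply: eq_bigr => ? _).
rewrite (affine_kraus (hf _ _ _ _)) bop_sumE ip_suml; apply: eq_bigr => i _.
rewrite !row_ampl -[in RHS](adjK (al i)) -adjP adjK.
by [].
Qed.

End Affine.
End Sufficiency.

Lemma ip_conj (R : realType) (I J : choiceType) (T : bop R J J) (V : bop R I J) u v :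
  ip ((adj V *o T *o V) u) v = ip (T (V u)) (V v).
Proof. by rewrite -[LHS]/(ip (adj V (T (V u))) v) -adjPr. Qed.

(** * Equivalence of both conditions with the existence of Kraus operators *)

Section Main.
Variable R : realType.
Variables (m n1 n2 k : nat).
Hypotheses (hm : (0 < m)%N) (hn1 : (0 < n1)%N) (hn2 : (0 < n2)%N) (hk : (0 < k)%N).
Variables (psi1 : {linear opM R (Fin hn1) (Fin hn1) -> opM R (Fin hm) (Fin hm)})
          (psi2 : {linear opM R (Fin hn2) (Fin hn2) -> opM R (Fin hm) (Fin hm)}).
Variables (a : tuples R k (Fin hn1)) (b : tuples R k (Fin hn2)) (rho : R).
Hypotheses (u1 : ucp psi1) (u2 : ucp psi2) (f1 : faithful psi1).
Hypotheses (sa : forall j, selfadj (a j)) (sb : forall j, selfadj (b j)).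
Hypotheses (rho0 : 0 < rho) (aball : ncball rho a) (bball : ncball rho b).

Definition kraus_ord (l : nat) (al : 'I_l.+1 -> opM R (Fin hn2) (Fin hn1)) : Prop :=
  [/\ \sum_i adj (al i) *o al i = idop R (idx (Fin hn1)),
      forall j, \sum_i adj (al i) *o b j *o al i = a j &
      forall Y, psi1 (\sum_i adj (al i) *o Y *o al i) = psi2 Y].

Lemma kraus_seq_ord al : kraus psi1 psi2 a b al -> exists l al', @kraus_ord l al'.
Proof.
(* A zero operator is prepended: it changes no sum and makes the index set nonempty, as a dimension
   in [ncdim] must be. *)
move=> [k1 k2 k3]; exists (size al), (fun i => nth 0 (0 :: al) i).
have E (V : nmodType) (f : bop R 'I_n1 'I_n2 -> V) : f 0 = 0 ->
    \sum_(i < (size al).+1) f (nth 0 (0 :: al) i) = \sum_(v <- al) f v.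
  move=> f0; rewrite big_ord_recl f0 add0r (big_nth 0) big_mkord.
  by apply: eq_bigr => i _.
split.
- by rewrite -k1 (E _ (fun v => adj v *o v))//; apply: bopP => x; rewrite adj0.
- move=> j; rewrite -k2 (E _ (fun v => adj v *o b j *o v))//.
  by apply: bopP => x; rewrite adj0.
- move=> Y; rewrite -k3 (E _ (fun v => adj v *o Y *o v))//.
  by apply: bopP => x; rewrite adj0.
Qed.

(** [p] may be infinite. The predicates defining the two [xget] agree for every [S], so their values
    agree without any appeal to existence or uniqueness. *)
Lemma kraus_idtens (p : choiceType) l (al : 'I_l.+1 -> opM R (Fin hn2) (Fin hn1))
    (T : bop R (p * idx (Fin hn2))%type (p * idx (Fin hn2))%type) : kraus_ord al ->
  idtens psi1 (\sum_i ampl p (adj (al i)) *o T *o ampl p (al i)) = idtens psi2 T.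
Proof.
move=> [_ _ k3]; rewrite /idtens; congr xget; apply/funext => S.
apply/propext; split=> h u v.
  rewrite h block_sum -k3; congr (psi1 _); apply: eq_bigr => i _; exact: block_ampl.
rewrite h block_sum -k3; congr (psi1 _); apply: eq_bigr => i _; exact: esym (block_ampl _ _ _ _ _).
Qed.

Lemma kraus_maj l (al : 'I_l.+1 -> opM R (Fin hn2) (Fin hn1)) :
  kraus_ord al -> nc_maj psi1 psi2 a b.
Proof.
move=> kal r r0 ar br p F [_ _ _ cF] _ [T FT <-].
have [k1 k2 _] := kal.
have [_ FS] := mv_convex_fin cF br FT k1.
exists (idtens psi2 T); last exact: ople_refl.
exists (\sum_i ampl (idx p) (adj (al i)) *o T *o ampl (idx p) (al i)).
  rewrite -[a](_ : (fun j => \sum_i adj (al i) *o b j *o al i) = a)//.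
  by apply/funext => j; exact: k2.
exact: kraus_idtens.
Qed.

Lemma kraus_cut l (al : 'I_l.+1 -> opM R (Fin hn2) (Fin hn1)) (p : nat) (hp : (0 < p)%N)
    (q : nat) (r : 'I_q -> nat)
    (h : forall i : 'I_q, 'I_(r i) -> 'I_(r i) -> 'I_p -> 'I_p -> ncfun R k) :
  kraus_ord al -> (forall i s t u v, cont_affine rho (h i s t u v)) ->
  setle (idtens psi1 @` cutmap hp h (Fin hn1) a) (idtens psi2 @` cutmap hp h (Fin hn2) b).
Proof.
move=> kal hh _ [T GT <-]; have [k1 k2 _] := kal.
exists (idtens psi2 T); last exact: ople_refl.
exists (\sum_i ampl (idx (Fin hp)) (adj (al i)) *o T *o ampl (idx (Fin hp)) (al i)); last first.
  exact: kraus_idtens.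
move=> i _; have [sT hT] := GT i I.
split.
  by apply: selfadj_sum => j; rewrite -adj_ampl; exact: selfadj_conj.
move=> z.
rewrite -[inner _ _]/(ip _ _) bopDE bopNE ipBl.
rewrite (evalmx_kraus k1 k2 bball) => [|s1 s2 p1 p2]; last by case: (hh i s1 s2 p1 p2).
(* The difference of the two sides at [a] is a sum over the Kraus operators of the corresponding
   nonnegative differences at [b]. *)
rewrite ampl_sum bop_sumE ip_suml -sumrB; apply: sumr_ge0 => j _.
have := hT (ampl 'I_(r i) (ampl 'I_p (al j)) z).
rewrite -[inner _ _]/(ip _ _) bopDE bopNE ipBl.
rewrite !ampl_comp -[ampl (idx (Fin hp)) (adj (al j))]adj_ampl.
by rewrite -[ampl _ (adj (ampl _ _))]adj_ampl ip_conj.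
Qed.

Lemma kraus_exists :
  (forall N, exists S : bop R ('I_n2 * 'I_n1)%type ('I_n2 * 'I_n1)%type,
     @testmap R n2 k hn2 hk b N _ a S /\
     ople (idtens psi1 S) (idtens psi2 (rank1 (omega R n2) (omega R n2)))) ->
  exists l al, @kraus_ord l al.
Proof.
move=> /(limit_choi u1 f1 sb)[S [S0 Sc SP]].
have [al kal] := kraus_of_choi hk u1 u2 f1 sa sb S0 SP Sc.
exact: kraus_seq_ord kal.
Qed.

Lemma kraus_of_maj : nc_maj psi1 psi2 a b -> exists l al, @kraus_ord l al.
Proof.
move=> maj; apply: kraus_exists => N.
have hA (i : 'I_N.+1) := @cut_A_herm R n2 k hn2 b i.
have hB (i : 'I_N.+1) := @cut_B_herm R n2 k hn2 b i.
have [lam0 l0 mj] := trunccut_majorization hn2 (ltn0Sn N)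
  (fun i : 'I_N.+1 => cut_j hk i) hA hB rho0.
have [lam1 tb] := pencut_trunc (ltn0Sn N) hA hB (testmap_omega hk b (N := N)).
(* [lam0] makes the truncation an nc majorization function, and [lam1] keeps [rank1 omega omega] in
   its value at [b]. *)
pose lam := Num.max lam0 lam1.
have [||_ [S FS <-] SP] := maj rho rho0 aball bball (Fin hn2) _ (mj lam _)
   (idtens psi2 (rank1 (omega R n2) (omega R n2))).
- by rewrite le_max lexx.
- by exists (rank1 (omega R n2) (omega R n2)) => //; apply: tb; rewrite le_max lexx orbT.
by exists S; split=> //; exact: (trunccut_sub (ltn0Sn N) hA hB FS).
Qed.

Lemma kraus_of_cuts :
  (forall (p : nat) (hp : (0 < p)%N), (p <= 2 * n2 ^ 2 + 2)%N ->
   forall (q : nat) (r : 'I_q -> nat), (0 < q)%N -> (forall i, (0 < r i)%N) ->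
   forall h : (forall i : 'I_q, 'I_(r i) -> 'I_(r i) -> 'I_p -> 'I_p -> ncfun R k),
   (forall i s t u v, cont_affine rho (h i s t u v)) ->
   let G := cutmap hp h in
   mv_nc rho G ->
   setle (idtens psi1 @` G (Fin hn1) a) (idtens psi2 @` G (Fin hn2) b)) ->
  exists l al, @kraus_ord l al.
Proof.
move=> cuts; apply: kraus_exists => N.
have hA (i : 'I_N.+1) := @cut_A_herm R n2 k hn2 b i.
have hB (i : 'I_N.+1) := @cut_B_herm R n2 k hn2 b i.
(* The test cuts have [p = r_i = n2], which lies in the allowed range. *)
have n2le : (n2 <= 2 * n2 ^ 2 + 2)%N.
  by rewrite (leq_trans _ (leq_addr _ _))// mulnC -mulnA leq_pmulr// muln_gt0 hn2.
have := cuts n2 hn2 n2le N.+1 (fun=> n2) (ltn0Sn N) (fun=> hn2)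
  (pencut (fun i : 'I_N.+1 => cut_j hk i) (fun i => cut_A b i) (fun i => cut_B b i)).
move=> /(_ (fun _ _ _ _ _ => pen_cont_affine _ _ _ _)) /=.
move=> /(_ (pencutmap_nc hn2 (ltn0Sn N) _ hA hB rho0)).
move=> /(_ (idtens psi2 (rank1 (omega R n2) (omega R n2))))[].
  by exists (rank1 (omega R n2) (omega R n2)) => //; exact: (testmap_omega hk b (N := N)).
by move=> _ [S GS <-] SP; exists S.
Qed.

End Main.

Theorem theorem7p1 (R : realType) (m n1 n2 k : nat)
    (hm : (0 < m)%N) (hn1 : (0 < n1)%N) (hn2 : (0 < n2)%N) (hk : (0 < k)%N)
    (psi1 : {linear opM R (Fin hn1) (Fin hn1) -> opM R (Fin hm) (Fin hm)})
    (psi2 : {linear opM R (Fin hn2) (Fin hn2) -> opM R (Fin hm) (Fin hm)})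
    (a : tuples R k (Fin hn1)) (b : tuples R k (Fin hn2)) (rho : R) :
  ucp psi1 -> ucp psi2 -> faithful psi1 ->
  (forall j, selfadj (a j)) -> (forall j, selfadj (b j)) ->
  0 < rho -> ncball rho a -> ncball rho b ->
  nc_maj psi1 psi2 a b <->
  (forall (p : nat) (hp : (0 < p)%N), (p <= 2 * n2 ^ 2 + 2)%N ->
   forall (q : nat) (r : 'I_q -> nat), (0 < q)%N -> (forall i, (0 < r i)%N) ->
   forall h : (forall i : 'I_q, 'I_(r i) -> 'I_(r i) -> 'I_p -> 'I_p -> ncfun R k),
   (forall i s t u v, cont_affine rho (h i s t u v)) ->
   let G := cutmap hp h in
   mv_nc rho G ->
   setle (idtens psi1 @` G (Fin hn1) a) (idtens psi2 @` G (Fin hn2) b)).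
Proof.
move=> u1 u2 f1 sa sb rho0 aball bball; split.
  move=> /(kraus_of_maj hk u1 u2 f1 sa sb rho0 aball bball)[l [al kal]].
  by move=> p hp _ q r _ _ h hh G _; exact: (kraus_cut bball kal hh).
move=> /(kraus_of_cuts hk u1 u2 f1 sa sb rho0)[l [al kal]].
exact: kraus_maj kal.
Qed.
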